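(* For each $n\ge1$ let $(x_i,y_i)_{i=1}^{2n}$ be i.i.d. observations from the single-index model $y_i=f_i(\langle x_i,\tau\rangle)$ with $x_i\sim\mathcal{E}(0,\Sigma,F_v)$ i.i.d. (elliptically symmetric) in $\mathbf{R}^p$, and let $\mu,\beta,z_i,\gamma,r_i$ and the debiased estimator $\tilde\beta_1$ be as defined in the context (known $\Sigma$). Let $$\nu^2=\frac{\mathbf{E}[r_n^2z_n^2]}{(\mathbf{E}[r_n^2])^2}.$$ Assume: 1. $\|x_i\|_{\psi_2}\le\sigma_x$ with $\sigma_x$ uniformly (over $n$) bounded above. 2. The sparsity $s=\|\beta\|_0$ satisfies $s=o\big(\tfrac{n}{\log^2(p)}\big)$. 3. There exist $0<c,C<\infty$ (not depending on $n$) such that $c\le\lambda_{\min}(\Sigma)\le\lambda_{\max}(\Sigma)\le C$. 4. $\mathbf{E}|y_n|^{2+\alpha}\le M<\infty$ for some $\alpha,M>0$ and all $n\ge1$. 5. The pilot estimator $\hat\beta$ satisfies $\|\hat\beta-\beta\|_2\lesssim\sqrt{\frac{s\log(p)}{n}}$ with probability $1-o(1)$. Then $$\sqrt n(\tilde\beta_1-\beta_1)=\nu\cdot\Xi_n,\qquad\text{where }\Xi_n\to_dN(0,1)\text{ as }n\to\infty.$$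
   Context: Asymptotic setting: $p$, $\Sigma$, $F_v$, $\tau$ and the law of the random link function may depend on $n$; ''constants'' do not. $t_n\lesssim s_n$ means $t_n\le c\,s_n$ for some constant $c>0$ not depending on $n$ ($\gtrsim$ is the reverse). Elliptical symmetry: $x\sim\mathcal{E}(0,\Sigma,F_v)$ means $x\stackrel{d}{=}vBU$ where the random variable $v\in\mathbf{R}$ has distribution $F_v$, $U$ is uniform on the unit sphere $\mathbb{S}^{p-1}$ and independent of $v$, and $\Sigma=BB^T$; it is assumed that $\mathbf{E}[v^2]=p$, so that $\mathbf{E}[xx^T]=\Sigma$. A centered random vector $x$ satisfies $\|x\|_{\psi_2}\le\sigma$ if $\|\langle u,x\rangle\|_{\psi_2}\le\sigma$ for all unit vectors $u$. Model: $f_i:\mathbf{R}\to\mathbf{R}$ are i.i.d. realizations of an unknown random function $f$, independent of the $x_i$ (equivalently $y_i=f(\langle x_i,\tau\rangle,u_i)$ for a deterministic measurable $f$ and i.i.d. uniform $u_i$ independent of the $x_i$); $\Sigma$ is positive definite and $\tau\in\mathbf{R}^p$ is normalized so that $\|\Sigma^{1/2}\tau\|_2=1$. Put $\mu:=\mathbf{E}[y_n\langle x_n,\tau\rangle]$, assumed nonzero, $\beta:=\mu\tau$, and $z_i:=y_i-\langle x_i,\beta\rangle$. Write $x_{i,1}$ for the first coordinate of $x_i$ and $x_{i,-1}\in\mathbf{R}^{p-1}$ for the remaining ones. Let $\gamma:=(\mathbf{E}[x_{n,-1}x_{n,-1}^T])^{-1}\mathbf{E}[x_{n,-1}x_{n,1}]$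 and $r_i:=x_{i,1}-\langle\gamma,x_{i,-1}\rangle$. Pilot estimator (second half of the sample): $$\hat\beta\in\arg\min_{\beta'}\Big\{\tfrac1{2n}\sum_{i=n+1}^{2n}(y_i-\langle x_i,\beta'\rangle)^2+\lambda\|\beta'\|_1\Big\},\qquad\lambda\gtrsim\sigma_x\sigma_z\sqrt{\log(p)/n},$$ where $\sigma_x,\sigma_z$ are the subgaussian constants of $x_n$ and $z_n$. Debiased estimator (first half): $$\tilde\beta_1:=\hat\beta_1+\frac{\sum_{i=1}^nr_i(y_i-\langle x_i,\hat\beta\rangle)}{\sum_{i=1}^nr_ix_{i,1}}.$$
   Formalization: The formal theorem also assumes that ν is bounded below by a positive constant not depending on n; without this the claim fails, e.g. for a noiseless linear link, where ν = 0 but the debiased estimator has nonzero error. *)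

(* Defs.v *)
From HB Require Import structures.
From mathcomp Require Import all_boot all_order all_algebra.
From mathcomp Require Import all_classical all_reals all_analysis.

Set Implicit Arguments.
Unset Strict Implicit.
Unset Printing Implicit Defensive.

Import Order.TTheory GRing.Theory Num.Theory.
Import numFieldNormedType.Exports.

Local Open Scope classical_set_scope.
Local Open Scope ring_scope.

(* The Borel sigma-algebra on matrices, generated by the coordinate maps, so
   that random vectors are [{RV P >-> 'cV[R]_p}]. *)

Definition matrix_display : measure_display.
Proof. exact: default_measure_display. Qed.

Section measurable_matrix.
Variables (R : realType) (m n : nat).

Definition matrix_measurable : set_system 'M[R]_(m, n) :=
  <<s \bigcup_(ij in [set: 'I_m * 'I_n])
        preimage_set_system setT (fun M : 'M[R]_(m, n) => M ij.1 ij.2)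
          measurable >>.

Let matrix_measurable0 : matrix_measurable set0.
Proof. exact: sigma_algebra0. Qed.

Let matrix_measurableC A : matrix_measurable A -> matrix_measurable (~` A).
Proof. exact: sigma_algebraC. Qed.

Let matrix_measurable_bigcup (F : (set 'M[R]_(m, n))^nat) :
  (forall i, matrix_measurable (F i)) -> matrix_measurable (\bigcup_i F i).
Proof. exact: sigma_algebra_bigcup. Qed.

HB.instance Definition _ := @isMeasurable.Build matrix_display 'M[R]_(m, n)
  matrix_measurable matrix_measurable0 matrix_measurableC
  matrix_measurable_bigcup.

End measurable_matrix.

Section linear_algebra.
Variable R : realType.

Definition dotv p (a b : 'cV[R]_p) : R := \sum_(j < p) a j 0 * b j 0.

Definition norm2 p (a : 'cV[R]_p) : R := Num.sqrt (dotv a a).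

Definition norm1 p (a : 'cV[R]_p) : R := \sum_(j < p) `|a j 0|.

Definition norm0 p (a : 'cV[R]_p) : nat := #|[pred j | a j 0 != 0]|.

Definition symmetric_mx p (S : 'M[R]_p) := S^T = S.

Definition pos_def p (S : 'M[R]_p) :=
  symmetric_mx S /\ forall v : 'cV[R]_p, v != 0 -> 0 < dotv v (S *m v).

Definition pos_semidef p (S : 'M[R]_p) :=
  symmetric_mx S /\ forall v : 'cV[R]_p, 0 <= dotv v (S *m v).

(* [H] is the matrix square root S^{1/2} *)
Definition is_sqrt_mx p (S H : 'M[R]_p) := pos_semidef H /\ H *m H = S.

(* Used only for symmetric matrices of positive size, whose set of eigenvalues
   is finite and nonempty. *)
Definition lambda_min p (S : 'M[R]_p) : R := inf [set a | eigenvalue S a].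
Definition lambda_max p (S : 'M[R]_p) : R := sup [set a | eigenvalue S a].

Definition fst_coord q (x : 'cV[R]_q.+1) : R := x ord0 ord0.
Definition other_coords q (x : 'cV[R]_q.+1) : 'cV[R]_q := row' ord0 x.

(* The Lasso criterion for the [n x p] design [X] and responses [Y]. *)
Definition lasso_objective n p (lam : R) (X : 'M[R]_(n, p)) (Y : 'cV[R]_n)
    (b : 'cV[R]_p) : R :=
  (2 * n%:R)^-1 * (\sum_(i < n) (Y i 0 - (X *m b) i 0) ^+ 2) + lam * norm1 b.

Definition lasso_argmin n p (lam : R) (X : 'M[R]_(n, p)) (Y : 'cV[R]_n) :
    set 'cV[R]_p :=
  [set b | forall b', lasso_objective lam X Y b <= lasso_objective lam X Y b'].

End linear_algebra.

Section probability.
Variables (R : realType) (d : measure_display) (T : measurableType d).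
Variable P : probability T R.

Definition mx_expectation m n (M : T -> 'M[R]_(m, n)) : 'M[R]_(m, n) :=
  \matrix_(i, j) fine 'E_P[fun w => M w i j].

Definition psi2_norm (X : T -> R) : \bar R :=
  ereal_inf [set t%:E | t in
    [set t : R | 0 < t /\ ('E_P[fun w => expR ((X w / t) ^+ 2)] <= 2%:E)%E]].

Definition psi2_norm_vec_le p (X : T -> 'cV[R]_p) (s : R) :=
  forall v : 'cV[R]_p, norm2 v = 1 ->
    (psi2_norm (fun w => dotv v (X w)) <= s%:E)%E.

(* Mutual independence of a finite family of sigma-algebras.  As each [G i]
   contains [setT], the product rule for all subfamilies is included. *)
Definition mutually_independent (I : finType) (G : I -> set_system T) :=
  forall E : I -> set T, (forall i, G i (E i)) ->
    P (\bigcap_(i in [set: I]) E i) = (\prod_(i : I) P (E i))%E.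

Definition identically_distributed d' (S : measurableType d') (X Y : T -> S) :=
  forall A : set S, measurable A -> P (X @^-1` A) = P (Y @^-1` A).

(* The uniform law on the unit sphere is the rotation-invariant one. *)
Definition uniform_on_sphere p (U : T -> 'cV[R]_p) :=
  P [set w | norm2 (U w) = 1] = 1%E /\
  forall Q : 'M[R]_p, Q *m Q^T = 1%:M ->
    identically_distributed U (fun w => Q *m U w).

End probability.

Section elliptical.
Variables (R : realType) (d : measure_display) (T : measurableType d).
Variable P : probability T R.

(* X ~ E(0, Sigma, Fv); the representation v B U lives on some auxiliary
   probability space. *)
Definition elliptical p (X : T -> 'cV[R]_p) (Sigma : 'M[R]_p)
    (Fv : probability (measurableTypeR R) R) :=
  (\int[Fv]_t ((t ^+ 2)%:E) = p%:R%:E)%E /\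
  exists (d' : measure_display) (T' : measurableType d') (P' : probability T' R)
    (v : {RV P' >-> R}) (U : {RV P' >-> 'cV[R]_p}) (B : 'M[R]_p),
    [/\ Sigma = B *m B^T,
        forall A : set R, measurable A -> P' (v @^-1` A) = Fv A,
        uniform_on_sphere P' U,
        forall (A : set R) (C : set 'cV[R]_p), measurable A -> measurable C ->
          P' (v @^-1` A `&` U @^-1` C) = (P' (v @^-1` A) * P' (U @^-1` C))%E &
        forall A : set 'cV[R]_p, measurable A ->
          P (X @^-1` A) = P' ((fun w => v w *: (B *m U w)) @^-1` A)].

End elliptical.

(* Observations are numbered from 1.  A sample of size [N] of the single-index
   model: the random link of the i-th observation is [f (_, u i)], where [u i]
   is uniform on [0, 1], and the [x i] and [u i], for 1 <= i <= N, are all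
   mutually independent. *)
Record single_index_sample (R : realType) (d : measure_display)
    (T : measurableType d) (P : probability T R) (N p : nat)
    (Sigma : 'M[R]_p) (Fv : probability (measurableTypeR R) R) (tau : 'cV[R]_p)
    (f : R * R -> R) (x : nat -> {RV P >-> 'cV[R]_p}) (u : nat -> {RV P >-> R})
    (y : nat -> {RV P >-> R}) : Prop := SingleIndexSample {
  sis_pos_def : pos_def Sigma ;
  sis_tau : exists2 H, is_sqrt_mx Sigma H & norm2 (H *m tau) = 1 ;
  sis_elliptical : forall i, (0 < i <= N)%N -> elliptical P (x i) Sigma Fv ;
  sis_x_id : forall i j, (0 < i <= N)%N -> (0 < j <= N)%N ->
    identically_distributed P (x i) (x j) ;
  sis_u_uniform : forall i, (0 < i <= N)%N ->
    forall A : set R, measurable A ->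
      P (u i @^-1` A) = uniform_prob (@ltr01 R) A ;
  sis_independent : mutually_independent P
    (fun k : 'I_N + 'I_N => match k with
      | inl i => g_sigma_algebra_preimage (x i.+1)
      | inr i => g_sigma_algebra_preimage (u i.+1)
      end) ;
  sis_link_measurable : measurable_fun setT f ;
  sis_model : forall i, (0 < i <= N)%N ->
    forall w, y i w = f (dotv (x i w) tau, u i w)
}.

Section debiasing.
Variables (R : realType) (d : measure_display) (T : measurableType d).
Variable P : probability T R.

(* In this section [X : T -> 'cV_p] and [Y : T -> R] are one observation. *)

Definition index_mu p (tau : 'cV[R]_p) (X : T -> 'cV[R]_p) (Y : T -> R) : R :=
  fine 'E_P[fun w => Y w * dotv (X w) tau].

Definition index_beta p (tau : 'cV[R]_p) (X : T -> 'cV[R]_p) (Y : T -> R) :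
    'cV[R]_p :=
  index_mu tau X Y *: tau.

Definition index_z p (beta : 'cV[R]_p) (X : T -> 'cV[R]_p) (Y : T -> R) :
    T -> R :=
  fun w => Y w - dotv (X w) beta.

Definition nodewise_gamma q (X : T -> 'cV[R]_q.+1) : 'cV[R]_q :=
  invmx (mx_expectation P
    (fun w => other_coords (X w) *m (other_coords (X w))^T)) *m
  mx_expectation P (fun w => fst_coord (X w) *: other_coords (X w)).

Definition nodewise_r q (gamma : 'cV[R]_q) (X : T -> 'cV[R]_q.+1) : T -> R :=
  fun w => fst_coord (X w) - dotv gamma (other_coords (X w)).

(* nu, the nonnegative root of nu^2 = E[r^2 z^2] / (E[r^2])^2 *)
Definition asymptotic_sd (r z : T -> R) : R :=
  Num.sqrt (fine 'E_P[fun w => r w ^+ 2 * z w ^+ 2] /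
            (fine 'E_P[fun w => r w ^+ 2]) ^+ 2).

(* Observations n+1, ..., 2n *)
Definition pilot_design n p (x : nat -> T -> 'cV[R]_p) (w : T) :
    'M[R]_(n, p) :=
  \matrix_(i < n, j < p) x (n + i.+1)%N w j 0.

Definition pilot_response n (y : nat -> T -> R) (w : T) : 'cV[R]_n :=
  \col_(i < n) y (n + i.+1)%N w.

(* Observations 1, ..., n *)
Definition debiased n q (gamma : 'cV[R]_q) (x : nat -> T -> 'cV[R]_q.+1)
    (y : nat -> T -> R) (bhat : T -> 'cV[R]_q.+1) : T -> R :=
  fun w =>
    fst_coord (bhat w) +
    (\sum_(1 <= i < n.+1)
       nodewise_r gamma (x i) w * (y i w - dotv (x i w) (bhat w))) /
    (\sum_(1 <= i < n.+1) nodewise_r gamma (x i) w * fst_coord (x i w)).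

End debiasing.

(* Convergence in distribution: the distribution functions converge at every
   continuity point of the limit one. *)
Definition cvg_in_distribution (R : realType) (d : nat -> measure_display)
    (T : forall n, measurableType (d n)) (P : forall n, probability (T n) R)
    (X : forall n, {RV P n >-> R}) (mu : probability (measurableTypeR R) R) :=
  forall a : R, {for a, continuous (fun t : R => mu `]-oo, t]%classic)} ->
    (fun n => cdf (X n) a) @ \oo --> mu `]-oo, a]%classic.

(* Main.v *)
(* Let [a] be the direction with [r = <a, x>], and let [D] be the pilot error
   [bhat - beta] with its first coordinate deleted. Since the debiasing step cancels
   the first coordinate of the pilot error,
     [(btilde - beta)_1 * sum r_i x_i1 = sum r_i z_i - sum r_i <x_i, D>].
   The reflection fixing [tau] preserves the law of an elliptical [x], which makes
   [z] uncorrelated with every linear form in [x], so [E (r z) = 0]; and [r] is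
   uncorrelated with the coordinates of [x] that [D] involves. As [D] depends only
   on the second half of the sample, conditioning on it bounds the variance of
   [n^(-1/2) sum r_i <x_i, D>] by [O(|D|^2) = O(s log p / n)], which tends to 0, and
   Chebyshev's inequality gives [(1/n) sum r_i x_i1 = E r^2 + o(1)]. The main term
   [n^(-1/2) sum r_i z_i] is asymptotically normal by Stein's method, with Mills
   ratio bounds for the solution of Stein's equation; the Lindeberg tails are
   controlled by the [2 + alpha] moment of [y] and the even moments of [x]. *)

(* The law of an observation, and even the probability space, change with [n], so the central limit
   step must be an inequality at fixed [n] whose constants come from moments alone. Stein's method
   gives one: the test function is a ramp between two nearby levels, so its Stein solution does not
   depend on [n], and the spare moments make the tails above a fixed truncation level [L] small
   uniformly in [n].

   Conditioning on the pilot error requires a bounded vector, while the pilot bound holds only with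
   probability tending to one. The error is therefore replaced by 0 outside the good event; it
   remains a function of the second half, and the discarded event enters only through its
   probability.

   Division by [nu] is controlled because [nu >= cnu] and [E r^2 >= c] bound the standard deviation
   of [r z] below by [cnu * c]. The eigenvalue assumption is used as a bound on quadratic forms, so
   the smallest eigenvalue of a symmetric matrix has to be compared with the minimum of its Rayleigh
   quotient. *)
Require Import Defs.
From HB Require Import structures.
From mathcomp Require Import all_boot all_order all_algebra.
From mathcomp Require Import all_classical all_reals all_analysis.
From mathcomp Require Import measurable_realfun ring lra.
Import Order.TTheory GRing.Theory Num.Theory.
Import numFieldNormedType.Exports.

Local Open Scope classical_set_scope.
Local Open Scope ring_scope.

Set Implicit Arguments.
Unset Strict Implicit.
Unset Printing Implicit Defensive.

(** * Real-valued expectations and probabilities *)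

Section expectation_calculus.
Context {R : realType} {d : measure_display} {T : measurableType d}.
Variable P : probability T R.
Implicit Types X Y : T -> R.

Definition L1 X := P.-integrable setT (EFin \o X).
(** Real values let [lra] and [nra] do the estimates. The price is that an infinite integral is
    silently sent to 0, so the linearity rules carry [L1] side conditions. *)
Definition Ex X : R := (\int[P]_w X w)%R.
Definition Pr (A : set T) : R := fine (P A).

Lemma fine_expectation X : fine 'E_P[X]%E = Ex X.
Proof. by rewrite unlock. Qed.

Lemma L1_measurable X : L1 X -> measurable_fun setT X.
Proof. by move=> /measurable_int/measurable_EFinP. Qed.

Lemma L1_expectation X : L1 X -> ('E_P[X] = (Ex X)%:E)%E.
Proof. by move=> iX; rewrite unlock -[LHS]fineK//; exact: integrable_fin_num. Qed.

Lemma L1_dom X Y : measurable_fun setT X -> L1 Y ->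
  (forall w, `|X w| <= Y w) -> L1 X.
Proof.
move=> mX iY XY; apply: (@le_integrable _ _ _ _ _ measurableT _ (EFin \o Y)) => //.
  exact/measurable_EFinP.
by move=> w _ /=; rewrite lee_fin (le_trans (XY w))// ler_norm.
Qed.

Lemma L1_cst k : L1 (fun=> k).
Proof.
apply/integrableP; split; first exact: measurable_cst.
by rewrite integral_cst//= probability_setT mule1 ltry.
Qed.

Lemma L1_bounded X k : measurable_fun setT X -> (forall w, `|X w| <= k) -> L1 X.
Proof. by move=> mX Xk; exact: L1_dom mX (L1_cst k) Xk. Qed.

Lemma L1D X Y : L1 X -> L1 Y -> L1 (fun w => X w + Y w).
Proof.
move=> iX iY; have := integrableD measurableT iX iY.
by rewrite /L1; under [X in _ -> _.-integrable _ X]eq_fun do rewrite /= EFinD.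
Qed.

Lemma L1Z k X : L1 X -> L1 (fun w => k * X w).
Proof.
move=> iX; have := integrableZl measurableT k iX.
by rewrite /L1; under [X in _ -> _.-integrable _ X]eq_fun do rewrite /= EFinM.
Qed.

Lemma L1N X : L1 X -> L1 (fun w => - X w).
Proof. by move=> /(L1Z (-1)); congr L1; apply/funext => w; rewrite mulN1r. Qed.

Lemma L1B X Y : L1 X -> L1 Y -> L1 (fun w => X w - Y w).
Proof. by move=> iX /L1N; exact: L1D. Qed.

Lemma L1_norm X : L1 X -> L1 (fun w => `|X w|).
Proof.
move=> iX; have := integrable_norm iX.
by rewrite /L1; under [X in _ -> _.-integrable _ X]eq_fun do rewrite /=.
Qed.

Lemma L1_sum I (s : seq I) (F : I -> T -> R) :
  (forall i, L1 (F i)) -> L1 (fun w => \sum_(i <- s) F i w).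
Proof.
move=> iF; elim: s => [|i s IH].
  by under eq_fun do rewrite big_nil; exact: L1_cst.
by under eq_fun do rewrite big_cons; exact: L1D.
Qed.

Lemma ExD X Y : L1 X -> L1 Y -> Ex (fun w => X w + Y w) = Ex X + Ex Y.
Proof. by move=> iX iY; exact: RintegralD. Qed.

Lemma ExB X Y : L1 X -> L1 Y -> Ex (fun w => X w - Y w) = Ex X - Ex Y.
Proof. by move=> iX iY; exact: RintegralB. Qed.

Lemma ExZ k X : L1 X -> Ex (fun w => k * X w) = k * Ex X.
Proof. by move=> iX; exact: RintegralZl. Qed.

Lemma Ex_cst k : Ex (fun=> k) = k.
Proof.
by rewrite /Ex /Rintegral integral_cst//= probability_setT mule1.
Qed.

Lemma Ex_sum I (s : seq I) (F : I -> T -> R) : (forall i, L1 (F i)) ->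
  Ex (fun w => \sum_(i <- s) F i w) = \sum_(i <- s) Ex (F i).
Proof.
move=> iF; elim: s => [|i s IH].
  by rewrite big_nil; under [X in Ex X]eq_fun do rewrite big_nil; rewrite Ex_cst.
rewrite big_cons; under [X in Ex X]eq_fun do rewrite big_cons.
by rewrite ExD ?IH//; exact: L1_sum.
Qed.

Lemma le_Ex X Y : L1 X -> L1 Y -> (forall w, X w <= Y w) -> Ex X <= Ex Y.
Proof. by move=> iX iY XY; apply: le_Rintegral. Qed.

Lemma Ex_ge0 X : (forall w, 0 <= X w) -> 0 <= Ex X.
Proof. by move=> X0; apply: Rintegral_ge0. Qed.

Lemma norm_Ex X : L1 X -> `|Ex X| <= Ex (fun w => `|X w|).
Proof. by move=> iX; apply: le_normr_Rintegral. Qed.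

Lemma Pr_fin A : measurable A -> (P A = (Pr A)%:E)%E.
Proof. by move=> mA; rewrite fineK// fin_num_measure. Qed.

Lemma le_Pr A B : measurable A -> measurable B -> A `<=` B -> Pr A <= Pr B.
Proof.
by move=> mA mB AB; rewrite -lee_fin -!Pr_fin//; apply: le_measure; rewrite ?inE.
Qed.

Lemma Pr_setU A B : measurable A -> measurable B -> Pr (A `|` B) <= Pr A + Pr B.
Proof.
move=> mA mB; have mAB : measurable (A `|` B) by exact: measurableU.
by rewrite -lee_fin EFinD -!Pr_fin//; exact: measureU2.
Qed.

Lemma Pr_setC A : measurable A -> Pr (~` A) = 1 - Pr A.
Proof.
move=> mA; have mC : measurable (~` A) by exact: measurableC.
by apply: EFin_inj; rewrite EFinB -!Pr_fin// probability_setC.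
Qed.

Lemma L1_indic A : measurable A -> L1 (\1_A).
Proof.
by move=> mA; apply: (@L1_bounded _ 1) => // w; rewrite indicE; case: (_ \in _);
  rewrite ?normr1 ?normr0.
Qed.

Lemma Ex_indic A : measurable A -> Ex (\1_A) = Pr A.
Proof.
by move=> mA; rewrite /Ex /Rintegral integral_indic// setIT.
Qed.

Lemma Ex_markov X A e : measurable A -> L1 X -> (forall w, 0 <= X w) -> 0 < e ->
  (forall w, A w -> e <= X w) -> Pr A <= Ex X / e.
Proof.
move=> mA iX X0 e0 Xe; rewrite ler_pdivlMr// mulrC -Ex_indic// -ExZ; last first.
  exact: L1_indic.
apply: le_Ex => //; first exact/L1Z/L1_indic.
move=> w; rewrite indicE; have [|] := boolP (w \in A).
  by rewrite inE mulr1 => /Xe.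
by rewrite mulr0.
Qed.

Lemma L1M_sqr X Y : measurable_fun setT X -> measurable_fun setT Y ->
  L1 (fun w => X w ^+ 2) -> L1 (fun w => Y w ^+ 2) -> L1 (fun w => X w * Y w).
Proof.
move=> mX mY iX iY; apply: (L1_dom (measurable_funM mX mY) (L1D iX iY)) => w.
rewrite normrM -(real_normK (num_real (X w))) -(real_normK (num_real (Y w))).
have := sqr_ge0 (`|X w| - `|Y w|); have := normr_ge0 (X w); have := normr_ge0 (Y w).
by nra.
Qed.

Lemma L1_sqr X : measurable_fun setT X -> L1 (fun w => X w ^+ 2) -> L1 X.
Proof.
move=> mX iX; apply: (L1_dom mX (L1D (L1_cst 1) iX)) => w.
rewrite -(real_normK (num_real (X w))).
by have := sqr_ge0 (`|X w| - 1); have := normr_ge0 (X w); nra.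
Qed.

End expectation_calculus.

(** The identity [t^-1 = t * (|t|^-1)^2] reduces inversion to a real power of the absolute value. It
    survives [t = 0], where the inverse is 0 by convention and the first factor vanishes. *)
Lemma measurable_fun_inv (R : realType) (d : measure_display)
    (T : measurableType d) (f : T -> R) :
  measurable_fun setT f -> measurable_fun setT (fun w => (f w)^-1).
Proof.
move=> mf; rewrite (_ : (fun w => _) = fun w => f w * (`|f w| `^ (-1)) ^+ 2).
  apply: measurable_funM => //; apply: measurable_funX.
  exact: (measurableT_comp (measurable_powR (-1)) (measurableT_comp (@normr_measurable R setT) mf)).
apply/funext => w; rewrite powR_inv1// exprVn real_normK ?num_real//.
have [->|fw] := eqVneq (f w) 0; first by rewrite invr0 mul0r.
by field.
Qed.

(** * Independence of sigma-algebras and of random variables *)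

Section independence.
Context {R : realType} {d : measure_display} {T : measurableType d}.
Variable P : probability T R.

(** Uniqueness of finite measures on a pi-system: the restriction of [P] to [B] and the measure [P]
    scaled by [P B] agree on [G], hence on the sigma-algebra that it generates. *)
Lemma indep_sigma (G : set_system T) (B : set T) :
    G `<=` measurable -> setI_closed G -> G setT -> measurable B ->
    (forall A, G A -> P (A `&` B) = (P A * P B)%E) ->
  forall A, <<s G >> A -> P (A `&` B) = (P A * P B)%E.
Proof.
move=> Gm GI GT mB GB A sA.
have PB0 : 0 <= fine (P B) by rewrite fine_ge0.
have HE : [set X | G X /\ X `<=` setT] = G.
  by apply/seteqP; split => [X []|X GX].
pose m2 : {measure set T -> \bar R} := mscale (NngNum PB0) P.
have mscE X : m2 X = (P X * P B)%E.
  by rewrite muleC -[in RHS](@fineK _ (P B)) ?fin_num_measure.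
have := @g_sigma_algebra_measure_unique_trace _ R T G setT measurableT.
rewrite HE => /(_ Gm GI (mrestr P mB) m2) E; rewrite -mscE; apply: E => //.
- by rewrite mscE; exact: GB.
- by move=> X GX; rewrite mscE; exact: GB.
- change (P (setT `&` B) < +oo)%E.
  by rewrite setTI (le_lt_trans (probability_le1 _ _)) ?ltry.
Qed.

Definition gen_sigma (I : Type) (G : I -> set_system T) (J : set I) :=
  <<s \bigcup_(i in J) G i >>.

(** A block is generated by the pi-system of intersections whose factors outside the block are
    trivial. For disjoint blocks each index has a nontrivial factor on at most one side, so the
    product rule splits; [indep_sigma] then extends it one block at a time. *)
Lemma indep_blocks (I : finType) (G : I -> set_system T) (J K : set I) :
    (forall i, G i setT) -> (forall i, setI_closed (G i)) ->
    (forall i, G i `<=` measurable) ->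
    mutually_independent P G -> (forall i, J i -> K i -> False) ->
  forall A B, gen_sigma G J A -> gen_sigma G K B ->
    P (A `&` B) = (P A * P B)%E.
Proof.
move=> GT GI Gm GP JK.
pose pi_ (L : set I) := [set A | exists2 E : I -> set T,
  (forall i, G i (E i)) & (forall i, ~ L i -> E i = setT) /\
    A = \bigcap_(i in [set: I]) E i].
have piI L : setI_closed (pi_ L).
  move=> _ _ [E GE [EL ->]] [F GF [FL ->]]; exists (fun i => E i `&` F i).
    by move=> i; exact: GI.
  split; first by move=> i nL; rewrite EL// FL// setTI.
  by rewrite bigcapI.
have piT L : pi_ L setT.
  by exists (fun=> setT); [exact: GT|split=> //; rewrite bigcapT].
have pim L : pi_ L `<=` measurable.
  move=> _ [E GE [_ ->]]; apply: fin_bigcap_measurable => // i _.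
  exact/Gm/GE.
have genpi L : gen_sigma G L `<=` <<s pi_ L >>.
  apply: sub_smallest2r; first exact: smallest_sigma_algebra.
  move=> A [i Li GA].
  exists (fun j => if j == i then A else setT).
    by move=> j; case: eqVneq => [->|].
  split; first by move=> j nL; case: eqVneq => // ji; rewrite ji in nL.
  apply/seteqP; split => [w Aw j _|w /(_ i Logic.I)]; last by rewrite eqxx.
  by case: eqVneq.
have pipi A B : pi_ J A -> pi_ K B -> P (A `&` B) = (P A * P B)%E.
  move=> [E GE [EJ ->]] [F GF [FK ->]]; rewrite -bigcapI !GP// -?big_split/=.
    apply: eq_bigr => i _; have [Ji|nJi] := pselect (J i).
      by rewrite FK ?setIT ?probability_setT ?mule1// => /(JK _ Ji).
    by rewrite EJ// setTI probability_setT mul1e.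
  by move=> i; exact: GI.
have mK B : gen_sigma G K B -> measurable B.
  move=> sB; have : <<s pi_ K >> B by exact: genpi.
  by apply: smallest_sub; [exact: sigma_algebra_measurable|exact: pim].
have mJ B : gen_sigma G J B -> measurable B.
  move=> sB; have : <<s pi_ J >> B by exact: genpi.
  by apply: smallest_sub; [exact: sigma_algebra_measurable|exact: pim].
move=> A B sA sB.
apply: (indep_sigma (pim J) (piI J) (piT J) (mK _ sB)); last exact: genpi.
move=> {sA}A pA; rewrite setIC muleC.
apply: (indep_sigma (pim K) (piI K) (piT K) (pim _ _ pA)); last exact: genpi.
by move=> {sB}B pB; rewrite setIC muleC; exact: pipi.
Qed.

Definition indep_fun d1 d2 (S1 : measurableType d1) (S2 : measurableType d2)
    (X : T -> S1) (Y : T -> S2) := forall A B, measurable A -> measurable B ->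
  P (X @^-1` A `&` Y @^-1` B) = (P (X @^-1` A) * P (Y @^-1` B))%E.

Lemma indep_fun_comp d1 d2 d3 d4 (S1 : measurableType d1) (S2 : measurableType d2)
    (S3 : measurableType d3) (S4 : measurableType d4)
    (X : T -> S1) (Y : T -> S2) (f : S1 -> S3) (g : S2 -> S4) :
  measurable_fun setT f -> measurable_fun setT g ->
  indep_fun X Y -> indep_fun (f \o X) (g \o Y).
Proof.
move=> mf mg XY A B mA mB; apply: (XY (f @^-1` A) (g @^-1` B)).
  by rewrite -[X in measurable X]setTI; exact: mf.
by rewrite -[X in measurable X]setTI; exact: mg.
Qed.

End independence.

(** * Equality in law across probability spaces *)

Section same_law.
Context {R : realType} {d d' : measure_display}.
Context {T : measurableType d} {T' : measurableType d'}.
Variables (P : probability T R) (P' : probability T' R).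

Definition same_law ds (S : measurableType ds) (X : T -> S) (Y : T' -> S) :=
  forall A, measurable A -> P (X @^-1` A) = P' (Y @^-1` A).

Lemma same_law_comp ds ds' (S : measurableType ds) (S' : measurableType ds')
    (X : T -> S) (Y : T' -> S) (f : S -> S') : measurable_fun setT f ->
  same_law X Y -> same_law (f \o X) (f \o Y).
Proof.
move=> mf XY A mA; apply: (XY (f @^-1` A)).
by rewrite -[X in measurable X]setTI; exact: mf.
Qed.

Lemma same_law_integral ds (S : measurableType ds) (X : T -> S) (Y : T' -> S)
    (f : S -> \bar R) : measurable_fun setT X -> measurable_fun setT Y ->
    measurable_fun setT f -> (forall s, 0 <= f s)%E -> same_law X Y ->
  (\int[P]_w f (X w) = \int[P']_w f (Y w))%E.
Proof.
move=> mX mY mf f0 XY.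
pose X' : {mfun T >-> S} := HB.pack X (isMeasurableFun.Build _ _ _ _ X mX).
pose Y' : {mfun T' >-> S} := HB.pack Y (isMeasurableFun.Build _ _ _ _ Y mY).
rewrite -(@ge0_integral_distribution _ _ _ _ _ P X')//.
rewrite -(@ge0_integral_distribution _ _ _ _ _ P' Y')//.
by apply: eq_measure_integral => A mA _; exact: XY.
Qed.

Lemma same_law_L1 ds (S : measurableType ds) (X : T -> S) (Y : T' -> S)
    (f : S -> R) : measurable_fun setT X -> measurable_fun setT Y ->
    measurable_fun setT f -> same_law X Y -> L1 P (f \o X) -> L1 P' (f \o Y).
Proof.
move=> mX mY mf XY /integrableP[mfX foo]; apply/integrableP; split.
  by apply/measurable_EFinP; exact: measurableT_comp.
rewrite -(same_law_integral (f := fun s => `|(f s)%:E|%E) mX)//.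
exact/measurableT_comp/measurable_EFinP.
Qed.

Lemma same_law_Ex ds (S : measurableType ds) (X : T -> S) (Y : T' -> S)
    (f : S -> R) : measurable_fun setT X -> measurable_fun setT Y ->
    measurable_fun setT f -> same_law X Y -> L1 P (f \o X) ->
  Ex P (f \o X) = Ex P' (f \o Y).
Proof.
move=> mX mY mf XY iX; have iY := same_law_L1 mX mY mf XY iX.
have mF : measurable_fun setT (EFin \o f) by exact/measurable_EFinP.
rewrite /Ex /Rintegral; congr fine.
pose X' : {mfun T >-> S} := HB.pack X (isMeasurableFun.Build _ _ _ _ X mX).
pose Y' : {mfun T' >-> S} := HB.pack Y (isMeasurableFun.Build _ _ _ _ Y mY).
transitivity (\int[distribution P X']_s (f s)%:E)%E.
  by rewrite (@integral_distribution _ _ _ _ _ P X').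
rewrite -[RHS](@integral_distribution _ _ _ _ _ P' Y' (EFin \o f))//.
by apply: eq_measure_integral => A mA _; exact: XY.
Qed.

End same_law.

(** * Joint laws and products of independent variables *)

Section product_law.
Context {R : realType} {d : measure_display} {T : measurableType d}.
Variable P : probability T R.
Context {d1 d2 : measure_display} {S1 : measurableType d1} {S2 : measurableType d2}.

Lemma indep_fun_law (X : {mfun T >-> S1}) (Y : {mfun T >-> S2})
    (XY : {mfun T >-> (S1 * S2)%type}) :
    (forall w, XY w = (X w, Y w)) -> indep_fun P X Y ->
  forall A, measurable A ->
    (distribution P X \x distribution P Y)%E A = distribution P XY A.
Proof.
move=> XYE iXY; apply: product_measure_unique => A B mA mB.
rewrite /distribution /pushforward -iXY//; congr (P _).
by apply/seteqP; split => w /=; rewrite XYE.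
Qed.

End product_law.

(** Independence makes each joint law the product of its marginals, and a product measure is
    determined by its values on rectangles. *)
Lemma same_law_pair (R : realType) (d d' : measure_display)
    (T : measurableType d) (T' : measurableType d')
    (P : probability T R) (P' : probability T' R)
    (d1 d2 : measure_display) (S1 : measurableType d1) (S2 : measurableType d2)
    (X : T -> S1) (Y : T -> S2) (X' : T' -> S1) (Y' : T' -> S2) :
    measurable_fun setT X -> measurable_fun setT Y ->
    measurable_fun setT X' -> measurable_fun setT Y' ->
    indep_fun P X Y -> indep_fun P' X' Y' ->
    same_law P P' X X' -> same_law P P' Y Y' ->
  same_law P P' (fun w => (X w, Y w)) (fun w => (X' w, Y' w)).
Proof.
move=> mX mY mX' mY' iXY iXY' XX' YY' A mA.
have mXY : measurable_fun setT (fun w => (X w, Y w)) by exact: measurable_fun_pair.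
have mXY' : measurable_fun setT (fun w => (X' w, Y' w)).
  exact: measurable_fun_pair.
pose hX : {mfun T >-> S1} := HB.pack X (isMeasurableFun.Build _ _ _ _ X mX).
pose hY : {mfun T >-> S2} := HB.pack Y (isMeasurableFun.Build _ _ _ _ Y mY).
pose hX' : {mfun T' >-> S1} := HB.pack X' (isMeasurableFun.Build _ _ _ _ X' mX').
pose hY' : {mfun T' >-> S2} := HB.pack Y' (isMeasurableFun.Build _ _ _ _ Y' mY').
pose hXY : {mfun T >-> (S1 * S2)%type} :=
  HB.pack (fun w => (X w, Y w)) (isMeasurableFun.Build _ _ _ _ _ mXY).
pose hXY' : {mfun T' >-> (S1 * S2)%type} :=
  HB.pack (fun w => (X' w, Y' w)) (isMeasurableFun.Build _ _ _ _ _ mXY').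
transitivity (distribution P hXY A) => //.
rewrite -(@indep_fun_law _ _ _ P _ _ _ _ hX hY hXY (fun=> erefl) iXY _ mA).
rewrite -[RHS]/(distribution P' hXY' A).
apply: product_measure_unique => // B C mB mC.
rewrite -[RHS]/(P (X @^-1` B) * P (Y @^-1` C))%E XX'// YY'// -iXY'//.
Qed.

Section product_expectation.
Context {R : realType} {d : measure_display} {T : measurableType d}.
Variable P : probability T R.

Lemma indep_fun_Ex (X Y : T -> R) : L1 P X -> L1 P Y -> indep_fun P X Y ->
  L1 P (fun w => X w * Y w) /\ Ex P (fun w => X w * Y w) = Ex P X * Ex P Y.
Proof.
move=> iX iY XY; have mX := L1_measurable iX; have mY := L1_measurable iY.
have mXY : measurable_fun setT (fun w => (X w, Y w)) by exact: measurable_fun_pair.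
pose hX : {mfun T >-> R} := HB.pack X (isMeasurableFun.Build _ _ _ _ X mX).
pose hY : {mfun T >-> R} := HB.pack Y (isMeasurableFun.Build _ _ _ _ Y mY).
pose hXY : {mfun T >-> (R * R)%type} :=
  HB.pack (fun w => (X w, Y w)) (isMeasurableFun.Build _ _ _ _ _ mXY).
have lawE := @indep_fun_law _ _ _ P _ _ _ _ hX hY hXY (fun=> erefl) XY.
pose f (z : R * R) := (z.1 * z.2)%:E.
have mf : measurable_fun setT f.
  by apply/measurable_EFinP; exact: measurable_funM.
have inte : (forall g : R * R -> \bar R, measurable_fun setT g ->
   (forall z, 0 <= g z) ->
   \int[P]_w g (X w, Y w) = \int[distribution P hX \x distribution P hY]_z g z)%E.
  move=> g mg g0.
  rewrite -[LHS](@ge0_integral_distribution _ _ _ _ _ P hXY g)//.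
  by apply: eq_measure_integral => A mA _; exact/esym/lawE.
have mabs : measurable_fun setT (fun z => `|f z|%E) by exact: measurableT_comp.
have abs0 z : (0 <= `|f z|)%E by exact: abse_ge0.
have mnorm : measurable_fun setT (fun r : R => (`|r|)%:E).
  by apply/measurable_EFinP; exact: normr_measurable.
have iabs (Z : T -> R) : L1 P Z -> (\int[P]_w `|(Z w)%:E| < +oo)%E.
  by move=> /integrableP[].
(* Tonelli on absolute values comes first: it supplies the integrability of the product that Fubini
   requires below. *)
have absM : (\int[P]_w `|(X w * Y w)%:E| < +oo)%E.
  rewrite (inte _ mabs abs0).
  rewrite fubini_tonelli1//=.
  rewrite /fubini_F /=.
  under eq_integral.
    move=> x _; under eq_integral do rewrite normrM EFinM.
    rewrite ge0_integralZl//.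
    over.
  rewrite /= ge0_integralZr//; last exact: integral_ge0.
  apply: lte_mul_pinfty => //.
  + exact: integral_ge0.
  + rewrite ge0_fin_numE ?integral_ge0//.
    rewrite (ge0_integral_distribution hX (f := fun r => (`|r|)%:E))//.
    exact: iabs.
  + rewrite (ge0_integral_distribution hY (f := fun r => (`|r|)%:E))//.
    exact: iabs.
have iXY : L1 P (fun w => X w * Y w).
  by apply/integrableP; split => //; apply/measurable_EFinP/measurable_funM.
split => //.
have iprod : ((distribution P hX \x distribution P hY)%E).-integrable setT f.
  apply/integrableP; split => //.
  by rewrite -(inte _ mabs abs0).
have mid : measurable_fun setT (EFin : R -> \bar R) by exact/measurable_EFinP.
have idX : (distribution P hX).-integrable setT (EFin : R -> \bar R).
  apply/integrableP; split => //.
  rewrite (ge0_integral_distribution hX (f := fun r => (`|r|)%:E))//.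
  exact: iabs.
have idY : (distribution P hY).-integrable setT (EFin : R -> \bar R).
  apply/integrableP; split => //.
  rewrite (ge0_integral_distribution hY (f := fun r => (`|r|)%:E))//.
  exact: iabs.
have EX : (\int[distribution P hX]_x x%:E = (Ex P X)%:E)%E.
  by rewrite (@integral_distribution _ _ _ _ _ P hX EFin)// -L1_expectation// unlock.
have EY : (\int[distribution P hY]_x x%:E = (Ex P Y)%:E)%E.
  by rewrite (@integral_distribution _ _ _ _ _ P hY EFin)// -L1_expectation// unlock.
apply: EFin_inj; rewrite EFinM -EX -EY -L1_expectation// unlock.
transitivity (\int[distribution P hX \x distribution P hY]_z f z)%E.
  rewrite -[LHS](@integral_distribution _ _ _ _ _ P hXY f)//.
  by apply: eq_measure_integral => A mA _; exact/esym/lawE.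
rewrite -integral12_prod_meas1// /fubini_F /f /=.
under eq_integral.
  move=> x _; under eq_integral do rewrite EFinM.
  rewrite integralZl// EY.
  over.
by rewrite /= integralZr// EY.
Qed.

End product_expectation.

Lemma is_derive_mvt (R : realType) (f df : R -> R) :
    (forall x : R, is_derive x 1 f (df x)) ->
  forall x y, x <= y -> exists2 c, x <= c <= y & f y - f x = df c * (y - x).
Proof.
move=> fdf x y xy.
have cf : {within `[x, y], continuous f}.
  apply: continuous_subspaceT => z; apply: differentiable_continuous.
  by apply/derivable1_diffP; have [] := fdf z.
have [c + ->] := MVT_segment xy (fun z _ => fdf z) cf.
by rewrite in_itv /= => cxy; exists c.
Qed.

Lemma is_derive_lipschitz (R : realType) (f df : R -> R) (B : R) :
    (forall x : R, is_derive x 1 f (df x)) -> (forall x, `|df x| <= B) ->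
  forall x y, `|f x - f y| <= B * `|x - y|.
Proof.
move=> fdf dfB x y; wlog xy : x y / x <= y.
  by move=> H; case/orP: (le_total x y) => [|/H]; [exact: H|rewrite distrC (distrC y)].
have [c _] := is_derive_mvt fdf xy; rewrite distrC (distrC x) => ->.
by rewrite normrM ler_wpM2r.
Qed.

(** * The Gaussian density and Mills ratio bounds *)

Section gaussian_tail.
Context {R : realType}.
Local Notation phi := (normal_pdf (0 : R) 1).

Lemma phiE x : phi x = normal_peak 1 * expR (- x ^+ 2 / 2).
Proof.
by rewrite normal_pdfE ?oner_neq0// /normal_fun subr0 expr1n.
Qed.

Lemma phi_gt0 x : 0 < phi x.
Proof. by rewrite phiE mulr_gt0 ?expR_gt0// normal_peak_gt0 ?oner_neq0. Qed.

Lemma phi_le x : phi x <= normal_peak 1.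
Proof. exact/normal_pdf_ub/oner_neq0. Qed.

Lemma phiN x : phi (- x) = phi x.
Proof. by rewrite !phiE sqrrN. Qed.

Lemma is_derive_phi (x : R) : is_derive x 1 phi (- x * phi x).
Proof.
rewrite [X in is_derive _ _ X](_ : _ = fun x => normal_peak 1 * expR (- x ^+ 2 / 2)).
  by apply: is_derive_eq; rewrite phiE /GRing.scale /=; field.
by apply/funext => y; rewrite phiE.
Qed.

(** [K] stands for either Gaussian tail, [Phi x] or [1 - Phi (- x)]: both are nonnegative primitives
    of the density that get arbitrarily small on the left, so one proof serves both tails. *)
Variable K : R -> R.
Hypothesis K0 : forall x, 0 <= K x.
Hypothesis K_inf : forall e x : R, 0 < e -> exists2 y, y < x & K y < e.
Hypothesis dK : forall x : R, is_derive x 1 K (phi x).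

(** [D] increases, its derivative being [2 * phi / (1 + x^2)^2], and its lower limit at minus
    infinity is nonnegative because [K] is and the density is bounded. Hence [D] cannot be
    negative. *)
Lemma mills_lower (x : R) : x <= -1 -> - x / (1 + x ^+ 2) * phi x <= K x.
Proof.
move=> x1; pose D x := K x + x / (1 + x ^+ 2) * phi x.
have dn (z : R) : 1 + z ^+ 2 != 0 by rewrite gt_eqF// ltr_pwDl// sqr_ge0.
have dD (z : R) : is_derive z 1 D (2 * phi z / (1 + z ^+ 2) ^+ 2).
  have := is_derive_phi z => dphi.
  have dz := dn z.
  by apply: is_derive_eq; rewrite /GRing.scale /=; field.
suff : 0 <= D x by rewrite /D; lra.
rewrite leNgt; apply/negP => Dx.
pose c : R := normal_peak 1.
have c0 : 0 < c by rewrite normal_peak_gt0 ?oner_neq0.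
(* So far to the left that the crude bound [D y >= - c / |y|] exceeds [D x], against
   monotonicity. *)
pose y := x - c / - D x.
have cD0 : 0 < c / - D x by rewrite divr_gt0// oppr_gt0.
have yx : y <= x by rewrite /y; lra.
have [z _] := is_derive_mvt dD yx.
have : 0 <= 2 * phi z / (1 + z ^+ 2) ^+ 2 * (x - y).
  rewrite mulr_ge0//; last by rewrite subr_ge0.
  by rewrite divr_ge0// ?sqr_ge0// mulr_ge0// ltW// phi_gt0.
move=> + E; rewrite -E subr_ge0 => Dyx.
have y0 : y < 0 by lra.
have : c < y * D x.
  rewrite /y mulrBl invrN mulrN mulNr opprK mulfVK ?lt_eqF//.
  have : 0 < x * D x by rewrite nmulr_rgt0//; lra.
  lra.
have : - c / (- y) <= D y.
  have Ky := K0 y; rewrite /D.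
  have : - c / - y <= y / (1 + y ^+ 2) * phi y.
    rewrite -subr_ge0.
    have -> : y / (1 + y ^+ 2) * phi y - - c / - y =
      (y ^+ 2 * (phi y - c) - c) / (y * (1 + y ^+ 2)).
      by have := dn y => dy; field; rewrite dy lt_eqF.
    rewrite mulr_le0 ?invr_le0//.
      have := phi_le y; have := sqr_ge0 y; rewrite -/c => y2 pc.
      by have : y ^+ 2 * (phi y - c) <= 0; [rewrite mulr_ge0_le0// subr_le0|lra].
    by rewrite nmulr_rle0// addr_ge0// sqr_ge0.
  lra.
rewrite mulNr invrN mulrN opprK ler_ndivrMr//.
have := ler_wnM2l (ltW y0) Dyx; lra.
Qed.

(** Here [D] has derivative [phi / x^2] on the negative axis, and its first term is positive there.
    If [D x] were negative, a point further left with [K] below [- D x] would give [D] a larger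
    value than at [x]. *)
Lemma mills_upper (x : R) : x <= -1 -> K x <= - phi x / x.
Proof.
move=> x1; pose D x := - (phi x / x) - K x.
have dD (z : R) : z != 0 -> is_derive z 1 D (phi z / z ^+ 2).
  move=> z0; have := is_derive_phi z => dphi.
  have dinv : is_derive z 1 (fun z : R => z^-1) (- (z ^- 2) *: 1).
    split; first exact: (@derivableV _ _ (fun z : R => z)).
    by rewrite (@deriveV _ _ (fun z : R => z))// derive_id.
  by apply: is_derive_eq; rewrite /GRing.scale /=; field.
suff : 0 <= D x by rewrite /D mulNr; lra.
rewrite leNgt; apply/negP => Dx.
have [|y yx Ky] := @K_inf (- D x) x; first by rewrite oppr_gt0.
have cD : {within `[y, x], continuous D}.
  apply: derivable_within_continuous => z; rewrite in_itv/= => /andP[_ zx].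
  by have [] : is_derive z 1 D (phi z / z ^+ 2) by apply: dD; rewrite lt_eqF//; lra.
have dDyx (z : R) : z \in `]y, x[ -> is_derive z 1 D (phi z / z ^+ 2).
  by rewrite in_itv/= => /andP[_ zx]; apply: dD; rewrite lt_eqF//; lra.
have [c _] := MVT yx dDyx cD.
have : 0 <= phi c / c ^+ 2 * (x - y).
  rewrite mulr_ge0//; last by rewrite subr_ge0 ltW.
  by rewrite divr_ge0// ?sqr_ge0// ltW// phi_gt0.
move=> + E; rewrite -E subr_ge0 => Dyx.
have : 0 <= - (phi y / y).
  by rewrite oppr_ge0 mulr_ge0_le0 ?(ltW (phi_gt0 _))// invr_le0; lra.
have DyE : D y = - (phi y / y) - K y by [].
by rewrite DyE in Dyx; lra.
Qed.

End gaussian_tail.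

(** * Stein's equation for a ramp *)

Section stein.
Context {R : realType}.
Local Notation phi := (normal_pdf (0 : R) 1).
Local Notation mu := (@lebesgue_measure R).
Implicit Types x y t : R.

Lemma lipschitz_cont (f : R -> R) (B : R) :
  (forall x y, `|f x - f y| <= B * `|x - y|) -> continuous f.
Proof.
move=> fB x; apply/cvgrPdist_le => e e0.
have B0 : 0 < `|B| + 1 by rewrite ltr_wpDl.
near=> y; apply: le_trans (fB x y) _.
apply: (@le_trans _ _ ((`|B| + 1) * `|x - y|)).
  by rewrite ler_wpM2r// (le_trans (ler_norm _))// lerDl.
rewrite mulrC -ler_pdivlMr//; near: y.
by apply: cvgr_dist_le; [exact: cvg_id|rewrite divr_gt0].
Unshelve. all: by end_near. Qed.

Lemma is_derive_cumulative (psi : R -> R) : continuous psi ->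
  mu.-integrable setT (EFin \o psi) ->
  forall x, is_derive x 1 (fun y => (\int[mu]_(t in `]-oo, y]) psi t)%R) (psi x).
Proof.
move=> cpsi ipsi x.
have ixu : mu.-integrable [set` `]-oo, (x + 1)]] (EFin \o psi).
  by apply: (integrableS measurableT) => //.
have xx1 : x < x + 1 by rewrite ltrDl.
have [dF dFE] := continuous_FTC1 xx1 ixu (ltNyr x) (cpsi x).
by split; [exact: dF|rewrite -dFE derive1E].
Qed.

Definition Phi x : R := (\int[mu]_(t in `]-oo, x]) phi t)%R.

Lemma PhiE x : Phi x = fine (normal_prob 0 1 `]-oo, x]).
Proof. by []. Qed.

Lemma phi_integrable : mu.-integrable setT (EFin \o phi).
Proof. exact: integrable_normal_pdf. Qed.

Lemma phi_continuous : continuous phi.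
Proof. exact/continuous_normal_pdf/oner_neq0. Qed.

Lemma is_derive_Phi x : is_derive x 1 Phi (phi x).
Proof. exact: (is_derive_cumulative phi_continuous phi_integrable). Qed.

Lemma Phi_ge0 x : 0 <= Phi x.
Proof. by apply: Rintegral_ge0 => t _; exact: normal_pdf_ge0. Qed.

Lemma Phi_le1 x : Phi x <= 1.
Proof.
have : (normal_prob 0 1 `]-oo, x] <= 1)%E by exact: probability_le1.
rewrite -(@fineK _ (normal_prob 0 1 `]-oo, x])) ?lee_fin//.
exact: fin_num_measure.
Qed.

(** As a random variable under the normal law, the identity has distribution function [Phi]; the
    general limits of distribution functions at both infinities then apply to [Phi]. *)
Let idTR : measurableTypeR R -> R := idfun.

#[local] HB.instance Definition _ :=
  @isMeasurableFun.Build _ _ _ _ idTR (@measurable_id _ _ setT).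

Let cdf_id x : cdf (idTR : {RV normal_prob 0 1 >-> R}) x = (Phi x)%:E.
Proof. by rewrite PhiE fineK//; exact: fin_num_measure. Qed.

Lemma Phi_inf e x : 0 < e -> exists2 y, y < x & Phi y < e.
Proof.
move=> e0; have := @cvg_cdfNy0 _ _ _ _ (idTR : {RV normal_prob 0 1 >-> R}).
under eq_cvg do rewrite cdf_id.
move=> /fine_cvgP[_] /cvgrPdist_lt/(_ e e0) H.
near (ninfty_nbhs R) => y; exists y; first by near: y; exact/nbhs_ninfty_lt/num_real.
have : `|0 - Phi y| < e by near: y.
by rewrite sub0r normrN ger0_norm// Phi_ge0.
Unshelve. all: by end_near. Qed.

Lemma Phi_sup e x : 0 < e -> exists2 y, y < x & 1 - Phi (- y) < e.
Proof.
move=> e0; have := @cvg_cdfy1 _ _ _ _ (idTR : {RV normal_prob 0 1 >-> R}).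
under eq_cvg do rewrite cdf_id.
move=> /fine_cvgP[_] /cvgrPdist_lt/(_ e e0) H.
near (pinfty_nbhs R) => y; exists (- y).
  by rewrite ltrNl; near: y; exact/nbhs_pinfty_gt/num_real.
have : `|1 - Phi y| < e by near: y.
by rewrite opprK ger0_norm// subr_ge0 Phi_le1.
Unshelve. all: by end_near. Qed.

Lemma is_derive_Phi_sup x : is_derive x 1 (fun y => 1 - Phi (- y)) (phi x).
Proof.
have := is_derive_Phi (- x) => dP.
have dN : is_derive x 1 (-%R : R -> R) (-1) by exact: is_deriveNid.
have dc := is_derive1_comp dP dN.
rewrite (_ : (fun y => 1 - Phi (- y)) = (cst 1 - (Phi \o -%R))); last first.
  by apply/funext => y; rewrite !fctE.
by apply: is_derive_eq; rewrite phiN; lra.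
Qed.

Variables a b : R.
Hypothesis ab : a < b.

(** A Lipschitz substitute for the indicator of a half-line, lying between the indicators of the
    half-lines that end at [a] and at [b]. Its slope enters the Lipschitz constant of the derivative
    of the Stein solution. *)
Definition ramp t : R := Num.min 1 (Num.max 0 ((b - t) / (b - a))).

Let ba0 : 0 < b - a. Proof. by rewrite subr_gt0. Qed.

Lemma ramp_ge0 t : 0 <= ramp t.
Proof. by rewrite le_min ler01 le_max lexx. Qed.

Lemma ramp_le1 t : ramp t <= 1.
Proof. by rewrite ge_min lexx. Qed.

Lemma ramp_left t : t <= a -> ramp t = 1.
Proof.
move=> ta; rewrite /ramp; apply/min_idPl; rewrite le_max; apply/orP; right.
by rewrite ler_pdivlMr//; lra.
Qed.

Lemma ramp_right t : b <= t -> ramp t = 0.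
Proof.
move=> bt; rewrite /ramp (max_idPl _) ?(min_idPr _)//.
by rewrite ler_pdivrMr//; lra.
Qed.

Lemma ramp_lip x y : `|ramp x - ramp y| <= (b - a)^-1 * `|x - y|.
Proof.
have H (u v : R) : `|Num.min 1 (Num.max 0 u) - Num.min 1 (Num.max 0 v)| <= `|u - v|.
  rewrite !minElt !maxElt; have uv := ler_norm (u - v).
  have vu := ler_norm (v - u); rewrite distrC in vu.
  case: (ltP 0 u) => u0; case: (ltP 0 v) => v0; rewrite ?ltr10.
  - by case: (ltP 1 u) => h1; case: (ltP 1 v) => h2; rewrite ler_norml;
      apply/andP; split; lra.
  - by case: (ltP 1 u) => h1; rewrite ler_norml; apply/andP; split; lra.
  - by case: (ltP 1 v) => h1; rewrite ler_norml; apply/andP; split; lra.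
  - by rewrite subrr normr0.
apply: le_trans (H _ _) _; rewrite -mulrBl normrM normfV (gtr0_norm ba0) mulrC.
by rewrite (_ : b - x - (b - y) = y - x) ?(distrC y)//; lra.
Qed.

(** Beyond distance [Lb] from the origin the ramp is constant and the Mills bounds, valid from
    distance 1 on, apply. *)
Let Lb : R := Num.max 1 (Num.max `|a| `|b|).
Let Lb1 : 1 <= Lb. Proof. by rewrite le_max lexx. Qed.
Let Lba : `|a| <= Lb. Proof. by rewrite !le_max lexx orbT. Qed.
Let Lbb : `|b| <= Lb. Proof. by rewrite !le_max lexx !orbT. Qed.

Let Gc x : R := (\int[mu]_(t in `]-oo, x]) (ramp t * phi t))%R.
Let mc : R := (\int[mu]_t (ramp t * phi t))%R.

Let gphi_cont : continuous (fun t => ramp t * phi t).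
Proof.
move=> t; apply: cvgM; first exact: (lipschitz_cont ramp_lip).
exact: phi_continuous.
Qed.

Let gphi_le t : `|ramp t * phi t| <= phi t.
Proof.
have p0 := ltW (phi_gt0 t).
by rewrite normrM (ger0_norm p0) (ger0_norm (ramp_ge0 t)) ler_piMl// ramp_le1.
Qed.

Let gphi_int : mu.-integrable setT (EFin \o (fun t => ramp t * phi t)).
Proof.
apply: (le_integrable measurableT _ _ phi_integrable) => [|t _] /=.
  by apply/measurable_EFinP; exact: continuous_measurable_fun.
by rewrite lee_fin (le_trans (gphi_le t))// ler_norm.
Qed.

Let int_tail (k : R -> R) x : mu.-integrable setT (EFin \o k) ->
  (\int[mu]_t k t - \int[mu]_(t in `]-oo, x]) k t = \int[mu]_(t in `]x, +oo[) k t)%R.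
Proof.
move=> ik; rewrite -set_itvNyy; apply: Rintegral_itvB => //.
by apply: (integrableS measurableT).
Qed.

Let Gc_left x : x <= a -> Gc x = Phi x.
Proof.
move=> xa; apply: eq_Rintegral => t; rewrite inE/= in_itv/= => tx.
by rewrite ramp_left ?mul1r// (le_trans tx).
Qed.

Let Gc_right x : b <= x -> Gc x = mc.
Proof.
move=> bx; apply/eqP; rewrite eq_sym -subr_eq0 int_tail//; apply/eqP.
rewrite (@eq_Rintegral _ _ _ _ _ (cst 0)) ?Rintegral_cst ?mul0r//.
move=> t; rewrite inE/= in_itv/= andbT => xt.
by rewrite ramp_right ?mul0r// (le_trans bx)// ltW.
Qed.

Let gphi_ge0 t : 0 <= ramp t * phi t.
Proof. by rewrite mulr_ge0 ?ramp_ge0// ltW// phi_gt0. Qed.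

Let Gc_ge0 x : 0 <= Gc x.
Proof. by apply: Rintegral_ge0 => t _. Qed.

Let Gc_le x : Gc x <= Phi x.
Proof.
apply: le_Rintegral => //.
- by apply: (integrableS measurableT).
- by apply: (integrableS measurableT) => //; exact: phi_integrable.
by move=> t _; rewrite (le_trans (ler_norm _)).
Qed.

Let Gc_mc x : Gc x <= mc.
Proof. by rewrite -subr_ge0 int_tail//; apply: Rintegral_ge0 => t _. Qed.

Lemma Phi_le_mc : Phi a <= mc.
Proof. by rewrite -Gc_left. Qed.

Lemma mc_le_Phi : mc <= Phi b.
Proof. by rewrite -(Gc_right (lexx b)). Qed.

Let mc0 : 0 <= mc. Proof. by rewrite (le_trans (Phi_ge0 a))// Phi_le_mc. Qed.
Let mc1 : mc <= 1. Proof. by rewrite (le_trans mc_le_Phi)// Phi_le1. Qed.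

(** The solution of [f' - x f = ramp - mc] obtained with the integrating factor [phi]. Subtracting
    the Gaussian mean [mc] of the ramp makes the numerator vanish at both infinities. *)
Let f x : R := (Gc x - mc * Phi x) / phi x.
Let f' x : R := x * f x + (ramp x - mc).

Let df x : is_derive x 1 f (f' x).
Proof.
have dG := is_derive_cumulative gphi_cont gphi_int x.
have dP := is_derive_Phi x; have dp := is_derive_phi x.
have p0 : phi x != 0 by rewrite gt_eqF ?phi_gt0.
have dG' : is_derive x 1 Gc (ramp x * phi x) by [].
by apply: is_derive_eq; rewrite /f' /f /GRing.scale /=; field.
Qed.

(** Left of [- Lb] the ramp is 1, so [f] is a multiple of the Mills ratio [rho = Phi / phi]. Up to
    that multiple, the three bounds control [f], then [f'], then the derivative of [x f]; the last
    one needs both Mills inequalities. *)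
Let left_tail x : x <= - Lb -> exists2 rho : R, f x = (1 - mc) * rho &
  [/\ ramp x = 1, 0 <= rho <= 1, -1 <= x * rho <= 0 &
      0 <= (1 + x ^+ 2) * rho + x <= 1].
Proof.
move=> xL; have [x1 xa] : x <= -1 /\ x <= a.
  have L1 := Lb1; have La := Lba.
  by split; [lra|have := ler_norm (- a); rewrite normrN; lra].
have p0 := phi_gt0 x.
exists (Phi x / phi x).
  by rewrite /f Gc_left//; field; rewrite gt_eqF.
have lo := mills_lower Phi_ge0 is_derive_Phi x1.
have up := mills_upper Phi_inf is_derive_Phi x1.
set rho := Phi x / phi x.
have x2 : 0 < 1 + x ^+ 2 by rewrite ltr_pwDl// sqr_ge0.
have lo' : - x <= (1 + x ^+ 2) * rho.
  rewrite /rho mulrA ler_pdivlMr//.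
  by move: lo; rewrite mulrAC ler_pdivrMr// (mulrC (Phi x)).
have up' : - 1 <= x * rho.
  have xn : x < 0 by lra.
  move: up; rewrite ler_ndivlMr// mulrC => up.
  by rewrite /rho mulrA ler_pdivlMr// mulN1r.
have r0 : 0 <= rho by rewrite divr_ge0 ?Phi_ge0// ltW.
split; first exact: ramp_left.
- by rewrite r0/=; nra.
- by rewrite up'/=; nra.
- apply/andP; split; first lra.
  by nra.
Qed.

Let right_tail x : Lb <= x -> exists2 rho : R, f x = mc * rho &
  [/\ ramp x = 0, 0 <= rho <= 1, 0 <= x * rho <= 1 &
      0 <= (1 + x ^+ 2) * rho - x <= 1].
Proof.
move=> xL; have [x1 xb] : 1 <= x /\ b <= x.
  have L1 := Lb1; have La := Lbb.
  by split; [lra|have := ler_norm b; lra].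
have p0 := phi_gt0 x.
exists ((1 - Phi x) / phi x).
  by rewrite /f Gc_right//; field; rewrite gt_eqF.
have K0 (z : R) : 0 <= 1 - Phi (- z) by rewrite subr_ge0 Phi_le1.
have xN1 : - x <= -1 by rewrite lerN2.
have := mills_lower K0 is_derive_Phi_sup xN1.
have := mills_upper Phi_sup is_derive_Phi_sup xN1.
rewrite !opprK sqrrN phiN => up lo.
set rho := (1 - Phi x) / phi x.
have x2 : 0 < 1 + x ^+ 2 by rewrite ltr_pwDl// sqr_ge0.
have lo' : x <= (1 + x ^+ 2) * rho.
  rewrite /rho mulrA ler_pdivlMr//.
  by move: lo; rewrite mulrAC ler_pdivrMr// (mulrC (1 - Phi x)).
have x0 : 0 < x by lra.
have up' : x * rho <= 1.
  move: up; rewrite invrN mulrN mulNr opprK ler_pdivlMr// mulrC => up.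
  by rewrite /rho mulrA ler_pdivrMr// mul1r.
have r0 : 0 <= rho by rewrite divr_ge0 ?subr_ge0 ?Phi_le1// ltW.
split; first exact: ramp_right.
- by rewrite r0/=; nra.
- by rewrite up' andbT mulr_ge0// ltW.
- by apply/andP; split; [lra|nra].
Qed.

Let A0 : R := (phi Lb)^-1.
Let A0_ge0 : 0 <= A0. Proof. by rewrite invr_ge0 ltW// phi_gt0. Qed.

(** The numerator of [f] is at most 1 in absolute value, and on this interval the density is
    smallest at the endpoint [Lb]. *)
Let mid x : `|x| <= Lb -> `|f x| <= A0.
Proof.
move=> xL; have p0 := phi_gt0 x; have pL := phi_gt0 Lb.
rewrite /f normrM normfV (gtr0_norm p0) /A0 -[leRHS]mul1r.
apply: ler_pM => //.
- by rewrite invr_ge0 ltW.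
- have := Phi_le1 x; have := Gc_le x; have := Gc_ge0 x; have := Phi_ge0 x.
  have := mc0; have := mc1; move: mc => k k1 k0 P0 G0 GP P1.
  by rewrite ler_norml; apply/andP; split; nra.
- rewrite lef_pV2 ?posrE//.
  rewrite !phiE ler_wpM2l ?normal_peak_ge0// ler_expR ler_wpM2r ?invr_ge0//.
  by rewrite lerN2 -(real_normK (num_real x)) lerXn2r// nnegrE (le_trans _ xL).
Qed.

(** The ramp has corners, so [F'] is not differentiated. Instead it is split as [x F] plus the ramp
    minus a constant: [x F] has derivative [F + x F'], bounded by [B0], and the ramp has slope at
    most [(b - a)^-1]. *)
Lemma stein_solution : exists (F F' : R -> R) (A B : R),
  [/\ forall x, is_derive x 1 F (F' x),
      forall x, `|F x| <= A /\ `|F' x| <= A,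
      forall x y, `|F' x - F' y| <= B * `|x - y| &
      forall x, F' x - x * F x = ramp x - mc].
Proof.
(* In the middle part [|f| <= A0] yields [1 + Lb * A0] for [f'] and [A0 + Lb * (1 + Lb * A0)] for
   [f + x f']; in the tails 1 suffices. [B0] dominates them all. *)
pose B0 : R := 1 + A0 + Lb * (1 + Lb * A0).
exists f, f', B0, (B0 + (b - a)^-1).
have Lb0 : 0 <= Lb by exact: le_trans Lb1.
have h1 x : `|ramp x - mc| <= 1.
  have := ramp_ge0 x; have := ramp_le1 x; have := mc0; have := mc1 => ????.
  by rewrite ler_norml; apply/andP; split; lra.
have A00 := A0_ge0.
have LA : 0 <= Lb * A0 by rewrite mulr_ge0.
have LLA : 0 <= Lb * (1 + Lb * A0) by rewrite mulr_ge0// addr_ge0.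
have bnd x : [/\ `|f x| <= B0, `|f' x| <= B0 & `|f x + x * f' x| <= B0].
  have B01 : 1 <= B0 by rewrite /B0; lra.
  have [xL|xL] := leP `|x| Lb.
    have fx := mid xL.
    have f'x : `|f' x| <= 1 + Lb * A0.
      rewrite /f' addrC (le_trans (ler_normD _ _))// lerD// (normrM x).
      by rewrite ler_pM.
    split.
    - by rewrite (le_trans fx)// /B0; lra.
    - rewrite (le_trans f'x)// /B0.
      have : Lb * A0 <= Lb * (Lb * A0) by rewrite ler_peMl.
      by have := Lb1; lra.
    - rewrite (le_trans (ler_normD _ _))// /B0 (normrM x).
      have : `|x| * `|f' x| <= Lb * (1 + Lb * A0) by rewrite ler_pM.
      lra.
  have m0 := mc0; have m1 := mc1.
  have [x0|x0] := leP 0 x.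
    have {}xL : Lb <= x by rewrite ltW// -(ger0_norm x0).
    have [rho fE [rE /andP[r0 r1] /andP[xr0 xr1] /andP[s0 s1]]] := right_tail xL.
    have f'E : f' x = mc * (x * rho - 1) by rewrite /f' fE rE; ring.
    have ffE : f x + x * f' x = mc * ((1 + x ^+ 2) * rho - x).
      by rewrite f'E fE; ring.
    rewrite ffE f'E fE; move: (x * rho) ((1 + x ^+ 2) * rho - x) xr0 xr1 s0 s1.
    move=> u v u0 u1 v0 v1; rewrite !normrM (ger0_norm m0).
    by split; apply: le_trans B01; rewrite mulr_ile1// ler_norml; apply/andP; split; lra.
  have {}xL : x <= - Lb by rewrite lerNr ltW// -(ltr0_norm x0).
  have [rho fE [rE /andP[r0 r1] /andP[xr0 xr1] /andP[s0 s1]]] := left_tail xL.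
  have f'E : f' x = (1 - mc) * (x * rho + 1) by rewrite /f' fE rE; ring.
  have ffE : f x + x * f' x = (1 - mc) * ((1 + x ^+ 2) * rho + x).
    by rewrite f'E fE; ring.
  rewrite ffE f'E fE; move: (x * rho) ((1 + x ^+ 2) * rho + x) xr0 xr1 s0 s1.
  have m2 : 0 <= 1 - mc by lra.
  move=> u v u0 u1 v0 v1; rewrite !normrM (ger0_norm m2).
  have m3 : 1 - mc <= 1 by lra.
  by split; apply: le_trans B01; rewrite mulr_ile1// ler_norml; apply/andP; split; lra.
split.
- exact: df.
- by move=> x; have [] := bnd x.
- move=> x y.
  have dxf (z : R) : is_derive z 1 (fun z => z * f z) (f z + z * f' z).
    by have := df z => dfz; apply: is_derive_eq; rewrite /GRing.scale /=; ring.
  have xfB (z : R) : `|f z + z * f' z| <= B0 by have [] := bnd z.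
  have H := is_derive_lipschitz dxf xfB x y.
  rewrite (_ : f' x - f' y = (x * f x - y * f y) + (ramp x - ramp y)); last first.
    by rewrite /f'; ring.
  rewrite (le_trans (ler_normD _ _))// mulrDl lerD//; exact: ramp_lip.
- by move=> x; rewrite /f'; ring.
Qed.

End stein.

(** * A normal approximation inequality for sums of independent variables *)

Section stein_clt.
Context {R : realType} {d : measure_display} {T : measurableType d}.
Variable P : probability T R.
Variables (n : nat) (X : 'I_n -> T -> R) (L eta : R).
Hypothesis n_gt0 : (0 < n)%N.
Hypothesis L_ge0 : 0 <= L.
Hypothesis mX : forall i, measurable_fun setT (X i).
Hypothesis iX2 : forall i, L1 P (fun w => X i w ^+ 2).
Hypothesis EX : forall i, Ex P (X i) = 0.
Hypothesis EX2 : forall i, Ex P (fun w => X i w ^+ 2) = 1.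
Hypothesis indX : forall i, indep_fun P (X i) (fun w => \sum_(j | j != i) X j w).
Hypothesis tailX : forall i,
  Ex P (fun w => if `|X i w| <= L then 0 else X i w ^+ 2) <= eta.

Let c : R := (Num.sqrt n%:R)^-1.
Let c_gt0 : 0 < c. Proof. by rewrite invr_gt0 sqrtr_gt0 ltr0n. Qed.
Let c2n : c ^+ 2 *+ n = 1.
Proof.
by rewrite exprVn sqr_sqrtr ?ler0n// -mulr_natr mulVf// pnatr_eq0 -lt0n.
Qed.

Let W w : R := c * \sum_(i < n) X i w.
(** The leave-one-out version of [W]: close to [W], yet independent of [X i]. *)
Let V i w : R := c * \sum_(j | j != i) X j w.

Let WE i w : W w = V i w + c * X i w.
Proof. by rewrite /W /V (bigD1 i)//= mulrDr addrC. Qed.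

Let mW : measurable_fun setT W.
Proof. by apply: measurable_funM => //; exact: measurable_sum. Qed.

Let mV i : measurable_fun setT (V i).
Proof.
apply: measurable_funM => //.
rewrite (_ : (fun w => _) = fun w => \sum_(j < n) if j != i then X j w else 0).
  by apply: measurable_sum => j; case: (j != i).
by apply/funext => w; rewrite big_mkcond.
Qed.

Let iX i : L1 P (X i). Proof. exact: L1_sqr. Qed.

Let indV i : indep_fun P (X i) (V i).
Proof.
apply: (@indep_fun_comp _ _ _ _ _ _ _ _ _ _ _ _ _ _ id (fun t => c * t)) (indX i).
  exact: measurable_id.
exact: measurable_funM.
Qed.

Variables (F F' : R -> R) (A B : R).
Hypothesis dF : forall x : R, is_derive x 1 F (F' x).
Hypothesis FA : forall x, `|F x| <= A /\ `|F' x| <= A.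
Hypothesis F'B : forall x y, `|F' x - F' y| <= B * `|x - y|.

Let A_ge0 : 0 <= A. Proof. by have [+ _] := FA 0; exact: le_trans. Qed.
Let B_ge0 : 0 <= B.
Proof.
have := F'B 1 0; rewrite subr0 normr1 mulr1; exact: le_trans.
Qed.

Let mF : measurable_fun setT F.
Proof.
by apply: continuous_measurable_fun;
  exact: (lipschitz_cont (is_derive_lipschitz dF (fun x => (FA x).2))).
Qed.
Let mF' : measurable_fun setT F'.
Proof. by apply: continuous_measurable_fun; exact: lipschitz_cont F'B. Qed.

Let iF' (Y : T -> R) : measurable_fun setT Y -> L1 P (fun w => F' (Y w)).
Proof.
move=> mY; apply: (@L1_bounded _ _ _ _ _ A); first exact: measurableT_comp.
by move=> w; have [] := FA (Y w).
Qed.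

Let iF (Y : T -> R) : measurable_fun setT Y -> L1 P (fun w => F (Y w)).
Proof.
move=> mY; apply: (@L1_bounded _ _ _ _ _ A); first exact: measurableT_comp.
by move=> w; have [] := FA (Y w).
Qed.

(** Two bounds for one remainder: quadratic in [t] for small summands, only linear for large ones,
    because after multiplication by the summand nothing beyond its second moment is available
    there. *)
Let taylor v t : `|F (v + t) - F v - t * F' v| <= `|t| * (B * `|t|) /\
  `|F (v + t) - F v - t * F' v| <= `|t| * (2 * A).
Proof.
have [s sE sB] : exists2 s, F (v + t) - F v = t * F' s & `|s - v| <= `|t|.
  have [t0|/ltW t0] := leP 0 t.
    have vt : v <= v + t by rewrite lerDl.
    have [s /andP[vs st] ->] := is_derive_mvt dF vt.
    exists s; first by rewrite addrAC subrr add0r mulrC.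
    by rewrite ger0_norm ?subr_ge0// ger0_norm//; lra.
  have vt : v + t <= v by rewrite gerDl.
  have [s /andP[vs st] E] := is_derive_mvt dF vt.
  exists s; first by rewrite -opprB E; ring.
  by rewrite ler0_norm ?subr_le0// ler0_norm//; lra.
rewrite sE -mulrBr normrM; split; rewrite ler_wpM2l//.
  by rewrite (le_trans (F'B _ _))// ler_wpM2l.
have [_ ] := FA s; have [_] := FA v; have := ler_normB (F' s) (F' v); lra.
Qed.

Let tail i w := if `|X i w| <= L then 0 else X i w ^+ 2.

Let mtail i : measurable_fun setT (tail i).
Proof.
apply: measurable_fun_ifT => //; last exact: measurable_funX.
by apply: measurable_fun_ler => //; exact: measurableT_comp.
Qed.

Let itail i : L1 P (tail i).
Proof.
apply: (L1_dom (mtail i) (iX2 i)) => w.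
by rewrite /tail; case: ifP => _; rewrite ?normr0 ?sqr_ge0// ger0_norm// sqr_ge0.
Qed.

Let EnormX i : Ex P (fun w => `|X i w|) <= 1.
Proof.
apply: (@le_trans _ _ (Ex P (fun w => 2^-1 * (1 + X i w ^+ 2)))).
  apply: le_Ex; [exact: L1_norm|by apply/L1Z/L1D => //; exact: L1_cst|].
  move=> w; rewrite -(real_normK (num_real (X i w))).
  by have := sqr_ge0 (`|X i w| - 1); nra.
rewrite ExZ; last by apply: L1D => //; exact: L1_cst.
by rewrite ExD ?Ex_cst ?EX2//; [lra|exact: L1_cst].
Qed.

Let iXF i : L1 P (fun w => X i w * F (W w)).
Proof.
apply: (L1_dom _ (L1Z A (L1_norm (iX i)))).
  by apply: measurable_funM => //; exact: measurableT_comp.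
by move=> w; rewrite normrM mulrC ler_wpM2r//; have [] := FA (W w).
Qed.

(** When [F (W w)] is expanded at the leave-one-out sum, independence kills the term of order 0 and
    turns that of order 1 into [c * E F'(V)]. The remainder costs [B * c * L] below the truncation
    level and [2 * A * eta] above it; returning from [V] to [W] inside [F'] costs the other
    [B * c]. *)
Let one_term i : `|c * Ex P (fun w => X i w * F (W w)) -
    c ^+ 2 * Ex P (fun w => F' (W w))| <=
  c ^+ 2 * (B * c + (B * c * L + 2 * A * eta)).
Proof.
have iXFV : L1 P (fun w => X i w * F (V i w)) /\
    Ex P (fun w => X i w * F (V i w)) = 0.
  have ind : indep_fun P (X i) (fun w => F (V i w)).
    exact: (indep_fun_comp (@measurable_id _ R setT) mF (@indV i)).
  by have [? ->] := indep_fun_Ex (iX i) (iF (mV i)) ind; rewrite EX mul0r.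
have iXF'V : L1 P (fun w => X i w ^+ 2 * F' (V i w)) /\
    Ex P (fun w => X i w ^+ 2 * F' (V i w)) = Ex P (fun w => F' (V i w)).
  have ind : indep_fun P (fun w => X i w ^+ 2) (fun w => F' (V i w)).
    have msq : measurable_fun setT (fun t : R => t ^+ 2) by exact: measurable_funX.
    exact: (indep_fun_comp msq mF' (@indV i)).
  by have [? ->] := indep_fun_Ex (iX2 i) (iF' (mV i)) ind; rewrite EX2 mul1r.
pose Rm w := X i w * (F (V i w + c * X i w) - F (V i w) - c * X i w * F' (V i w)).
have RmE w : Rm w = X i w * F (W w) - X i w * F (V i w) - c * (X i w ^+ 2 * F' (V i w)).
  by rewrite (WE i) /Rm; ring.
have iRm : L1 P Rm.
  rewrite (_ : Rm = fun w => X i w * F (W w) - X i w * F (V i w) -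
    c * (X i w ^+ 2 * F' (V i w))); last exact/funext.
  by apply: L1B; [apply: L1B => //; exact: iXFV.1|apply: L1Z; exact: iXF'V.1].
have ERm : Ex P Rm = Ex P (fun w => X i w * F (W w)) - c * Ex P (fun w => F' (V i w)).
  rewrite (_ : Rm = fun w => X i w * F (W w) - X i w * F (V i w) -
    c * (X i w ^+ 2 * F' (V i w))); last exact/funext.
  rewrite ExB ?ExB ?iXFV.2 ?subr0 ?ExZ ?iXF'V.2//; try exact: iXFV.1;
    try exact: iXF'V.1; [apply: L1B => //; exact: iXFV.1|apply: L1Z; exact: iXF'V.1].
have Rm_le : `|Ex P Rm| <= c * (B * c * L + 2 * A * eta).
  apply: le_trans (norm_Ex iRm) _.
  apply: (@le_trans _ _ (Ex P (fun w => c * (B * c * L * X i w ^+ 2 + 2 * A * tail i w)))).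
    apply: le_Ex; [exact: L1_norm|by apply/L1Z/L1D; exact: L1Z|].
    move=> w; rewrite /Rm normrM.
    have [T1 T2] := taylor (V i w) (c * X i w).
    have cX : `|c * X i w| = c * `|X i w| by rewrite normrM gtr0_norm.
    rewrite cX in T1 T2; rewrite /tail.
    have x0 := normr_ge0 (X i w); have c0 := ltW c_gt0.
    rewrite -(real_normK (num_real (X i w))).
    case: ifPn => [XL|]; rewrite ?mulr0 ?addr0.
      apply: le_trans (ler_wpM2l x0 T1) _.
      have : 0 <= c ^+ 2 * B * `|X i w| ^+ 2 * (L - `|X i w|).
        by rewrite mulr_ge0 ?subr_ge0// mulr_ge0 ?sqr_ge0// mulr_ge0 ?sqr_ge0.
      lra.
    move=> _; apply: le_trans (ler_wpM2l x0 T2) _.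
    have : 0 <= c * (B * c * L * `|X i w| ^+ 2).
      by rewrite !mulr_ge0 ?sqr_ge0.
    lra.
  rewrite ExZ; last by apply/L1D; exact: L1Z.
  rewrite ExD ?ExZ ?EX2 ?mulr1//; try exact: L1Z.
  rewrite ler_wpM2l ?(ltW c_gt0)// lerD2l ler_wpM2l ?tailX//.
  by rewrite mulr_ge0.
have dF' : `|Ex P (fun w => F' (V i w)) - Ex P (fun w => F' (W w))| <= B * c.
  rewrite -ExB ?iF'//.
  have iD : L1 P (fun w => F' (V i w) - F' (W w)) by apply: L1B; exact: iF'.
  apply: le_trans (norm_Ex iD) _.
  apply: (@le_trans _ _ (Ex P (fun w => B * c * `|X i w|))).
    apply: le_Ex; [exact: L1_norm|by apply: L1Z; exact: L1_norm|].
    move=> w; apply: le_trans (F'B _ _) _.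
    rewrite (WE i) opprD addrA subrr sub0r normrN normrM (gtr0_norm c_gt0).
    by rewrite mulrA.
  rewrite ExZ; last exact: L1_norm.
  by rewrite ler_piMr// mulr_ge0// ltW.
rewrite (_ : _ - _ = c * Ex P Rm +
    c ^+ 2 * (Ex P (fun w => F' (V i w)) - Ex P (fun w => F' (W w)))); last first.
  by rewrite ERm; ring.
apply: le_trans (ler_normD _ _) _; rewrite (normrM c) (normrM (c ^+ 2)) normrX (gtr0_norm c_gt0).
rewrite mulrDr addrC lerD//; first by rewrite ler_wpM2l ?sqr_ge0.
by rewrite expr2 -mulrA ler_wpM2l ?(ltW c_gt0).
Qed.

Let stein_identity : `|Ex P (fun w => F' (W w) - W w * F (W w))| <=
  B * c + (B * c * L + 2 * A * eta).
Proof.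
have iWF : L1 P (fun w => W w * F (W w)).
  rewrite (_ : (fun w => _) = fun w => c * \sum_(i < n) X i w * F (W w)).
    by apply: L1Z; exact: L1_sum.
  by apply/funext => w; rewrite /W -mulrA mulr_suml.
rewrite ExB ?iF'//.
have -> : Ex P (fun w => W w * F (W w)) = \sum_(i < n) c * Ex P (fun w => X i w * F (W w)).
  rewrite (_ : (fun w => _) = fun w => c * \sum_(i < n) X i w * F (W w)).
    by rewrite ExZ ?Ex_sum// ?mulr_sumr//; exact: L1_sum.
  by apply/funext => w; rewrite /W -mulrA mulr_suml.
(* Since [n * c^2 = 1], the single expectation of [F'] can be spread over the [n] summands and
   compared with them one by one. *)
set e := Ex P _; have eE : e = \sum_(i < n) c ^+ 2 * e.
  by rewrite sumr_const card_ord -mulrnAl c2n mul1r.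
rewrite {1}eE -sumrB; apply: le_trans (ler_norm_sum _ _ _) _.
have -> : B * c + (B * c * L + 2 * A * eta) =
    \sum_(i < n) c ^+ 2 * (B * c + (B * c * L + 2 * A * eta)).
  by rewrite sumr_const card_ord -mulrnAl c2n mul1r.
by apply: ler_sum => i _; rewrite distrC; exact: one_term.
Qed.

Lemma stein_bound (g : R -> R) m : (forall x, F' x - x * F x = g x - m) ->
    measurable_fun setT g -> (forall x, 0 <= g x <= 1) ->
  `|Ex P (fun w => g (W w)) - m| <= B * c + (B * c * L + 2 * A * eta).
Proof.
move=> FE mg g01.
have ig : L1 P (fun w => g (W w)).
  apply: (@L1_bounded _ _ _ _ _ 1); first exact: measurableT_comp.
  by move=> w; rewrite ger0_norm; have /andP[] := g01 (W w).
have -> : Ex P (fun w => g (W w)) - m = Ex P (fun w => F' (W w) - W w * F (W w)).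
  rewrite -[m in LHS](Ex_cst P) -ExB//; last exact: L1_cst.
  by congr (Ex P); apply/funext => w; rewrite FE.
exact: stein_identity.
Qed.

End stein_clt.

(* [A] bounds the solution of Stein's equation for the ramp from [a] to [b] and its
   derivative, and [B] is a Lipschitz constant of that derivative: they depend
   neither on the probability space nor on [n], as a triangular array requires. *)
Definition clt_constants (R : realType) (a b A B : R) :=
  forall (d : measure_display) (T : measurableType d) (P : probability T R)
    (n : nat) (X : 'I_n -> T -> R) (L eta : R),
  (0 < n)%N -> 0 <= L -> (forall i, measurable_fun setT (X i)) ->
  (forall i, L1 P (fun w => X i w ^+ 2)) -> (forall i, Ex P (X i) = 0) ->
  (forall i, Ex P (fun w => X i w ^+ 2) = 1) ->
  (forall i, indep_fun P (X i) (fun w => \sum_(j | j != i) X j w)) ->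
  (forall i, Ex P (fun w => if `|X i w| <= L then 0 else X i w ^+ 2) <= eta) ->
  let W w := (Num.sqrt n%:R)^-1 * \sum_(i < n) X i w in
  let err := B * (Num.sqrt n%:R)^-1 + (B * (Num.sqrt n%:R)^-1 * L + 2 * A * eta) in
  Pr P [set w | W w <= a] <= Phi b + err /\ Phi a - err <= Pr P [set w | W w <= b].

(** The ramp lies above the indicator of the half-line up to [a] and below the one up to [b]. This
    gives both the comparison with the probabilities of [W] and the bounds
    [Phi a <= mc <= Phi b]. *)
Lemma clt_constants_ex (R : realType) (a b : R) : a < b ->
  exists A B : R, 0 <= A /\ clt_constants a b A B.
Proof.
move=> ab; have [F [F' [A [B [dF FA F'B FE]]]]] := stein_solution ab.
exists A, B; split; first by have [+ _] := FA 0; exact: le_trans.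
move=> d T P n X L eta n0 L0 mX iX2 EX EX2 indX tailX W err.
have mg : measurable_fun setT (ramp a b).
  by apply: continuous_measurable_fun; exact: lipschitz_cont (ramp_lip ab).
have mW : measurable_fun setT W.
  by apply: measurable_funM => //; exact: measurable_sum.
have mle t : measurable [set w | W w <= t].
  rewrite -[X in measurable X]setTI; apply: (measurable_fun_le (f := W) (g := cst t)) => //.
have g01 t : 0 <= ramp a b t <= 1 by rewrite ramp_ge0 ramp_le1.
have := stein_bound n0 L0 mX iX2 EX EX2 indX tailX dF FA F'B FE mg g01.
rewrite -/W -/err ler_distl => /andP[lo up].
have ig : L1 P (fun w => ramp a b (W w)).
  apply: (@L1_bounded _ _ _ _ _ 1); first exact: measurableT_comp.
  by move=> w; rewrite ger0_norm; have /andP[] := g01 (W w).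
have Pa : Pr P [set w | W w <= a] <= Ex P (fun w => ramp a b (W w)).
  rewrite -Ex_indic//; apply: le_Ex => //; first exact: L1_indic.
  move=> w; rewrite indicE; have [|_] := boolP (w \in _); last exact: ramp_ge0.
  by rewrite inE /= => Wa; rewrite ramp_left.
have Pb : Ex P (fun w => ramp a b (W w)) <= Pr P [set w | W w <= b].
  rewrite -Ex_indic//; apply: le_Ex => //; first exact: L1_indic.
  move=> w; rewrite indicE; have [_|] := boolP (w \in _); first exact: ramp_le1.
  by rewrite notin_setE /= => /negP; rewrite -ltNge => /ltW Wb; rewrite ramp_right.
have := Phi_le_mc ab; have := mc_le_Phi ab.
by split; lra.
Qed.

(** * Quadratic forms, the smallest eigenvalue and reflections *)

Section vectors.
Context {R : realType}.

Lemma dotvE p (a b : 'cV[R]_p) : dotv a b = (a^T *m b) 0 0.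
Proof. by rewrite mxE; apply: eq_bigr => j _; rewrite mxE. Qed.

Lemma dotvC p (a b : 'cV[R]_p) : dotv a b = dotv b a.
Proof. by apply: eq_bigr => j _; rewrite mulrC. Qed.

Lemma dotvDl p (a b c : 'cV[R]_p) : dotv (a + b) c = dotv a c + dotv b c.
Proof. by rewrite -big_split/=; apply: eq_bigr => j _; rewrite mxE mulrDl. Qed.

Lemma dotvDr p (a b c : 'cV[R]_p) : dotv c (a + b) = dotv c a + dotv c b.
Proof. by rewrite dotvC dotvDl !(dotvC c). Qed.

Lemma dotvZl p (k : R) (a b : 'cV[R]_p) : dotv (k *: a) b = k * dotv a b.
Proof. by rewrite mulr_sumr; apply: eq_bigr => j _; rewrite mxE mulrA. Qed.

Lemma dotvZr p (k : R) (a b : 'cV[R]_p) : dotv b (k *: a) = k * dotv b a.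
Proof. by rewrite dotvC dotvZl dotvC. Qed.

Lemma dotvNl p (a b : 'cV[R]_p) : dotv (- a) b = - dotv a b.
Proof. by rewrite -scaleN1r dotvZl mulN1r. Qed.

Lemma dotvBl p (a b c : 'cV[R]_p) : dotv (a - b) c = dotv a c - dotv b c.
Proof. by rewrite dotvDl dotvNl. Qed.

Lemma dotvBr p (a b c : 'cV[R]_p) : dotv c (a - b) = dotv c a - dotv c b.
Proof. by rewrite dotvC dotvBl !(dotvC c). Qed.

Lemma dotv_mulmx p q (a : 'cV[R]_p) (M : 'M[R]_(p, q)) (b : 'cV[R]_q) :
  dotv a (M *m b) = dotv (M^T *m a) b.
Proof. by rewrite !dotvE trmx_mul trmxK mulmxA. Qed.

Lemma dotvv_ge0 p (a : 'cV[R]_p) : 0 <= dotv a a.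
Proof. by apply: sumr_ge0 => j _; rewrite -expr2 sqr_ge0. Qed.

Lemma dotvv_eq0 p (a : 'cV[R]_p) : (dotv a a == 0) = (a == 0).
Proof.
apply/idP/eqP => [|->]; last by rewrite /dotv big1// => j _; rewrite mxE mul0r.
rewrite psumr_eq0 => [/allP a0|j _]; last by rewrite -expr2 sqr_ge0.
apply/matrixP => j k; rewrite ord1 mxE.
by have := a0 j (mem_index_enum _); rewrite /= mulf_eq0 orbb => /eqP.
Qed.

Lemma norm2_sqr p (a : 'cV[R]_p) : norm2 a ^+ 2 = dotv a a.
Proof. by rewrite sqr_sqrtr// dotvv_ge0. Qed.

Lemma coord_sqr_le p (a : 'cV[R]_p) j : a j 0 ^+ 2 <= dotv a a.
Proof.
rewrite /dotv (bigD1 j)//= expr2 lerDl; apply: sumr_ge0 => k _.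
by rewrite -expr2 sqr_ge0.
Qed.

Lemma quad_bound p (S : 'M[R]_p) : exists2 K : R, 0 < K &
  forall v : 'cV[R]_p, `|dotv v (S *m v)| <= K * dotv v v.
Proof.
exists (1 + \sum_i \sum_j `|S i j|).
  by rewrite ltr_pwDl// sumr_ge0// => i _; rewrite sumr_ge0.
move=> v; rewrite mulrDl mul1r mulr_suml; apply: ler_wpDl; first exact: dotvv_ge0.
apply: le_trans (ler_norm_sum _ _ _) _; apply: ler_sum => i _.
rewrite mxE mulr_sumr mulr_suml; apply: le_trans (ler_norm_sum _ _ _) _.
apply: ler_sum => j _; rewrite !normrM mulrCA ler_wpM2l//.
have := coord_sqr_le v i; have := coord_sqr_le v j.
rewrite -(real_normK (num_real (v i 0))) -(real_normK (num_real (v j 0))).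
have := sqr_ge0 (`|v i 0| - `|v j 0|); have := normr_ge0 (v i 0).
have := normr_ge0 (v j 0); nra.
Qed.

(** With [A], [B], [C] the values of the form at the pairs [(u, u)], [(u, v)], [(v, v)], its
    nonnegativity at [B *: u - A *: v] reads [A * (A * C - B^2) >= 0], which settles the case
    [A > 0]. *)
Lemma psd_cauchy p (S : 'M[R]_p) : S^T = S ->
    (forall v : 'cV[R]_p, 0 <= dotv v (S *m v)) ->
  forall u v, dotv u (S *m v) ^+ 2 <= dotv u (S *m u) * dotv v (S *m v).
Proof.
move=> symS psd u v.
have symq : dotv v (S *m u) = dotv u (S *m v).
  by rewrite dotv_mulmx symS dotvC.
have expand (s t : R) : 0 <= s ^+ 2 * dotv u (S *m u) +
    2 * s * t * dotv u (S *m v) + t ^+ 2 * dotv v (S *m v).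
  have := psd (s *: u + t *: v); rewrite mulmxDr -!scalemxAr.
  rewrite !dotvDl !dotvDr !dotvZl !dotvZr symq; lra.
have a0 := psd u; have c0 := psd v.
move: (dotv u (S *m u)) (dotv u (S *m v)) (dotv v (S *m v)) expand a0 c0.
move=> A B C H A0 C0; have := H B (- A); have := H C (- B).
have [A1|] := ltP 0 A.
  move=> _ H2; have : 0 <= A * (A * C - B ^+ 2) by lra.
  by rewrite pmulr_rge0// subr_ge0.
move=> Ale; have {Ale}AE : A = 0 by apply/eqP; rewrite eq_le Ale A0.
(* For [A = 0] the coefficients [- (C + 1)] and [B] give [- (C + 2) * B^2 >= 0], which forces
   [B = 0]. *)
rewrite AE in H *; move=> _ _; have := H (- (C + 1)) B; rewrite mul0r.
by have := sqr_ge0 B; nra.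
Qed.

(** The supremum [m] of all [t] with [S - t] positive semidefinite is attained, and every eigenvalue
    is at least [m]. If [m] were not an eigenvalue, [S - m] would be semidefinite and invertible,
    hence at least a positive multiple of the identity, and [m] could be increased. So
    [lambda_min S <= m]. *)
Lemma lambda_min_le q (S : 'M[R]_q.+1) : S^T = S ->
  forall v : 'cV[R]_q.+1, lambda_min S * dotv v v <= dotv v (S *m v).
Proof.
move=> symS.
pose TT := [set t : R | forall v : 'cV[R]_q.+1, t * dotv v v <= dotv v (S *m v)].
have [K K0 SK] := quad_bound S.
have TK : TT (- K).
  by move=> v; have := SK v; rewrite ler_norml mulNr => /andP[].
have e0 : dotv (delta_mx 0 0 : 'cV[R]_q.+1) (delta_mx 0 0) = 1.
  rewrite /dotv (bigD1 0)//= !mxE !eqxx/= mulr1 big1 ?addr0// => j j0.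
  by rewrite !mxE (negbTE j0) mul0r.
have supT : has_sup TT.
  split; first by exists (- K).
  exists (dotv (delta_mx 0 0) (S *m delta_mx 0 0)) => t /(_ (delta_mx 0 0)).
  by rewrite e0 mulr1.
pose m := sup TT.
have Tm : TT m.
  move=> v; have := dotvv_ge0 v; rewrite le_eqVlt eq_sym => /predU1P[v0|v0].
    have /eqP -> : v == 0 by rewrite -dotvv_eq0 v0.
    by rewrite mulmx0 /dotv !big1 ?mulr0// => j _; rewrite !mxE mul0r.
  rewrite -ler_pdivlMr//; apply: ge_sup; first by case: supT.
  by move=> t /(_ v); rewrite ler_pdivlMr.
have eig_m a : eigenvalue S a -> m <= a.
  move=> /eigenvalueP[w wS w0]; have := Tm w^T.
  have -> : S *m w^T = a *: w^T by rewrite -{1}symS -trmx_mul wS linearZ.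
  rewrite dotvZr.
  rewrite ler_pM2r// lt_neqAle dotvv_ge0 andbT eq_sym dotvv_eq0.
  by apply: contra w0 => /eqP/(congr1 trmx); rewrite trmxK trmx0 => ->.
have eigm : eigenvalue S m.
  rewrite /eigenvalue /eigenspace kermx_eq0 row_free_unit; apply/negP => uS.
  set S' := S - m%:M in uS.
  have symS' : S'^T = S' by rewrite linearB/= symS tr_scalar_mx.
  have S'E v : dotv v (S' *m v) = dotv v (S *m v) - m * dotv v v.
    by rewrite mulmxBl mul_scalar_mx dotvBr dotvZr.
  have psd v : 0 <= dotv v (S' *m v) by rewrite S'E subr_ge0; exact: Tm.
  have [K1 K10 S'K] := quad_bound S'.
  have [K2 K20 IK] := quad_bound ((invmx S')^T *m invmx S').
  (* Cauchy-Schwarz for the form of [S'] at [S' v] and [v] bounds [|S' v|^4] by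
     [K1 * |S' v|^2 * <v, S' v>]; one factor [|S' v|^2] is then divided out. *)
  have sq v : dotv (S' *m v) (S' *m v) <= K1 * dotv v (S' *m v).
    have := psd_cauchy symS' psd (S' *m v) v.
    have := S'K (S' *m v); rewrite ger0_norm ?psd//.
    have := dotvv_ge0 (S' *m v); have := psd v.
    move: (dotv (S' *m v) (S' *m v)) (dotv v (S' *m v)) (dotv (S' *m v) (S' *m (S' *m v))).
    move=> A B C B0; rewrite le_eqVlt => /predU1P[<-|A0] CA AB.
      by rewrite mulr_ge0// ltW.
    rewrite -(ler_pM2l A0) -expr2; apply: le_trans AB _.
    by rewrite mulrA ler_wpM2r// mulrC.
  have inv v : dotv v v <= K2 * dotv (S' *m v) (S' *m v).
    apply: le_trans (IK (S' *m v)); rewrite -!mulmxA (mulmxA (invmx S') S').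
    by rewrite mulVmx// mul1mx dotv_mulmx trmxK mulmxA mulVmx// mul1mx ler_norm.
  pose e := (K1 * K2)^-1.
  have e_gt0 : 0 < e by rewrite invr_gt0 mulr_gt0.
  have : TT (m + e).
    move=> v; rewrite mulrDl -lerBrDl -S'E /e mulrC ler_pdivrMr ?mulr_gt0//.
    apply: le_trans (inv v) _.
    have := ler_wpM2l (ltW K20) (sq v); lra.
  move=> /(ub_le_sup supT.2); rewrite -/m; lra.
have lm : lambda_min S <= m.
  apply: ge_inf => //; exists m => a; exact: eig_m.
move=> v; apply: le_trans (Tm v); rewrite ler_wpM2r//; exact: dotvv_ge0.
Qed.

Definition reflection p (b : 'cV[R]_p) : 'M[R]_p :=
  1%:M - (2 / dotv b b) *: (b *m b^T).

Lemma reflectionE p (b x : 'cV[R]_p) :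
  reflection b *m x = x - (2 * dotv b x / dotv b b) *: b.
Proof.
rewrite mulmxBl mul1mx -scalemxAl -mulmxA; congr (_ - _).
rewrite [b^T *m x]mx11_scalar -dotvE mul_mx_scalar scalerA; congr (_ *: _).
by rewrite mulrAC.
Qed.

Lemma reflection_tr p (b : 'cV[R]_p) : (reflection b)^T = reflection b.
Proof. by rewrite linearB/= trmx1 linearZ/= trmx_mul trmxK. Qed.

Lemma reflection_orth p (b : 'cV[R]_p) : b != 0 ->
  reflection b *m (reflection b)^T = 1%:M.
Proof.
rewrite -dotvv_eq0 => b0; rewrite reflection_tr.
rewrite {2}/reflection mulmxBr mulmx1 -scalemxAr mulmxA reflectionE.
rewrite mulfK// scaler_nat mulr2n opprD addrA subrr sub0r mulNmx scalerN opprK.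
by rewrite /reflection subrK.
Qed.

End vectors.

(** * Borel measurability of vector operations *)

Section measurable_vectors.
Context {R : realType}.

Lemma measurable_coord m n (i : 'I_m) (j : 'I_n) :
  measurable_fun setT (fun M : 'M[R]_(m, n) => M i j).
Proof.
by move=> _ A mA; apply: sub_sigma_algebra; exists (i, j) => //; exists A.
Qed.

Lemma measurable_mxP d (T : measurableType d) m n (f : T -> 'M[R]_(m, n)) :
  (forall i j, measurable_fun setT (fun w => f w i j)) -> measurable_fun setT f.
Proof.
move=> mf; apply: measurability; first by [].
move=> _ [B [[i j] _ [A mA <-]] <-]; rewrite setTI setTI.
by have := mf i j measurableT A mA; rewrite setTI.
Qed.

Lemma measurable_dotv_fun d (T : measurableType d) p (f g : T -> 'cV[R]_p) :
  measurable_fun setT f -> measurable_fun setT g ->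
  measurable_fun setT (fun w => dotv (f w) (g w)).
Proof.
move=> mf mg; apply: measurable_sum => j.
by apply: measurable_funM; apply: measurableT_comp (measurable_coord _ _) _.
Qed.

Lemma measurable_dotv p (a : 'cV[R]_p) : measurable_fun setT (dotv a).
Proof. exact: measurable_dotv_fun. Qed.

Lemma measurable_dotvr p (a : 'cV[R]_p) : measurable_fun setT (fun x => dotv x a).
Proof. exact: measurable_dotv_fun. Qed.

Lemma measurable_mulmx m n (A : 'M[R]_(m, n)) :
  measurable_fun setT (fun x : 'cV[R]_n => A *m x).
Proof.
apply: measurable_mxP => i j.
rewrite (_ : (fun w => _) = fun w : 'cV[R]_n => \sum_k A i k * w k j); last first.
  by apply/funext => w; rewrite mxE.
by apply: measurable_sum => k; apply: measurable_funM => //; exact: measurable_coord.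
Qed.

Lemma measurable_scale d (T : measurableType d) m n (f : T -> R)
    (g : T -> 'M[R]_(m, n)) : measurable_fun setT f -> measurable_fun setT g ->
  measurable_fun setT (fun w => f w *: g w).
Proof.
move=> mf mg; apply: measurable_mxP => i j.
rewrite (_ : (fun w => _) = fun w => f w * g w i j); last first.
  by apply/funext => w; rewrite mxE.
by apply: measurable_funM => //; apply: measurableT_comp (measurable_coord _ _) _.
Qed.

End measurable_vectors.

(** * Symmetries and covariance of elliptical vectors *)

Section elliptical_moments.
Context {R : realType} {d : measure_display} {T : measurableType d}.
Variables (P : probability T R) (p : nat) (x : {RV P >-> 'cV[R]_p}).
Variables (Sigma : 'M[R]_p) (Fv : probability (measurableTypeR R) R).
Hypothesis ellx : elliptical P x Sigma Fv.

(** [U] and [Q *m U] have the same law and are both independent of [v]; so their pairs with [v] have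
    the same law, and scaling is a measurable function of the pair. *)
Lemma spherical_invariant d' (T' : measurableType d') (P' : probability T' R)
    (v : {RV P' >-> R}) (U : {RV P' >-> 'cV[R]_p}) (Q : 'M[R]_p) :
    uniform_on_sphere P' U -> indep_fun P' v U -> Q *m Q^T = 1%:M ->
  same_law P' P' (fun w => v w *: U w) (fun w => Q *m (v w *: U w)).
Proof.
move=> [_ Uinv] vU QQ.
have mQU : measurable_fun setT (fun w => Q *m U w).
  by apply: measurableT_comp (measurable_mulmx _) _.
have vQU : indep_fun P' v (fun w => Q *m U w).
  exact: (indep_fun_comp (@measurable_id _ R setT) (measurable_mulmx Q) vU).
have vv : same_law P' P' v v by [].
have mv : measurable_fun setT v by [].
have mU : measurable_fun setT U by [].
have H := same_law_pair mv mU mv mQU vU vQU vv (Uinv Q QQ).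
have mf : measurable_fun setT (fun z : R * 'cV[R]_p => z.1 *: z.2).
  exact: measurable_scale.
have := same_law_comp mf H.
rewrite /comp/=; congr same_law; apply/funext => w /=.
by rewrite scalemxAr.
Qed.

(** When [Sigma = B *m B^T], the factor [B] intertwines this map with the Euclidean reflection along
    [B^T *m h]. Applied to [x], it negates [dotv h x] and preserves every linear form whose
    coefficient vector is Sigma-orthogonal to [h]. *)
Definition sreflection (h : 'cV[R]_p) : 'M[R]_p :=
  1%:M - (2 / dotv h (Sigma *m h)) *: (Sigma *m h *m h^T).

Lemma elliptical_sreflection (h : 'cV[R]_p) : 0 < dotv h (Sigma *m h) ->
  same_law P P x (fun w => sreflection h *m x w).
Proof.
move=> h0; case: ellx => _ [d' [T' [P' [v [U [B [SB _ sU vU lawx]]]]]]].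
pose b := B^T *m h.
have bb : dotv b b = dotv h (Sigma *m h).
  by rewrite SB -mulmxA dotv_mulmx.
have b0 : b != 0 by rewrite -dotvv_eq0 bb gt_eqF.
have SBE : sreflection h *m B = B *m reflection b.
  rewrite /reflection mulmxBr mulmx1 mulmxBl mul1mx -scalemxAl -scalemxAr bb SB.
  by rewrite /b trmx_mul trmxK !mulmxA.
have inv := spherical_invariant sU vU (reflection_orth b0).
have mvU : measurable_fun setT (fun w => v w *: U w) by exact: measurable_scale.
move=> A mA; rewrite lawx//.
have mS : measurable ((fun y => sreflection h *m y) @^-1` A).
  by rewrite -[X in measurable X]setTI; exact: (measurable_mulmx _).
rewrite -[RHS]/(P (x @^-1` ((fun y => sreflection h *m y) @^-1` A))) lawx//.
have := same_law_comp (measurable_mulmx B) inv mA; rewrite /comp/=.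
move=> E; transitivity (P' ((fun w => B *m (v w *: U w)) @^-1` A)).
  by congr (P' _); apply/seteqP; split => w /=; rewrite scalemxAr.
rewrite E; congr (P' _); apply/seteqP; split => w /=;
  by rewrite mulmxA -SBE -!scalemxAr mulmxA.
Qed.

(** The vector [xi = v U] has identity covariance: reflecting one axis kills the off-diagonal
    entries, reflecting along a difference of two basis vectors equates the diagonal ones, and their
    sum is [E v^2 = p]. The law of [x] is that of [B xi]. *)
Lemma elliptical_cov (a b : 'cV[R]_p) :
  L1 P (fun w => dotv a (x w) * dotv b (x w)) /\
  Ex P (fun w => dotv a (x w) * dotv b (x w)) = dotv a (Sigma *m b).
Proof.
case: ellx => Fv2 [d' [T' [P' [v [U [B [SB lawv sU vU lawx]]]]]]].
pose xi w := v w *: U w.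
have mxi : measurable_fun setT xi by exact: measurable_scale.
have mxij j : measurable_fun setT (fun w => xi w j 0).
  exact: (measurableT_comp (measurable_coord _ _) mxi).
have inv := spherical_invariant sU vU.
have Ev2 : (\int[P']_w ((v w ^+ 2)%:E) = p%:R%:E)%E.
  have msq : measurable_fun setT (fun t : measurableTypeR R => ((t : R) ^+ 2)%:E).
    by apply/measurable_EFinP; exact: exprn_measurable.
  have sq0 (t : measurableTypeR R) : (0 <= ((t : R) ^+ 2)%:E)%E by rewrite lee_fin sqr_ge0.
  have mv : measurable_fun setT v by [].
  have mid : measurable_fun setT (idfun : measurableTypeR R -> measurableTypeR R).
    exact: measurable_id.
  rewrite -Fv2; exact: (same_law_integral mv mid msq sq0 lawv).
have mv : measurable_fun setT v by [].
have mU : measurable_fun setT U by [].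
have Exi2 : (\int[P']_w (dotv (xi w) (xi w))%:E = p%:R%:E)%E.
  have mxx : measurable_fun setT (fun w => (dotv (xi w) (xi w))%:E).
    by apply/measurable_EFinP; exact: (measurable_dotv_fun mxi mxi).
  have mvv : measurable_fun setT (fun w => (v w ^+ 2)%:E).
    by apply/measurable_EFinP; exact: measurable_funX.
  (* [U] has norm 1 only almost surely, so the squared norm of [xi] equals [v^2] off a null set. *)
  rewrite -Ev2; apply: ge0_ae_eq_integral => //.
  - by move=> w _; rewrite lee_fin dotvv_ge0.
  - by move=> w _; rewrite lee_fin sqr_ge0.
  have mA : measurable [set w | norm2 (U w) = 1].
    have mn : measurable_fun setT (fun w => norm2 (U w)).
      have msqrt : measurable_fun setT (@Num.sqrt R).
        by apply: continuous_measurable_fun; exact: sqrt_continuous.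
      exact: (measurableT_comp msqrt (measurable_dotv_fun mU mU)).
    by rewrite -[X in measurable X]setTI; exact: (mn measurableT [set 1]).
  exists (~` [set w | norm2 (U w) = 1]); split.
  - exact: measurableC.
  - by apply: etrans (probability_setC P' mA) _; rewrite sU.1 subee.
  - move=> w; apply: contra_not => Uw _ /=.
    by rewrite /xi dotvZl dotvZr -norm2_sqr Uw expr1n mulr1.
have ixi2 : L1 P' (fun w => dotv (xi w) (xi w)).
  apply/integrableP; split; first by apply/measurable_EFinP; exact: (measurable_dotv_fun mxi mxi).
  under eq_integral do rewrite /= ger0_norm ?dotvv_ge0//.
  by rewrite Exi2 ltry.
have ixi j k : L1 P' (fun w => xi w j 0 * xi w k 0).
  apply: (L1_dom _ ixi2); first exact: measurable_funM.
  move=> w; rewrite normrM.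
  have := coord_sqr_le (xi w) j; have := coord_sqr_le (xi w) k.
  rewrite -(real_normK (num_real (xi w j 0))) -(real_normK (num_real (xi w k 0))).
  have := sqr_ge0 (`|xi w j 0| - `|xi w k 0|); nra.
pose N j k := Ex P' (fun w => xi w j 0 * xi w k 0).
have invN (Q : 'M[R]_p) j k : Q *m Q^T = 1%:M ->
    N j k = Ex P' (fun w => (Q *m xi w) j 0 * (Q *m xi w) k 0).
  move=> /inv H; have mQxi : measurable_fun setT (fun w => Q *m xi w).
    exact: (measurableT_comp (measurable_mulmx Q) mxi).
  apply: (same_law_Ex (f := fun z : 'cV[R]_p => z j 0 * z k 0) mxi mQxi _ H).
    by apply: measurable_funM; exact: measurable_coord.
  exact: ixi.
have e_neq0 (j : 'I_p) : (delta_mx j 0 : 'cV[R]_p) != 0.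
  by apply/eqP => /matrixP/(_ j 0); rewrite !mxE !eqxx => /eqP; rewrite oner_eq0.
have dote (j : 'I_p) (z : 'cV[R]_p) : dotv (delta_mx j 0) z = z j 0.
  rewrite /dotv (bigD1 j)//= !mxE !eqxx mul1r big1 ?addr0// => k kj.
  by rewrite !mxE (negbTE kj) mul0r.
have Njk j k : j != k -> N j k = 0.
  move=> jk; suff : N j k = -1 * N j k by lra.
  rewrite [LHS](invN _ j k (reflection_orth (e_neq0 j))) -ExZ//.
  congr (Ex P'); apply/funext => w.
  rewrite reflectionE !dote !mxE !eqxx/= eq_sym (negbTE jk)/=.
  by rewrite mulr1n divr1; ring.
have Njj j k : N j j = N k k.
  have [->//|jk] := eqVneq j k.
  have b0 : (delta_mx j 0 - delta_mx k 0 : 'cV[R]_p) != 0.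
    by apply/eqP => /matrixP/(_ j 0); rewrite !mxE !eqxx (negbTE jk) /= subr0 => /eqP;
      rewrite oner_eq0.
  rewrite (invN _ j j (reflection_orth b0)); congr (Ex P'); apply/funext => w.
  suff -> : (reflection (delta_mx j 0 - delta_mx k 0) *m xi w) j 0 = xi w k 0 by [].
  rewrite reflectionE !dotvBl !dotvBr !dote !mxE !eqxx/= (eq_sym k) (negbTE jk)/=.
  by field.
have N1 j : N j j = 1.
  have p0 : (p%:R : R) != 0 by rewrite pnatr_eq0 -lt0n (leq_ltn_trans _ (ltn_ord j)).
  apply: (mulfI p0); rewrite mulr1.
  have : Ex P' (fun w => dotv (xi w) (xi w)) = p%:R by rewrite /Ex /Rintegral Exi2.
  rewrite Ex_sum => [E|k]; last exact: ixi.
  rewrite -[RHS]E (eq_bigr (fun=> N j j)) => [|k _]; last exact: Njj.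
  by rewrite sumr_const card_ord mulr_natl.
have covxi (a' b' : 'cV[R]_p) : L1 P' (fun w => dotv a' (xi w) * dotv b' (xi w)) /\
    Ex P' (fun w => dotv a' (xi w) * dotv b' (xi w)) = dotv a' b'.
  have E w : dotv a' (xi w) * dotv b' (xi w) =
      \sum_j \sum_k (a' j 0 * b' k 0) * (xi w j 0 * xi w k 0).
    rewrite mulr_suml; apply: eq_bigr => j _; rewrite mulr_sumr.
    by apply: eq_bigr => k _; ring.
  have iE j : L1 P' (fun w => \sum_k (a' j 0 * b' k 0) * (xi w j 0 * xi w k 0)).
    by apply: L1_sum => k; exact: L1Z.
  rewrite (_ : (fun w => _) = fun w =>
      \sum_j \sum_k (a' j 0 * b' k 0) * (xi w j 0 * xi w k 0)); last exact/funext.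
  split; first exact: L1_sum.
  rewrite Ex_sum//; apply: eq_bigr => j _; rewrite Ex_sum; last by move=> k; exact: L1Z.
  rewrite (bigD1 j)//= ExZ// -/(N j j) N1 mulr1 big1 ?addr0// => k kj.
  by rewrite ExZ// -/(N j k) Njk ?mulr0// eq_sym.
have [iab Eab] := covxi (B^T *m a) (B^T *m b).
have mBxi : measurable_fun setT (fun w => B *m xi w).
  exact: (measurableT_comp (measurable_mulmx B) mxi).
have lawx' : same_law P' P (fun w => B *m xi w) x.
  move=> A mA; rewrite lawx//; congr (P' _).
  by apply/seteqP; split => w /=; rewrite /xi scalemxAr.
have mf : measurable_fun setT (fun z : 'cV[R]_p => dotv a z * dotv b z).
  by apply: measurable_funM; exact: measurable_dotv.
have fE : (fun w => dotv (B^T *m a) (xi w) * dotv (B^T *m b) (xi w)) =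
  (fun z => dotv a z * dotv b z) \o (fun w => B *m xi w).
  by apply/funext => w /=; rewrite !dotv_mulmx.
have mx : measurable_fun setT x by [].
rewrite fE in iab Eab; split; first exact: (same_law_L1 mBxi mx mf lawx' iab).
rewrite -(same_law_Ex mBxi mx mf lawx' iab) Eab SB -mulmxA.
by rewrite -dotv_mulmx.
Qed.

End elliptical_moments.

(** * Moment bounds and comparison of distribution functions *)

Section moments.
Context {R : realType} {d : measure_display} {T : measurableType d}.
Variable P : probability T R.

(** The inequality [t / k <= expR (t / k)] raised to the power [k]; exponent 0 is separate because
    of the division. *)
Lemma exprn_le_expR (t : R) k : 0 <= t -> t ^+ k <= k%:R ^+ k * expR t.
Proof.
case: k => [|k] t0; first by rewrite !expr0 mul1r -expR0 ler_expR.
have k0 : 0 < (k.+1%:R : R) by rewrite ltr0n.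
rewrite -{2}(divfK (lt0r_neq0 k0) t) expRM_natr -exprMn.
apply: lerXn2r; rewrite ?nnegrE// ?mulr_ge0 ?expR_ge0//.
rewrite mulrC -ler_pdivrMr//; apply: le_trans (expR_ge1Dx _).
by rewrite lerDr.
Qed.

(** The infimum in [psi2_norm] may not be attained, so a scale [t] strictly above it is needed to
    find an admissible [t' < t]. The bound [exprn_le_expR] at [(X / t')^2] then turns the
    exponential moment, at most 2, into the moment of order [2 * k]. *)
Lemma psi2_moment (X : T -> R) (s t : R) k : measurable_fun setT X ->
    (psi2_norm P X <= s%:E)%E -> s < t ->
  L1 P (fun w => X w ^+ (2 * k)) /\
  Ex P (fun w => X w ^+ (2 * k)) <= 2 * k%:R ^+ k * (t ^+ 2) ^+ k.
Proof.
move=> mX Xs st.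
have : (psi2_norm P X < t%:E)%E by rewrite (le_lt_trans Xs)// lte_fin.
move=> /ereal_inf_lt [_ [t' [t'0 Et'] <-]]; rewrite lte_fin => t't.
pose g w := expR ((X w / t') ^+ 2).
have mg : measurable_fun setT g.
  apply: measurableT_comp => //; apply: measurable_funX.
  exact: measurable_funM.
have Eg : (\int[P]_w (g w)%:E <= 2%:E)%E by move: Et'; rewrite unlock.
have ig : L1 P g.
  apply/integrableP; split; first exact/measurable_EFinP.
  under eq_integral do rewrite /= ger0_norm ?expR_ge0//.
  by rewrite (le_lt_trans Eg) ?ltry.
have Eg2 : Ex P g <= 2.
  by rewrite -lee_fin -L1_expectation// unlock.
pose c : R := k%:R ^+ k * (t' ^+ 2) ^+ k.
have Xg w : `|X w ^+ (2 * k)| <= c * g w.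
  rewrite exprM ger0_norm; last exact/exprn_ge0/sqr_ge0.
  have -> : X w ^+ 2 = (X w / t') ^+ 2 * t' ^+ 2.
    by rewrite -exprMn divfK// gt_eqF.
  have -> : c * g w = k%:R ^+ k * g w * (t' ^+ 2) ^+ k by rewrite /c mulrAC.
  rewrite (exprMn _ ((X w / t') ^+ 2)) ler_wpM2r//; first exact/exprn_ge0/sqr_ge0.
  by apply: exprn_le_expR; exact: sqr_ge0.
have iX : L1 P (fun w => X w ^+ (2 * k)).
  by apply: (L1_dom _ (L1Z c ig) Xg); exact: measurable_funX.
split => //; apply: (@le_trans _ _ (Ex P (fun w => c * g w))).
  apply: le_Ex => //; first exact: L1Z.
  by move=> w; rewrite (le_trans (ler_norm _)).
rewrite ExZ// mulrC.
apply: (@le_trans _ _ (2 * c)).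
  by rewrite ler_wpM2r// mulr_ge0//; apply: exprn_ge0; rewrite ?sqr_ge0.
rewrite /c !mulrA ler_wpM2l//.
have t'2 : t' ^+ 2 <= t ^+ 2 by rewrite lerXn2r// ?nnegrE; lra.
by apply: lerXn2r => //; rewrite nnegrE sqr_ge0.
Qed.

Lemma psi2_vec_moment p (x : T -> 'cV[R]_p) (s t : R) k (a : 'cV[R]_p) :
    measurable_fun setT x -> psi2_norm_vec_le P x s -> s < t ->
  L1 P (fun w => dotv a (x w) ^+ (2 * k)) /\
  Ex P (fun w => dotv a (x w) ^+ (2 * k)) <=
    2 * k%:R ^+ k * (dotv a a * t ^+ 2) ^+ k.
Proof.
move=> mx xs st; have [->|a0] := eqVneq a 0.
  have E (b : 'cV[R]_p) : dotv 0 b = 0.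
    by rewrite /dotv big1// => j _; rewrite mxE mul0r.
  under [X in L1 _ X]eq_fun do rewrite E.
  under [X in Ex _ X]eq_fun do rewrite E.
  rewrite E mul0r Ex_cst; split; first exact: L1_cst.
  case: k => [|k]; first by rewrite muln0 !expr0; lra.
  by rewrite exprM expr0n/= !expr0n/= mulr0.
have n0 : 0 < norm2 a by rewrite sqrtr_gt0 lt_def dotvv_ge0 dotvv_eq0 a0.
pose e := (norm2 a)^-1 *: a.
have e1 : norm2 e = 1.
  by rewrite /norm2 dotvZl dotvZr mulrA -norm2_sqr -expr2 -exprMn mulVf
    ?gt_eqF// expr1n sqrtr1.
have me : measurable_fun setT (fun w => dotv e (x w)).
  exact: (measurableT_comp (measurable_dotv e) mx).
have [ie Ee] := psi2_moment k me (xs e e1) st.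
have aE w : dotv a (x w) ^+ (2 * k) = dotv a a ^+ k * dotv e (x w) ^+ (2 * k).
  rewrite -norm2_sqr -exprM -exprMn; congr (_ ^+ _).
  by rewrite /e dotvZl mulrA mulfV ?mul1r// gt_eqF.
rewrite (_ : (fun w => _) = (fun w => dotv a a ^+ k * dotv e (x w) ^+ (2 * k))); last exact/funext.
split; first exact: L1Z.
by rewrite ExZ// exprMn mulrCA ler_wpM2l// exprn_ge0// dotvv_ge0.
Qed.

Lemma Ex_sum_sqr n (xi : 'I_n -> T -> R) v :
    (forall i, measurable_fun setT (xi i)) ->
    (forall i, L1 P (fun w => xi i w ^+ 2)) ->
    (forall i, Ex P (fun w => xi i w ^+ 2) <= v) ->
    (forall i j, i != j -> Ex P (fun w => xi i w * xi j w) = 0) ->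
  L1 P (fun w => (\sum_i xi i w) ^+ 2) /\
  Ex P (fun w => (\sum_i xi i w) ^+ 2) <= n%:R * v.
Proof.
move=> mxi ixi Exi xi0.
have iM i j : L1 P (fun w => xi i w * xi j w) by exact: L1M_sqr.
have E w : (\sum_i xi i w) ^+ 2 = \sum_i \sum_j xi i w * xi j w.
  by rewrite expr2 mulr_suml; apply: eq_bigr => i _; rewrite mulr_sumr.
rewrite (_ : (fun w => _) = (fun w => \sum_i \sum_j xi i w * xi j w)); last exact/funext.
split; first by apply: L1_sum => i; exact: L1_sum.
rewrite Ex_sum; last by move=> i; exact: L1_sum.
rewrite mulr_natl -[X in v *+ X]card_ord -sumr_const; apply: ler_sum => i _.
rewrite Ex_sum// (bigD1 i)//= big1 ?addr0; first exact: Exi.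
by move=> j ji; rewrite xi0// eq_sym.
Qed.

(* Conditioning on [D]: since [Y] and [D] are independent, a bound on the second
   moments of [dotv Y b] for fixed [b] passes to the random vector [D]. *)
Lemma Ex_indep_quadratic p (Y D : T -> 'cV[R]_p) (V : set 'cV[R]_p) (C k : R) :
    measurable_fun setT Y -> measurable_fun setT D -> indep_fun P Y D ->
    (forall j, L1 P (fun w => Y w j 0 ^+ 2)) ->
    (forall w, V (D w) /\ dotv (D w) (D w) <= k ^+ 2) -> 0 <= C ->
    (forall b, V b -> Ex P (fun w => dotv (Y w) b ^+ 2) <= C * dotv b b) ->
  L1 P (fun w => dotv (Y w) (D w) ^+ 2) /\
  Ex P (fun w => dotv (Y w) (D w) ^+ 2) <= C * k ^+ 2.
Proof.
move=> mY mD YD iY DV C0 EY.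
have mYj j : measurable_fun setT (fun w => Y w j 0).
  exact: (measurableT_comp (measurable_coord _ _) mY).
have mDj j : measurable_fun setT (fun w => D w j 0).
  exact: (measurableT_comp (measurable_coord _ _) mD).
have iYY j l : L1 P (fun w => Y w j 0 * Y w l 0) by exact: L1M_sqr.
have iDD j l : L1 P (fun w => D w j 0 * D w l 0).
  apply: (@L1_bounded _ _ _ _ _ (k ^+ 2)); first exact: measurable_funM.
  move=> w; have [_ Dk] := DV w; rewrite normrM.
  have := coord_sqr_le (D w) j; have := coord_sqr_le (D w) l.
  rewrite -(real_normK (num_real (D w j 0))) -(real_normK (num_real (D w l 0))).
  have := sqr_ge0 (`|D w j 0| - `|D w l 0|); nra.
have mprod (j l : 'I_p) : measurable_fun setT (fun b : 'cV[R]_p => b j 0 * b l 0).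
  by apply: measurable_funM; exact: measurable_coord.
have ind j l : indep_fun P (fun w => Y w j 0 * Y w l 0) (fun w => D w j 0 * D w l 0).
  exact: (indep_fun_comp (mprod j l) (mprod j l) YD).
pose G j l := Ex P (fun w => Y w j 0 * Y w l 0).
(* The double sum separates the entries of [Y] from those of [D], so independence applies to each
   product and replaces a conditional expectation. *)
have sqE (a b : 'cV[R]_p) : dotv a b ^+ 2 =
    \sum_j \sum_l (a j 0 * a l 0) * (b j 0 * b l 0).
  rewrite expr2 mulr_suml; apply: eq_bigr => j _; rewrite mulr_sumr.
  by apply: eq_bigr => l _; ring.
have iYD j l : L1 P (fun w => (Y w j 0 * Y w l 0) * (D w j 0 * D w l 0)).
  by have [] := indep_fun_Ex (iYY j l) (iDD j l) (ind j l).
have EG (b : 'cV[R]_p) :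
    \sum_j \sum_l G j l * (b j 0 * b l 0) = Ex P (fun w => dotv (Y w) b ^+ 2).
  transitivity (Ex P (fun w => \sum_j \sum_l (b j 0 * b l 0) * (Y w j 0 * Y w l 0))).
    rewrite Ex_sum; last by move=> j; apply: L1_sum => l; exact: L1Z.
    apply: eq_bigr => j _; rewrite Ex_sum; last by move=> l; exact: L1Z.
    by apply: eq_bigr => l _; rewrite ExZ// mulrC.
  congr (Ex P); apply/funext => w; rewrite sqE; apply: eq_bigr => j _.
  by apply: eq_bigr => l _; ring.
rewrite (_ : (fun w => _) = fun w => \sum_j \sum_l
    (Y w j 0 * Y w l 0) * (D w j 0 * D w l 0)); last first.
  by apply/funext => w; rewrite sqE.
split; first by apply: L1_sum => j; exact: L1_sum.
rewrite Ex_sum; last by move=> j; exact: L1_sum.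
have -> : \sum_j Ex P (fun w => \sum_l (Y w j 0 * Y w l 0) * (D w j 0 * D w l 0)) =
    Ex P (fun w => \sum_j \sum_l G j l * (D w j 0 * D w l 0)).
  rewrite Ex_sum; last by move=> j; apply: L1_sum => l; exact: L1Z.
  apply: eq_bigr => j _; rewrite !Ex_sum//; last by move=> l; exact: L1Z.
  apply: eq_bigr => l _; rewrite ExZ//.
  by have [_ ->] := indep_fun_Ex (iYY j l) (iDD j l) (ind j l).
rewrite -[leRHS](Ex_cst P); apply: le_Ex; last first.
- move=> w; rewrite EG; have [VD Dk] := DV w.
  by rewrite (le_trans (EY _ VD))// ler_wpM2l.
- exact: L1_cst.
- by apply: L1_sum => j; apply: L1_sum => l; exact: L1Z.
Qed.

Lemma Pr_sqr_ge (X : T -> R) v e : measurable_fun setT X ->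
    L1 P (fun w => X w ^+ 2) -> Ex P (fun w => X w ^+ 2) <= v -> 0 < e ->
  measurable [set w | e < `|X w|] /\ Pr P [set w | e < `|X w|] <= v / e ^+ 2.
Proof.
move=> mX iX Ev e0.
have mA : measurable [set w | e < `|X w|].
  have mn : measurable_fun setT (fun w => `|X w|) by exact: measurableT_comp.
  have := @measurable_fun_ltr _ T R setT (cst e) _ (measurable_cst e) mn.
  move=> /(_ measurableT [set true]); rewrite setTI => H.
  rewrite (_ : [set w | e < `|X w|] = (fun w => cst e w < `|X w|) @^-1` [set true]).
    exact: H.
  by apply/seteqP; split => w.
split => //; apply: (@le_trans _ _ (Ex P (fun w => X w ^+ 2) / e ^+ 2)).
  apply: Ex_markov => //; rewrite ?exprn_gt0// => w; first exact: sqr_ge0.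
  by move=> /ltW h; rewrite -(real_normK (num_real (X w))) lerXn2r// nnegrE// ltW.
by rewrite ler_wpM2r// invr_ge0 sqr_ge0.
Qed.

(** On [G] one has [Xi - W = ((1 - Q) * W - E) / Q]. If moreover [|W| <= l] and both [|Q - 1|] and
    [|E|] are at most [eta], then [Q >= 1/2], whence the factor 2 in the condition on [dl]. The
    bound adds the probabilities of the four exceptions. *)
Lemma ratio_close (W Q E Xi : T -> R) (G : set T) (vQ vE eta l dl : R) :
    measurable_fun setT W -> measurable_fun setT Q -> measurable_fun setT E ->
    measurable_fun setT Xi -> measurable G ->
    L1 P (fun w => W w ^+ 2) -> Ex P (fun w => W w ^+ 2) <= 1 ->
    L1 P (fun w => (Q w - 1) ^+ 2) -> Ex P (fun w => (Q w - 1) ^+ 2) <= vQ ->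
    L1 P (fun w => E w ^+ 2) -> Ex P (fun w => E w ^+ 2) <= vE ->
    (forall w, G w -> Q w != 0 -> Xi w = (W w - E w) / Q w) ->
    0 < eta -> eta <= 2^-1 -> 0 < l -> 2 * eta * (l + 1) <= dl ->
  measurable [set w | dl < `|Xi w - W w|] /\
  Pr P [set w | dl < `|Xi w - W w|] <=
    1 / l ^+ 2 + vQ / eta ^+ 2 + vE / eta ^+ 2 + (1 - Pr P G).
Proof.
move=> mW mQ mE mXi mG iW EW iQ EQ iE EE XiE eta0 eta1 l0 dlE.
have [mA1 PA1] := Pr_sqr_ge mW iW EW l0.
have mQ1 : measurable_fun setT (fun w => Q w - 1) by exact: measurable_funB.
have [mA2 PA2] := Pr_sqr_ge mQ1 iQ EQ eta0.
have [mA3 PA3] := Pr_sqr_ge mE iE EE eta0.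
have mB : measurable [set w | dl < `|Xi w - W w|].
  have mn : measurable_fun setT (fun w => `|Xi w - W w|).
    by apply: measurableT_comp => //; exact: measurable_funB.
  have := @measurable_fun_ltr _ T R setT (cst dl) _ (measurable_cst dl) mn.
  move=> /(_ measurableT [set true]); rewrite setTI => H.
  rewrite (_ : [set w | _] = (fun w => cst dl w < `|Xi w - W w|) @^-1` [set true]).
    exact: H.
  by apply/seteqP; split => w.
split => //; pose U := ([set w | l < `|W w|] `|` [set w | eta < `|Q w - 1|])
  `|` ([set w | eta < `|E w|] `|` ~` G).
have mU1 := measurableU _ _ mA1 mA2.
have mU2 := measurableU _ _ mA3 (measurableC mG).
have mU : measurable U by exact: measurableU.
apply: (@le_trans _ _ (Pr P U)).
  apply: le_Pr => // w /= dlX; apply: contrapT => nU; move: dlX; apply/negP.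
  rewrite -leNgt.
  have lW : `|W w| <= l by rewrite leNgt; apply/negP => h; apply: nU; left; left.
  have Qe : `|Q w - 1| <= eta.
    by rewrite leNgt; apply/negP => h; apply: nU; left; right.
  have Ee : `|E w| <= eta by rewrite leNgt; apply/negP => h; apply: nU; right; left.
  have Gw : G w by apply: contrapT => h; apply: nU; right; right.
  have Qh : 2^-1 <= Q w by move: Qe; rewrite ler_norml => /andP[? ?]; lra.
  have Q0 : 0 < Q w by lra.
  rewrite XiE ?gt_eqF//.
  have -> : (W w - E w) / Q w - W w = ((1 - Q w) * W w - E w) / Q w.
    by field; rewrite gt_eqF.
  rewrite normrM normfV (gtr0_norm Q0) ler_pdivrMr//.
  have num : `|(1 - Q w) * W w - E w| <= eta * (l + 1).
    rewrite (le_trans (ler_normB _ _))// mulrDr mulr1 lerD//.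
    by rewrite normrM distrC ler_pM.
  apply: le_trans num _; apply: (@le_trans _ _ (dl * 2^-1)); first lra.
  have p0 : 0 < eta * (l + 1) by rewrite mulr_gt0//; lra.
  have dl0 : 0 <= dl by lra.
  by rewrite ler_wpM2l.
apply: le_trans (Pr_setU P mU1 mU2) _.
have := Pr_setU P mA1 mA2; have := Pr_setU P mA3 (measurableC mG).
rewrite Pr_setC//; lra.
Qed.

Lemma cdf_sandwich (W Xi : T -> R) (a dl : R) : measurable_fun setT W ->
    measurable_fun setT Xi -> measurable [set w | dl < `|Xi w - W w|] ->
  Pr P [set w | Xi w <= a] <=
    Pr P [set w | W w <= a + dl] + Pr P [set w | dl < `|Xi w - W w|] /\
  Pr P [set w | W w <= a - dl] <=
    Pr P [set w | Xi w <= a] + Pr P [set w | dl < `|Xi w - W w|].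
Proof.
move=> mW mXi mB.
have mle (X : T -> R) e : measurable_fun setT X -> measurable [set w | X w <= e].
  move=> mX; rewrite -[X in measurable X]setTI.
  exact: (measurable_fun_le (f := X) (g := cst e)).
split.
  apply: le_trans (Pr_setU P (mle _ _ mW) mB); apply: le_Pr => //; first exact: mle.
    by apply: measurableU => //; exact: mle.
  move=> w /= Xa; have [h|h] := leP `|Xi w - W w| dl; [left|right] => //=.
  by move: h; rewrite ler_norml => /andP[? ?]; lra.
apply: le_trans (Pr_setU P (mle _ _ mXi) mB); apply: le_Pr => //; first exact: mle.
  by apply: measurableU => //; exact: mle.
move=> w /= Xa; have [h|h] := leP `|Xi w - W w| dl; [left|right] => //=.
by move: h; rewrite ler_norml => /andP[? ?]; lra.
Qed.

End moments.

(** * Independence and symmetry in the sampling model *)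

Section sample.
Context {R : realType} {d : measure_display} {T : measurableType d}.
Context {P : probability T R} {N p : nat} {Sigma : 'M[R]_p}.
Context {Fv : probability (measurableTypeR R) R} {tau : 'cV[R]_p} {f : R * R -> R}.
Context {x : nat -> {RV P >-> 'cV[R]_p}} {u y : nat -> {RV P >-> R}}.
Hypothesis sis : single_index_sample N Sigma Fv tau f x u y.

Definition obs_index (k : 'I_N + 'I_N) : nat :=
  match k with inl i => i.+1 | inr i => i.+1 end.

Definition obs_sigma (k : 'I_N + 'I_N) : set_system T := match k with
  | inl i => g_sigma_algebra_preimage (x i.+1)
  | inr i => g_sigma_algebra_preimage (u i.+1)
  end.

(* [T] with the sigma-algebra generated by the observations indexed by [J] *)
Definition block (J : set nat) :=
  g_sigma_algebraType (\bigcup_(k in [set k | J (obs_index k)]) obs_sigma k).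

Lemma block_indep d1 d2 (S1 : measurableType d1) (S2 : measurableType d2)
    (J K : set nat) (X : T -> S1) (Y : T -> S2) :
    (forall i, J i -> K i -> False) ->
    measurable_fun setT (X : block J -> S1) ->
    measurable_fun setT (Y : block K -> S2) -> indep_fun P X Y.
Proof.
move=> JK mX mY A B mA mB.
have GT k : obs_sigma k setT.
  by case: k => i; exists setT => //; rewrite setTI preimage_setT.
have GI k : setI_closed (obs_sigma k).
  by case: k => i _ _ [C mC <-] [D mD <-]; exists (C `&` D);
    rewrite ?setTI ?preimage_setI//; exact: measurableI.
have Gm k : obs_sigma k `<=` measurable.
  by case: k => i _ [C mC <-]; rewrite setTI; exact: measurable_funPTI.
have GP : mutually_independent P obs_sigma.
  move=> E GE; exact: (sis_independent sis).
apply: (indep_blocks GT GI Gm GP (J := [set k | J (obs_index k)])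
  (K := [set k | K (obs_index k)])).
- by move=> k; exact: JK.
- by have := mX measurableT A mA; rewrite setTI.
- by have := mY measurableT B mB; rewrite setTI.
Qed.

Lemma x_block (J : set nat) i : (0 < i <= N)%N -> J i ->
  measurable_fun setT (x i : block J -> 'cV[R]_p).
Proof.
case: i => // i /= iN Ji _ A mA; rewrite setTI; apply: sub_sigma_algebra.
by exists (inl (Ordinal iN)) => //; exists A => //; rewrite setTI.
Qed.

Lemma u_block (J : set nat) i : (0 < i <= N)%N -> J i ->
  measurable_fun setT (u i : block J -> R).
Proof.
case: i => // i /= iN Ji _ A mA; rewrite setTI; apply: sub_sigma_algebra.
by exists (inr (Ordinal iN)) => //; exists A => //; rewrite setTI.
Qed.

(** The response is given on the whole space; being pointwise the link applied to [x i] and [u i],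
    it is measurable for any block that contains [i]. *)
Lemma y_block (J : set nat) i : (0 < i <= N)%N -> J i ->
  measurable_fun setT (y i : block J -> R).
Proof.
move=> iN Ji; have -> : (y i : T -> R) = (fun w => f (dotv (x i w) tau, u i w)).
  by apply/funext => w; rewrite (sis_model sis).
apply: (measurableT_comp (sis_link_measurable sis)).
apply: measurable_fun_pair; last exact: u_block.
exact: (measurableT_comp (measurable_dotvr tau) (x_block iN Ji)).
Qed.

(** A [block] never separates [x i] from [u i], so this goes back to [indep_blocks] with two
    singletons of indices. *)
Lemma xu_indep i : (0 < i <= N)%N -> indep_fun P (x i) (u i).
Proof.
move=> iN A B mA mB; case: i iN => // i /= iN.
have GT k : obs_sigma k setT.
  by case: k => j; exists setT => //; rewrite setTI preimage_setT.
have GI k : setI_closed (obs_sigma k).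
  by case: k => j _ _ [C mC <-] [D mD <-]; exists (C `&` D);
    rewrite ?setTI ?preimage_setI//; exact: measurableI.
have Gm k : obs_sigma k `<=` measurable.
  by case: k => j _ [C mC <-]; rewrite setTI; exact: measurable_funPTI.
have GP : mutually_independent P obs_sigma.
  move=> E GE; exact: (sis_independent sis).
apply: (indep_blocks GT GI Gm GP (J := [set inl (Ordinal iN)])
  (K := [set inr (Ordinal iN)])).
- by move=> k -> .
- apply: sub_sigma_algebra; exists (inl (Ordinal iN)) => //.
  by exists A => //; rewrite setTI.
- apply: sub_sigma_algebra; exists (inr (Ordinal iN)) => //.
  by exists B => //; rewrite setTI.
Qed.

Lemma obs_same_law i j : (0 < i <= N)%N -> (0 < j <= N)%N ->
  same_law P P (fun w => (x i w, u i w)) (fun w => (x j w, u j w)).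
Proof.
move=> iN jN; apply: same_law_pair => //; [exact: xu_indep|exact: xu_indep| |].
- exact: (sis_x_id sis).
- by move=> A mA; rewrite !(sis_u_uniform sis).
Qed.

(** The moment assumption on the response and the definition of [nu] speak of observation [n] only;
    this carries them to the other observations. *)
Lemma obs_transfer i j (phi : 'cV[R]_p * R -> R) :
    (0 < i <= N)%N -> (0 < j <= N)%N -> measurable_fun setT phi ->
    L1 P (fun w => phi (x i w, u i w)) ->
  L1 P (fun w => phi (x j w, u j w)) /\
  Ex P (fun w => phi (x j w, u j w)) = Ex P (fun w => phi (x i w, u i w)).
Proof.
move=> iN jN mphi iphi.
have mo k : measurable_fun setT (fun w => (x k w, u k w)).
  exact: measurable_fun_pair.
split; first exact: (same_law_L1 (mo i) (mo j) mphi (obs_same_law iN jN) iphi).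
by rewrite -(same_law_Ex (mo i) (mo j) mphi (obs_same_law iN jN) iphi).
Qed.

(* A reflection fixing [tau] in law preserves the joint law of one observation
   and negates [dotv h x], so the response is uncorrelated with [dotv h x]. *)
Lemma response_uncorrelated i (h : 'cV[R]_p) : (0 < i <= N)%N ->
    dotv h (Sigma *m tau) = 0 -> L1 P (fun w => dotv h (x i w) * y i w) ->
  Ex P (fun w => dotv h (x i w) * y i w) = 0.
Proof.
move=> iN hS ihy; have [symS posS] := sis_pos_def sis.
have [->|h0] := eqVneq h 0.
  rewrite -[RHS](Ex_cst P 0); congr (Ex P); apply/funext => w.
  by rewrite /dotv big1 ?mul0r// => j _; rewrite mxE mul0r.
have hSh := posS _ h0.
pose Q := sreflection Sigma h.
have QE z : Q *m z = z - (2 / dotv h (Sigma *m h) * dotv h z) *: (Sigma *m h).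
  rewrite mulmxBl mul1mx -scalemxAl -[_ *m h^T *m z]mulmxA.
  by rewrite [h^T *m z]mx11_scalar -dotvE mul_mx_scalar scalerA.
have hQ z : dotv h (Q *m z) = - dotv h z.
  by rewrite QE dotvBr dotvZr mulrAC divfK ?gt_eqF//; ring.
have Qtau z : dotv (Q *m z) tau = dotv z tau.
  rewrite QE dotvBl dotvZl (_ : dotv (Sigma *m h) tau = 0) ?mulr0 ?subr0//.
  by rewrite -{1}symS -dotv_mulmx.
have mx : measurable_fun setT (x i) by [].
have mu : measurable_fun setT (u i) by [].
have mQx : measurable_fun setT (fun w => Q *m x i w).
  exact: (measurableT_comp (measurable_mulmx Q) mx).
have Qxu : indep_fun P (fun w => Q *m x i w) (u i).
  exact: (indep_fun_comp (measurable_mulmx Q) (@measurable_id _ R setT) (xu_indep iN)).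
have lawQ := elliptical_sreflection (sis_elliptical sis iN) hSh.
have uu : same_law P P (u i) (u i) by [].
have law2 := same_law_pair mx mu mQx mu (xu_indep iN) Qxu lawQ uu.
pose phi (z : 'cV[R]_p * R) := dotv h z.1 * f (dotv z.1 tau, z.2).
have mphi : measurable_fun setT phi.
  apply: measurable_funM; first exact: (measurableT_comp (measurable_dotv h)).
  apply: (measurableT_comp (sis_link_measurable sis)).
  apply: measurable_fun_pair => //.
  exact: (measurableT_comp (measurable_dotvr tau)).
have phiE : (fun w => dotv h (x i w) * y i w) = phi \o (fun w => (x i w, u i w)).
  by apply/funext => w; rewrite /phi /= (sis_model sis iN).
have phiQ : phi \o (fun w => (Q *m x i w, u i w)) =
    (fun w => -1 * (dotv h (x i w) * y i w)).
  by apply/funext => w; rewrite /phi /= (sis_model sis iN) hQ Qtau mulN1r mulNr.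
have mxu : measurable_fun setT (fun w => (x i w, u i w)) by exact: measurable_fun_pair.
have mQxu : measurable_fun setT (fun w => (Q *m x i w, u i w)).
  exact: measurable_fun_pair.
have := same_law_Ex mxu mQxu mphi law2; rewrite -phiE phiQ ExZ// => /(_ ihy).
lra.
Qed.

End sample.

(** * The direction of the nodewise residual *)

Section node_direction.
Context {R : realType} {q : nat}.
Implicit Types (S : 'M[R]_q.+1) (v g : 'cV[R]_q).

Definition emb v : 'cV[R]_q.+1 :=
  \col_j oapp (fun k => v k 0) 0 (unlift ord0 j).

Definition unit0 : 'cV[R]_q.+1 := delta_mx 0 0.

(* The residual [r] of the nodewise regression is [dotv (node_dir gamma) x]. *)
Definition node_dir g : 'cV[R]_q.+1 := unit0 - emb g.

Lemma emb0 v : emb v 0 0 = 0.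
Proof. by rewrite mxE unlift_none. Qed.

Lemma embS v k : emb v (lift ord0 k) 0 = v k 0.
Proof. by rewrite mxE liftK. Qed.

Lemma dotv_delta p (j : 'I_p) (z : 'cV[R]_p) : dotv (delta_mx j 0) z = z j 0.
Proof.
rewrite /dotv (bigD1 j)//= !mxE !eqxx mul1r big1 ?addr0// => k kj.
by rewrite !mxE (negbTE kj) mul0r.
Qed.

Lemma dotv_emb v (z : 'cV[R]_q.+1) : dotv (emb v) z = dotv v (other_coords z).
Proof.
rewrite /dotv big_ord_recl emb0 mul0r add0r; apply: eq_bigr => k _.
by rewrite embS /other_coords mxE.
Qed.

Lemma nodewise_rE d (T : measurableType d) g (X : T -> 'cV[R]_q.+1) w :
  nodewise_r g X w = dotv (node_dir g) (X w).
Proof.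
by rewrite /nodewise_r /node_dir dotvBl dotv_delta dotv_emb.
Qed.

Lemma emb_other (b : 'cV[R]_q.+1) : b 0 0 = 0 -> b = emb (other_coords b).
Proof.
move=> b0; apply/matrixP => j k; rewrite ord1 mxE.
by case: unliftP => [l ->|->] /=; rewrite ?mxE.
Qed.

Definition minor00 S : 'M[R]_q := row' ord0 (col' ord0 S).

Lemma other_mulmx_emb S v : other_coords (S *m emb v) = minor00 S *m v.
Proof.
apply/matrixP => j k; rewrite ord1 !mxE big_ord_recl emb0 mulr0 add0r.
by apply: eq_bigr => l _; rewrite embS !mxE.
Qed.

Lemma minor00_sym S : S^T = S -> (minor00 S)^T = minor00 S.
Proof. by move=> symS; apply/matrixP => j k; rewrite !mxE -[in LHS]symS mxE. Qed.

(** A kernel vector of the minor, padded with a zero, would be a nonzero vector at which the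
    quadratic form of [S] vanishes. *)
Lemma minor00_unit S : pos_def S -> minor00 S \in unitmx.
Proof.
move=> [symS posS]; have symM := minor00_sym symS.
rewrite -row_free_unit -kermx_eq0; apply/negPn/negP => /rowV0Pn[w /sub_kermxP wM w0].
have e0 : emb w^T != 0.
  apply: contra w0 => /eqP e0; apply/eqP/matrixP => j k.
  by have /matrixP/(_ (lift ord0 k) 0) := e0; rewrite embS !mxE ord1.
have := posS _ e0; rewrite dotv_emb other_mulmx_emb.
rewrite -symM -trmx_mul wM trmx0 /dotv big1 ?ltxx// => j _.
by rewrite [X in _ * X]mxE mulr0.
Qed.

(** The condition on [g] is the normal equation of the regression of the first coordinate on the
    others; geometrically, it makes the residual direction S-orthogonal to the hyperplane of vectors
    with first coordinate 0. *)
Lemma node_dir_orth S g (b : 'cV[R]_q.+1) : S^T = S ->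
    minor00 S *m g = other_coords (S *m unit0) -> b 0 0 = 0 ->
  dotv (node_dir g) (S *m b) = 0.
Proof.
move=> symS Mg /emb_other ->; set v := other_coords b.
rewrite /node_dir dotvBl.
have -> : dotv unit0 (S *m emb v) = dotv v (minor00 S *m g).
  by rewrite dotv_mulmx symS dotvC dotv_emb Mg.
by rewrite dotv_emb other_mulmx_emb dotv_mulmx minor00_sym// dotvC subrr.
Qed.

Lemma node_dir_0 g : node_dir g 0 0 = 1.
Proof. by rewrite mxE [X in _ + X]mxE emb0 mxE !eqxx subr0. Qed.

End node_direction.

Lemma nodewise_gammaP (R : realType) (d : measure_display) (T : measurableType d)
    (P : probability T R) (q : nat) (x : {RV P >-> 'cV[R]_q.+1}) (Sigma : 'M[R]_q.+1)
    (Fv : probability (measurableTypeR R) R) :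
    pos_def Sigma -> elliptical P x Sigma Fv ->
  minor00 Sigma *m nodewise_gamma P x = other_coords (Sigma *m unit0).
Proof.
move=> posS ellx.
have cov j k : fine 'E_P[(fun w => x w j 0 * x w k 0)%R]%E = Sigma j k.
  have [_] := elliptical_cov ellx (delta_mx j 0) (delta_mx k 0).
  rewrite fine_expectation dotv_delta -colE mxE => <-.
  by congr (Ex P); apply/funext => w; rewrite !dotv_delta.
rewrite /nodewise_gamma.
have -> : mx_expectation P (fun w => other_coords (x w) *m (other_coords (x w))^T) =
    minor00 Sigma.
  apply/matrixP => j k; rewrite !mxE -cov; congr (fine 'E_P[_]%E).
  by apply/funext => w; rewrite mxE big_ord1 !mxE.
have -> : mx_expectation P (fun w => fst_coord (x w) *: other_coords (x w)) =
    other_coords (Sigma *m unit0).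
  apply/matrixP => j k; rewrite ord1 mxE -colE !mxE -cov; congr (fine 'E_P[_]%E).
  by apply/funext => w; rewrite !mxE mulrC.
by rewrite mulmxA mulmxV ?mul1mx// minor00_unit.
Qed.

(** * A Lindeberg tail estimate *)

Section tail_bound.
Context {R : realType}.

Lemma powR_le_even (t e : R) k : 0 <= e -> e <= (2 * k)%:R ->
  `|t| `^ e <= 1 + t ^+ (2 * k).
Proof.
move=> e0 ek; have t0 := normr_ge0 t.
have E : t ^+ (2 * k) = `|t| ^+ (2 * k) by rewrite !exprM real_normK// num_real.
have [t1|t1] := leP `|t| 1.
  rewrite -[leLHS]addr0 lerD//; last by rewrite E exprn_ge0.
  have <- : 1 `^ e = 1 :> R by rewrite powR1.
  by apply: ge0_ler_powR => //; rewrite nnegrE.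
rewrite E -powR_mulrn//; apply: (@le_trans _ _ (`|t| `^ (2 * k)%:R)).
  by apply: ler_powR => //; exact: ltW.
by rewrite lerDr.
Qed.

(** A pointwise trade-off for a factor [z] with few moments and a factor [r] with all of them. If
    [r^(2+e) <= z^e], the product costs only [e] more powers of [z]; otherwise [z] is at most
    [r^((2+e)/e)] and everything is a power of [r]. *)
Lemma powR_prod_le (r z e : R) : 0 < e -> 1 <= r -> 1 <= z ->
  (r * z) `^ (2 + e) <= z `^ (2 + 2 * e) + r `^ ((2 + e) + (2 + e) ^+ 2 / e).
Proof.
move=> e0 r1 z1; have r0 : 0 <= r by lra.
have z0 : 0 <= z by lra.
have z_neq0 : z != 0 by rewrite gt_eqF//; lra.
have r_neq0 : r != 0 by rewrite gt_eqF//; lra.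
rewrite powRM//; have [h|/ltW h] := leP (r `^ (2 + e)) (z `^ e).
  apply: (@le_trans _ _ (z `^ (2 + 2 * e))); last by rewrite lerDl powR_ge0.
  rewrite (_ : 2 + 2 * e = e + (2 + e)); last by ring.
  rewrite [leRHS]powRD; last by rewrite z_neq0 implybT.
  by rewrite ler_wpM2r// powR_ge0.
apply: (@le_trans _ _ (r `^ ((2 + e) + (2 + e) ^+ 2 / e))); last first.
  by rewrite lerDr powR_ge0.
rewrite [leRHS]powRD; last by rewrite r_neq0 implybT.
rewrite ler_wpM2l ?powR_ge0//.
have -> : z `^ (2 + e) = (z `^ e) `^ ((2 + e) / e).
  by rewrite -powRrM; congr (_ `^ _); field; rewrite gt_eqF.
have -> : r `^ ((2 + e) ^+ 2 / e) = (r `^ (2 + e)) `^ ((2 + e) / e).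
  by rewrite -powRrM; congr (_ `^ _); field; rewrite gt_eqF.
apply: ge0_ler_powR; rewrite ?nnegrE ?powR_ge0// divr_ge0//; lra.
Qed.

Lemma powR_diff_le (y v e : R) k : 0 <= e -> e <= (2 * k)%:R ->
  Num.max 1 `|y - v| `^ e <= 2 `^ e * (2 + `|y| `^ e + v ^+ (2 * k)).
Proof.
move=> e0 ek.
have pos : 0 <= v ^+ (2 * k) by rewrite exprM exprn_ge0// sqr_ge0.
have ypos : 0 <= `|y| `^ e by exact: powR_ge0.
have up (t : R) : 0 <= t -> Num.max 1 `|y - v| <= 2 * t ->
    t `^ e <= 2 + `|y| `^ e + v ^+ (2 * k) ->
    Num.max 1 `|y - v| `^ e <= 2 `^ e * (2 + `|y| `^ e + v ^+ (2 * k)).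
  move=> t0 mt te; apply: (@le_trans _ _ ((2 * t) `^ e)).
    apply: ge0_ler_powR => //; rewrite nnegrE; last by rewrite mulr_ge0.
    by rewrite le_max ler01.
  by rewrite powRM// ler_wpM2l// powR_ge0.
have nyv := ler_normB y v.
have [y1|y1] := leP `|y| 1; have [v1|v1] := leP `|v| 1.
- apply: (up 1) => //; last by rewrite powR1; lra.
  by rewrite ge_max; apply/andP; split; lra.
- apply: (up `|v|) => //; last by have := powR_le_even v e0 ek; lra.
  by rewrite ge_max; apply/andP; split; lra.
- apply: (up `|y|) => //; last lra.
  by rewrite ge_max; apply/andP; split; lra.
have [yv|yv] := leP `|y| `|v|.
- apply: (up `|v|) => //; last by have := powR_le_even v e0 ek; lra.
  by rewrite ge_max; apply/andP; split; lra.
- apply: (up `|y|) => //; last lra.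
  by rewrite ge_max; apply/andP; split; lra.
Qed.

(** On the tail [X^2 <= L^(-e) * |X|^(2+e)] with [e = alpha / 2]. Only half of the spare exponent is
    spent here, because splitting the product by [powR_prod_le] raises [2 + e] to
    [2 + 2 * e = 2 + alpha]. As [k] and [C] depend on [alpha] alone, the bound is uniform over the
    rows. *)
Lemma tail_bound (alpha : R) : 0 < alpha ->
  exists (k : nat) (C : R), 0 < C /\ forall s L r y v sd : R,
    0 < s -> s <= sd -> 0 < L ->
  (if `|r * (y - v) / sd| <= L then 0 else (r * (y - v) / sd) ^+ 2) <=
    (L `^ (alpha / 2) * s `^ (2 + alpha / 2))^-1 *
    (C * (1 + `|y| `^ (2 + alpha) + v ^+ (2 * k) + r ^+ (2 * k))).
Proof.
move=> a0; pose e := alpha / 2; have e0 : 0 < e by rewrite divr_gt0.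
pose m := (2 + e) + (2 + e) ^+ 2 / e.
have m0 : 0 <= m by rewrite addr_ge0 ?divr_ge0 ?sqr_ge0//; lra.
(* [2 * k] must exceed the exponent [m] of [r] as well as the exponent [2 + alpha] of [v]; the
   sub-Gaussian bounds concern even moments. *)
pose k := Num.bound (m + (2 + alpha)).
have kb : m + (2 + alpha) < k%:R by apply: archi_boundP; lra.
have k2 : (k%:R : R) <= (2 * k)%:R by rewrite ler_nat leq_pmull.
pose C : R := 3 + 2 `^ (2 + alpha) * 2.
have C2 : 0 <= 2 `^ (2 + alpha) :> R by exact: powR_ge0.
exists k, C; split; first by rewrite /C; lra.
move=> s L r y v sd s0 ssd L0; set X := r * (y - v) / sd.
have Le0 : 0 < L `^ e by exact: powR_gt0.
have se0 : 0 < s `^ (2 + e) by exact: powR_gt0.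
have sd0 : 0 < sd by lra.
have vpos : 0 <= v ^+ (2 * k) by rewrite exprM exprn_ge0// sqr_ge0.
have rpos : 0 <= r ^+ (2 * k) by rewrite exprM exprn_ge0// sqr_ge0.
have ypos : 0 <= `|y| `^ (2 + alpha) by exact: powR_ge0.
have rhs0 : 0 <= C * (1 + `|y| `^ (2 + alpha) + v ^+ (2 * k) + r ^+ (2 * k)).
  by rewrite mulr_ge0// /C; lra.
rewrite mulrC ler_pdivlMr ?mulr_gt0//.
case: ifPn => [_|]; first by rewrite mul0r.
rewrite -ltNge => LX; have X0 : 0 < `|X| by lra.
apply: (@le_trans _ _ (`|X| `^ (2 + e) * s `^ (2 + e))).
  rewrite mulrA ler_wpM2r ?(ltW se0)// powRD; last by rewrite (gt_eqF X0) implybT.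
  rewrite powR_mulrn// real_normK ?num_real// ler_wpM2l ?sqr_ge0//.
  by apply: ge0_ler_powR; rewrite ?nnegrE//; exact: ltW.
rewrite -powRM ?(ltW s0)//.
pose r' := Num.max 1 `|r|; pose z' := Num.max 1 `|y - v|.
have r'1 : 1 <= r' by rewrite le_max lexx.
have z'1 : 1 <= z' by rewrite le_max lexx.
apply: (@le_trans _ _ ((r' * z') `^ (2 + e))).
  apply: ge0_ler_powR; rewrite ?nnegrE.
  - lra.
  - by rewrite mulr_ge0// ltW.
  - by rewrite mulr_ge0//; lra.
  rewrite /X normrM normfV (gtr0_norm sd0) normrM.
  apply: (@le_trans _ _ (`|r| * `|y - v|)).
    rewrite -[leLHS]mulrA ler_piMr ?mulr_ge0//.
    by rewrite mulrC ler_pdivrMr// mul1r.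
  by rewrite ler_pM// le_max lexx orbT.
apply: le_trans (powR_prod_le e0 r'1 z'1) _; rewrite -/m.
have -> : 2 + 2 * e = 2 + alpha by rewrite /e; field.
have Z : z' `^ (2 + alpha) <= 2 `^ (2 + alpha) * (2 + `|y| `^ (2 + alpha) + v ^+ (2 * k)).
  by apply: powR_diff_le; lra.
have Rr : r' `^ m <= 2 + r ^+ (2 * k).
  rewrite /r'; have [r1|r1] := leP `|r| 1; first by rewrite powR1; lra.
  by have := @powR_le_even r m k m0; lra.
rewrite /C; move: (2 `^ (2 + alpha)) C2 Z => c2 C2 Z.
have := mulr_ge0 C2 ypos; have := mulr_ge0 C2 vpos; have := mulr_ge0 C2 rpos.
lra.
Qed.

End tail_bound.

(** * Estimates in one row of the triangular array *)

Section row.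
Context {R : realType} {d : measure_display} {T : measurableType d}.
Context {P : probability T R} {n q : nat} {Sigma : 'M[R]_q.+1}.
Context {Fv : probability (measurableTypeR R) R} {tau : 'cV[R]_q.+1} {f : R * R -> R}.
Context {x : nat -> {RV P >-> 'cV[R]_q.+1}} {u y : nat -> {RV P >-> R}}.
Context {s t c alpha M : R}.
Hypothesis n_gt0 : (0 < n)%N.
Hypothesis sis : single_index_sample (n + n) Sigma Fv tau f x u y.
Hypothesis subg : forall i, (0 < i <= n + n)%N -> psi2_norm_vec_le P (x i) s.
Hypothesis st : s < t.
Hypothesis c_gt0 : 0 < c.
Hypothesis cSigma : c <= lambda_min Sigma.
Hypothesis alpha_gt0 : 0 < alpha.
Hypothesis yM : ('E_P[fun w => (`|y n w| `^ (2 + alpha))%R] <= M%:E)%E.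

Let beta := index_beta P tau (x n) (y n).
Let gamma := nodewise_gamma P (x n).
Let r i : T -> R := nodewise_r gamma (x i).
Let z i : T -> R := index_z beta (x i) (y i).
Let a := node_dir gamma.
Let rho := dotv a (Sigma *m a).

Let nN : (0 < n <= n + n)%N.
Proof. by rewrite n_gt0 leq_addr. Qed.

Let symS : Sigma^T = Sigma. Proof. by case: (sis_pos_def sis). Qed.

Let c_quad v : c * dotv v v <= dotv v (Sigma *m v).
Proof.
by apply: le_trans (lambda_min_le symS v); rewrite ler_wpM2r// dotvv_ge0.
Qed.

Lemma row_rE i w : r i w = dotv a (x i w).
Proof. exact: nodewise_rE. Qed.

Lemma row_cov i (b b' : 'cV[R]_q.+1) : (0 < i <= n + n)%N ->
  L1 P (fun w => dotv b (x i w) * dotv b' (x i w)) /\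
  Ex P (fun w => dotv b (x i w) * dotv b' (x i w)) = dotv b (Sigma *m b').
Proof. by move=> iN; exact: elliptical_cov (sis_elliptical sis iN) b b'. Qed.

Lemma row_moment i k (b : 'cV[R]_q.+1) K : (0 < i <= n + n)%N -> dotv b b <= K ->
  L1 P (fun w => dotv b (x i w) ^+ (2 * k)) /\
  Ex P (fun w => dotv b (x i w) ^+ (2 * k)) <= 2 * k%:R ^+ k * (K * t ^+ 2) ^+ k.
Proof.
move=> iN bK; have mx : measurable_fun setT (x i) by [].
have [ib Eb] := psi2_vec_moment k b mx (subg iN) st; split => //.
apply: le_trans Eb _; rewrite ler_wpM2l//.
have b0 := dotvv_ge0 b; have t0 := sqr_ge0 t; have K0 := le_trans b0 bK.
apply: lerXn2r; rewrite ?nnegrE; [exact: mulr_ge0|exact: mulr_ge0|].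
exact: ler_wpM2r.
Qed.

Lemma row_dir_orth (b : 'cV[R]_q.+1) : b 0 0 = 0 -> dotv a (Sigma *m b) = 0.
Proof.
apply: node_dir_orth => //.
exact: nodewise_gammaP (sis_pos_def sis) (sis_elliptical sis nN).
Qed.

(** [unit0] and [a] differ by a vector with first coordinate 0, to which [a] is Sigma-orthogonal. In
    probabilistic terms [E (r x_1) = E r^2], the limit of the averaged denominator. *)
Lemma row_rhoE : rho = dotv a (Sigma *m unit0).
Proof.
rewrite /rho [in LHS](_ : a = unit0 - emb gamma)// mulmxBr dotvBr.
by rewrite [X in _ - X]row_dir_orth ?emb0// subr0.
Qed.

(** The first coordinate of [a] is 1, so its norm is at least 1. *)
Lemma row_rho_ge : c <= rho.
Proof.
apply: le_trans (c_quad a); rewrite ler_peMr ?(ltW c_gt0)//.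
by have := coord_sqr_le a 0; rewrite node_dir_0 expr1n.
Qed.

Lemma unit0_dotv : dotv (unit0 : 'cV[R]_q.+1) unit0 = 1.
Proof. by rewrite dotv_delta mxE !eqxx. Qed.

(** Pythagoras in the Sigma inner product: [rho] is at most the variance of the first coordinate,
    whose sub-Gaussian bound is [2 * t^2]. *)
Lemma row_rho_le : rho <= 2 * t ^+ 2.
Proof.
have u1 : dotv (unit0 : 'cV[R]_q.+1) unit0 <= 1 by rewrite unit0_dotv.
have [_] := row_moment 1 nN u1; rewrite mulr1 mul1r expr1.
have [_ + ] := row_cov unit0 unit0 nN.
rewrite (_ : (fun w => _) = (fun w => dotv unit0 (x n w) ^+ (2 * 1))); last first.
  by apply/funext => w; rewrite muln1 expr2.
move=> ->; apply: le_trans.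
have e0E : unit0 = a + emb gamma by rewrite /a /node_dir subrK.
have -> : dotv unit0 (Sigma *m unit0) =
    dotv a (Sigma *m unit0) + dotv (emb gamma) (Sigma *m unit0).
  by rewrite -dotvDl -e0E.
rewrite row_rhoE lerDl.
have -> : dotv (emb gamma) (Sigma *m unit0) =
    dotv (emb gamma) (Sigma *m a) + dotv (emb gamma) (Sigma *m emb gamma).
  by rewrite -dotvDr -mulmxDr -e0E.
rewrite dotv_mulmx symS dotvC row_dir_orth ?emb0// add0r.
by apply: le_trans (c_quad _); rewrite mulr_ge0 ?(ltW c_gt0)// dotvv_ge0.
Qed.

Lemma row_dir_le : dotv a a <= 2 * t ^+ 2 / c.
Proof.
by rewrite ler_pdivlMr// mulrC (le_trans (c_quad a))// row_rho_le.
Qed.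

Lemma row_tauE : dotv tau (Sigma *m tau) = 1.
Proof.
have [H [[symH _] HH] Ht] := sis_tau sis.
have := norm2_sqr (H *m tau); rewrite Ht expr1n dotv_mulmx symH mulmxA HH dotvC.
by move=> <-.
Qed.

Lemma row_tau_le : dotv tau tau <= c^-1.
Proof.
have := c_quad tau; rewrite row_tauE -ler_pdivlMl// mulr1; exact.
Qed.

Let my : measurable_fun setT (fun w => `|y n w| `^ (2 + alpha)).
Proof.
exact: (measurableT_comp (measurable_powR (2 + alpha))
  (measurableT_comp (@normr_measurable R setT) _)).
Qed.

Lemma row_ypow : L1 P (fun w => `|y n w| `^ (2 + alpha)) /\
  Ex P (fun w => `|y n w| `^ (2 + alpha)) <= M.
Proof.
have iy : L1 P (fun w => `|y n w| `^ (2 + alpha)).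
  apply/integrableP; split; first exact/measurable_EFinP.
  under eq_integral do rewrite /= ger0_norm ?powR_ge0//.
  by move: yM; rewrite unlock => yM'; rewrite (le_lt_trans yM') ?ltry.
by split => //; rewrite -lee_fin -L1_expectation.
Qed.

Lemma row_M_ge0 : 0 <= M.
Proof. by apply: le_trans row_ypow.2; apply: Ex_ge0 => w; exact: powR_ge0. Qed.

Lemma row_y2 : L1 P (fun w => y n w ^+ 2) /\ Ex P (fun w => y n w ^+ 2) <= 1 + M.
Proof.
have [iy Ey] := row_ypow.
have le w : y n w ^+ 2 <= 1 + `|y n w| `^ (2 + alpha).
  rewrite -(real_normK (num_real (y n w))); have y0 := normr_ge0 (y n w).
  have [y1|/ltW y1] := leP `|y n w| 1.
    rewrite -[leLHS]addr0 lerD ?powR_ge0//; by rewrite expr_le1.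
  rewrite -[leLHS]add0r lerD// -powR_mulrn//; apply: ler_powR => //.
  by rewrite lerDl ltW.
have i1 : L1 P (fun w => 1 + `|y n w| `^ (2 + alpha)).
  by apply: L1D => //; exact: L1_cst.
have i2 : L1 P (fun w => y n w ^+ 2).
  by apply: (L1_dom _ i1) => [|w]; [exact: measurable_funX|rewrite ger0_norm ?sqr_ge0].
split => //; apply: le_trans (le_Ex i2 i1 le) _.
by rewrite ExD ?Ex_cst ?lerD2l//; exact: L1_cst.
Qed.

Let xtau_sqr i : (0 < i <= n + n)%N ->
  L1 P (fun w => dotv (x i w) tau ^+ 2) /\
  Ex P (fun w => dotv (x i w) tau ^+ 2) = 1.
Proof.
move=> iN; have := row_cov tau tau iN; rewrite row_tauE.
rewrite (_ : (fun w => _) = (fun w => dotv (x i w) tau ^+ 2))//.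
by apply/funext => w; rewrite expr2 dotvC.
Qed.

Let mxtau i : measurable_fun setT (fun w => dotv (x i w) tau).
Proof.
have mx : measurable_fun setT (x i) by [].
exact: (measurableT_comp (measurable_dotvr tau) mx).
Qed.

Lemma row_mu_le : `|index_mu P tau (x n) (y n)| <= 2 + M.
Proof.
rewrite /index_mu fine_expectation; have [iy Ey] := row_y2.
have [it Et] := xtau_sqr nN.
have iyt : L1 P (fun w => y n w * dotv (x n w) tau).
  by apply: L1M_sqr.
apply: le_trans (norm_Ex iyt) _.
apply: (@le_trans _ _ (Ex P (fun w => y n w ^+ 2 + dotv (x n w) tau ^+ 2))).
  apply: le_Ex; [exact: L1_norm|exact: L1D|move=> w].
  rewrite normrM -(real_normK (num_real (y n w))) -(real_normK (num_real (dotv _ _))).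
  have := sqr_ge0 (`|y n w| - `|dotv (x n w) tau|).
  have := normr_ge0 (y n w); have := normr_ge0 (dotv (x n w) tau); nra.
by rewrite ExD// Et; lra.
Qed.

Lemma row_beta_le : dotv beta beta <= (2 + M) ^+ 2 / c.
Proof.
rewrite /beta /index_beta dotvZl dotvZr mulrA -expr2.
have M0 := row_M_ge0; apply: ler_pM; rewrite ?sqr_ge0 ?dotvv_ge0 ?row_tau_le//.
rewrite -real_normK ?num_real//.
by apply: lerXn2r; rewrite ?nnegrE ?row_mu_le//; lra.
Qed.

Let phr (o : 'cV[R]_q.+1 * R) := dotv a o.1.
Let phz (o : 'cV[R]_q.+1 * R) := f (dotv o.1 tau, o.2) - dotv o.1 beta.

Let mphr : measurable_fun setT phr.
Proof. exact: (measurableT_comp (measurable_dotv a)). Qed.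

Let mphz : measurable_fun setT phz.
Proof.
apply: measurable_funB; last exact: (measurableT_comp (measurable_dotvr beta)).
apply: (measurableT_comp (sis_link_measurable sis)).
by apply: measurable_fun_pair => //; exact: (measurableT_comp (measurable_dotvr tau)).
Qed.

Let phrE i w : r i w = phr (x i w, u i w).
Proof. exact: row_rE. Qed.

Let phzE i w : (0 < i <= n + n)%N -> z i w = phz (x i w, u i w).
Proof. by move=> iN; rewrite /z /index_z /phz /= (sis_model sis iN). Qed.

Lemma row_transfer i (g : R * R -> R) : (0 < i <= n + n)%N -> measurable_fun setT g ->
    L1 P (fun w => g (r n w, z n w)) ->
  L1 P (fun w => g (r i w, z i w)) /\
  Ex P (fun w => g (r i w, z i w)) = Ex P (fun w => g (r n w, z n w)).
Proof.
move=> iN mg.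
have E j : (0 < j <= n + n)%N ->
    (fun w => g (r j w, z j w)) = (fun w => (fun o => g (phr o, phz o)) (x j w, u j w)).
  by move=> jN; apply/funext => w; rewrite phrE phzE.
rewrite !E// => ig.
apply: (@obs_transfer _ _ _ _ _ _ _ _ _ _ _ _ _ sis n i
  (fun o => g (phr o, phz o))) => //.
by apply: (measurableT_comp mg); exact: measurable_fun_pair.
Qed.

Lemma row_measurable_r (J : set nat) i : (0 < i <= n + n)%N -> J i ->
  measurable_fun setT (r i : @block _ _ _ P (n + n) _ x u J -> R).
Proof.
move=> iN Ji; rewrite (_ : r i = fun w => dotv a (x i w)); last first.
  by apply/funext => w; rewrite row_rE.
exact: (measurableT_comp (measurable_dotv a) (@x_block _ _ _ P (n + n) _ x u J i iN Ji)).
Qed.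

Lemma row_measurable_z (J : set nat) i : (0 < i <= n + n)%N -> J i ->
  measurable_fun setT (z i : @block _ _ _ P (n + n) _ x u J -> R).
Proof.
move=> iN Ji; apply: measurable_funB; first exact: (y_block sis iN Ji).
exact: (measurableT_comp (measurable_dotvr beta) (@x_block _ _ _ P (n + n) _ x u J i iN Ji)).
Qed.

Lemma row_mr i : measurable_fun setT (r i).
Proof.
rewrite (_ : r i = fun w => dotv a (x i w)); last first.
  by apply/funext => w; rewrite row_rE.
have mx : measurable_fun setT (x i) by [].
exact: (measurableT_comp (measurable_dotv a) mx).
Qed.

Lemma row_mz i : measurable_fun setT (z i).
Proof.
apply: measurable_funB => //; have mx : measurable_fun setT (x i) by [].
exact: (measurableT_comp (measurable_dotvr beta) mx).
Qed.

Lemma row_z2 : L1 P (fun w => z n w ^+ 2).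
Proof.
have [iy _] := row_y2; have [ib _] := row_cov beta beta nN.
have mz := row_mz n.
apply: (L1_dom _ (L1Z 2 (L1D iy ib))) => [|w]; first exact: measurable_funX.
rewrite ger0_norm ?sqr_ge0// /z /index_z (dotvC _ beta).
by have := sqr_ge0 (y n w + dotv beta (x n w)); lra.
Qed.

(** Split [a = h + k tau] with [h] Sigma-orthogonal to [tau]. The [h] part is uncorrelated with [y]
    by reflection; the [tau] part contributes [k * mu], which is exactly the covariance of [r] with
    [<x, beta>] since [beta = mu tau]. *)
Lemma row_Erz : L1 P (fun w => r n w * z n w) /\ Ex P (fun w => r n w * z n w) = 0.
Proof.
have irz : L1 P (fun w => r n w * z n w).
  apply: L1M_sqr; [exact: row_mr|exact: row_mz| |exact: row_z2].
  have [+ _] := row_cov a a nN; congr (L1 P); apply/funext => w.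
  by rewrite row_rE expr2.
split => //; pose k := dotv a (Sigma *m tau); pose h := a - k *: tau.
have hS : dotv h (Sigma *m tau) = 0.
  by rewrite (dotvBl a) (dotvZl k) row_tauE mulr1 subrr.
have [iy2 _] := row_y2; have mx : measurable_fun setT (x n) by [].
have iby (b : 'cV[R]_q.+1) : L1 P (fun w => dotv b (x n w) * y n w).
  apply: L1M_sqr => //; first exact: (measurableT_comp (measurable_dotv b) mx).
  by have [+ _] := row_cov b b nN; congr (L1 P); apply/funext => w; rewrite expr2.
have Ehy := response_uncorrelated sis nN hS (iby h).
have Ety : Ex P (fun w => dotv tau (x n w) * y n w) = index_mu P tau (x n) (y n).
  rewrite /index_mu fine_expectation; congr (Ex P); apply/funext => w.
  by rewrite mulrC dotvC.
have [iab Eab] := row_cov a beta nN.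
have -> : (fun w => r n w * z n w) = (fun w => (dotv h (x n w) * y n w +
    k * (dotv tau (x n w) * y n w)) - dotv a (x n w) * dotv beta (x n w)).
  apply/funext => w; rewrite row_rE /z /index_z /h (dotvBl a (k *: tau)).
  rewrite (dotvZl k tau) (dotvC _ beta).
  by ring.
have i2 := L1Z k (iby tau).
rewrite ExB//; last exact: L1D.
rewrite ExD// ExZ// Ehy Ety Eab /beta /index_beta -scalemxAr dotvZr -/k.
by ring.
Qed.

(** The vectors [beta] and [a] enter only through bounds on their norms, so the value is common to
    all rows. *)
Definition row_K k : R := 1 + M + 2 * k%:R ^+ k * ((2 + M) ^+ 2 / c * t ^+ 2) ^+ k +
  2 * k%:R ^+ k * (2 * t ^+ 2 / c * t ^+ 2) ^+ k.

Lemma row_dom k :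
  L1 P (fun w => 1 + `|y n w| `^ (2 + alpha) + dotv (x n w) beta ^+ (2 * k) +
    r n w ^+ (2 * k)) /\
  Ex P (fun w => 1 + `|y n w| `^ (2 + alpha) + dotv (x n w) beta ^+ (2 * k) +
    r n w ^+ (2 * k)) <= row_K k.
Proof.
have [iy Ey] := row_ypow.
have := row_moment k nN row_beta_le.
rewrite (_ : (fun w => _) = (fun w => dotv (x n w) beta ^+ (2 * k))); last first.
  by apply/funext => w; rewrite dotvC.
move=> [ib Eb]; have := row_moment k nN row_dir_le.
rewrite (_ : (fun w => _) = (fun w => r n w ^+ (2 * k))); last first.
  by apply/funext => w; rewrite row_rE.
move=> [ir Er].
have i1 : L1 P (fun w => 1 + `|y n w| `^ (2 + alpha)).
  by apply: L1D => //; exact: L1_cst.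
have i2 := L1D i1 ib; have i3 := L1D i2 ir.
split => //; rewrite !ExD//; last exact: L1_cst.
by rewrite Ex_cst /row_K; lra.
Qed.

(** * The normalized summands of the main term *)

Section normalized.
Variables (s0 sd : R) (k : nat) (C : R).
Hypothesis s0_gt0 : 0 < s0.
Hypothesis s0_le : s0 <= sd.
Hypothesis tailb : forall L r0 y0 v : R, 0 < L ->
  (if `|r0 * (y0 - v) / sd| <= L then 0 else (r0 * (y0 - v) / sd) ^+ 2) <=
    (L `^ (alpha / 2) * s0 `^ (2 + alpha / 2))^-1 *
    (C * (1 + `|y0| `^ (2 + alpha) + v ^+ (2 * k) + r0 ^+ (2 * k))).
Hypothesis C_gt0 : 0 < C.
Hypothesis sdE : sd ^+ 2 = Ex P (fun w => r n w ^+ 2 * z n w ^+ 2).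

Let sd_gt0 : 0 < sd. Proof. exact: lt_le_trans s0_le. Qed.

Let g (o : R * R) := o.1 * o.2 / sd.

Let mg : measurable_fun setT g.
Proof. by apply: measurable_funM => //; exact: measurable_funM. Qed.

Let tl L (v : R) := if `|v| <= L then 0 else v ^+ 2.

Let mtl L : measurable_fun setT (tl L).
Proof.
apply: measurable_fun_ifT => //.
by apply: measurable_fun_ler => //; exact: normr_measurable.
Qed.

Let tl_le L v : 0 < L -> v ^+ 2 <= L ^+ 2 + tl L v.
Proof.
move=> L0; rewrite /tl; case: ifPn => vL; last by rewrite lerDr sqr_ge0.
by rewrite addr0 -(real_normK (num_real v)) lerXn2r// nnegrE// ltW.
Qed.

Lemma row_tail_n L : 0 < L ->
  L1 P (fun w => tl L (g (r n w, z n w))) /\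
  Ex P (fun w => tl L (g (r n w, z n w))) <=
    (L `^ (alpha / 2) * s0 `^ (2 + alpha / 2))^-1 * (C * row_K k).
Proof.
move=> L0; have [iD ED] := row_dom k.
have c0 : 0 <= (L `^ (alpha / 2) * s0 `^ (2 + alpha / 2))^-1 * C.
  by rewrite mulr_ge0 ?(ltW C_gt0)// invr_ge0 mulr_ge0// powR_ge0.
have iD' := L1Z ((L `^ (alpha / 2) * s0 `^ (2 + alpha / 2))^-1 * C) iD.
have tl0 v : 0 <= tl L v by rewrite /tl; case: ifP => // _; exact: sqr_ge0.
have le w : tl L (g (r n w, z n w)) <=
    (L `^ (alpha / 2) * s0 `^ (2 + alpha / 2))^-1 * C *
    (1 + `|y n w| `^ (2 + alpha) + dotv (x n w) beta ^+ (2 * k) + r n w ^+ (2 * k)).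
  by rewrite -mulrA; exact: tailb.
have mrz : measurable_fun setT (fun w => (r n w, z n w)).
  by apply: measurable_fun_pair; [exact: row_mr|exact: row_mz].
have it : L1 P (fun w => tl L (g (r n w, z n w))).
  apply: (L1_dom _ iD') => [|w]; last by rewrite ger0_norm.
  exact: (measurableT_comp (mtl L) (measurableT_comp mg mrz)).
split => //; apply: le_trans (le_Ex it iD' le) _.
by rewrite ExZ// -mulrA mulrA [leRHS]mulrA ler_wpM2l.
Qed.

Lemma row_tail i L : (0 < i <= n + n)%N -> 0 < L ->
  Ex P (fun w => if `|r i w * z i w / sd| <= L then 0 else (r i w * z i w / sd) ^+ 2) <=
    (L `^ (alpha / 2) * s0 `^ (2 + alpha / 2))^-1 * (C * row_K k).
Proof.
move=> iN L0; have [it Et] := row_tail_n L0.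
have mtg : measurable_fun setT (fun o => tl L (g o)) by exact: measurableT_comp.
by have [_ E] := row_transfer iN mtg it; rewrite -E in Et.
Qed.

(** Square integrability comes from the tail bound at level 1: the square is at most 1 plus its part
    above that level. With it, [sdE] can be read as a genuine second moment. *)
Lemma row_L2 i : (0 < i <= n + n)%N ->
  L1 P (fun w => (r i w * z i w / sd) ^+ 2) /\
  Ex P (fun w => (r i w * z i w / sd) ^+ 2) = 1.
Proof.
move=> iN; have [it _] := row_tail_n ltr01.
have mrz : measurable_fun setT (fun w => (r n w, z n w)).
  by apply: measurable_fun_pair; [exact: row_mr|exact: row_mz].
have mg2 : measurable_fun setT (fun o => g o ^+ 2) by exact: measurable_funX.
have i1 : L1 P (fun w => 1 ^+ 2 + tl 1 (g (r n w, z n w))).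
  by apply: L1D => //; exact: L1_cst.
have i2 : L1 P (fun w => g (r n w, z n w) ^+ 2).
  apply: (L1_dom _ i1) => [|w]; first exact: (measurableT_comp mg2 mrz).
  by rewrite ger0_norm ?sqr_ge0// tl_le.
have [iG EG] := row_transfer iN mg2 i2.
split; [exact: iG|rewrite [LHS]EG].
have E : (fun w => r n w ^+ 2 * z n w ^+ 2) = (fun w => sd ^+ 2 * g (r n w, z n w) ^+ 2).
  by apply/funext => w; rewrite /g -!exprMn [sd * _]mulrC divfK// gt_eqF.
have sd2 : sd ^+ 2 != 0 by rewrite gt_eqF// exprn_gt0.
by apply: (mulfI sd2); rewrite mulr1 -ExZ// -E sdE.
Qed.

Lemma row_mean i : (0 < i <= n + n)%N -> Ex P (fun w => r i w * z i w / sd) = 0.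
Proof.
move=> iN; have [irz Erz] := row_Erz.
have E : (fun w => g (r n w, z n w)) = (fun w => sd^-1 * (r n w * z n w)).
  by apply/funext => w; rewrite /g mulrC.
have ig : L1 P (fun w => g (r n w, z n w)) by rewrite E; exact: L1Z.
have [_ ->] := row_transfer iN mg ig.
by rewrite E ExZ// Erz mulr0.
Qed.

Let X i w := r i w * z i w / sd.

Let mX i : measurable_fun setT (X i).
Proof.
by apply: measurable_funM => //; apply: measurable_funM; [exact: row_mr|exact: row_mz].
Qed.

Let X_block (J : set nat) i : (0 < i <= n + n)%N -> J i ->
  measurable_fun setT (X i : @block _ _ _ P (n + n) _ x u J -> R).
Proof.
move=> iN Ji; apply: measurable_funM => //.
by apply: measurable_funM; [exact: row_measurable_r|exact: row_measurable_z].
Qed.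

Let ordN (i : 'I_n) : (0 < i.+1 <= n + n)%N.
Proof. by rewrite /= (leq_trans (ltn_ord i))// leq_addr. Qed.

Lemma row_ind_sum (i : 'I_n) :
  indep_fun P (X i.+1) (fun w => \sum_(j < n | j != i) X j.+1 w).
Proof.
apply: (block_indep sis (J := [set i.+1]) (K := ~` [set i.+1])).
- by move=> j -> /=.
- by apply: X_block => //; exact: ordN.
- rewrite (_ : (fun w => _) = fun w => \sum_(j < n) if j != i then X j.+1 w else 0).
    apply: measurable_sum => j; have [_|ji] := eqVneq j i; first exact: measurable_cst.
    apply: X_block => //=; first exact: ordN.
    by move=> [] /val_inj /eqP; rewrite (negbTE ji).
  by apply/funext => w; rewrite big_mkcond.
Qed.

(** Pairwise independence and centring leave only the diagonal terms. Chebyshev's inequality will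
    turn this into tightness of the main term. *)
Lemma row_clt_le :
  Ex P (fun w => ((Num.sqrt n%:R)^-1 * \sum_(i < n) X i.+1 w) ^+ 2) <= 1 /\
  L1 P (fun w => ((Num.sqrt n%:R)^-1 * \sum_(i < n) X i.+1 w) ^+ 2).
Proof.
have X2 (i : 'I_n) := row_L2 (ordN i).
have [||||iS ES] := @Ex_sum_sqr _ _ _ P n (fun i => X i.+1) 1.
- by move=> i; exact: mX.
- by move=> i; have [] := X2 i.
- by move=> i; have [_ ->] := X2 i.
- move=> i j ij; have iXL k' : (0 < k' <= n + n)%N -> L1 P (X k').
    by move=> kN; apply: L1_sqr => //; have [] := row_L2 kN.
  have ind : indep_fun P (X i.+1) (X j.+1).
    apply: (block_indep sis (J := [set i.+1]) (K := [set j.+1])).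
    + by move=> l -> [] /val_inj /eqP; rewrite (negbTE ij).
    + by apply: X_block => //; exact: ordN.
    + by apply: X_block => //; exact: ordN.
  have [_ ->] := indep_fun_Ex (iXL _ (ordN i)) (iXL _ (ordN j)) ind.
  by rewrite [Ex P (X _)]row_mean ?mul0r//; exact: ordN.
have n0 : 0 < n%:R :> R by rewrite ltr0n.
have E : (fun w => ((Num.sqrt n%:R)^-1 * \sum_(i < n) X i.+1 w) ^+ 2) =
    (fun w => n%:R^-1 * (\sum_(i < n) X i.+1 w) ^+ 2).
  by apply/funext => w; rewrite exprMn exprVn sqr_sqrtr ?ler0n.
rewrite E; split; last exact: L1Z.
rewrite ExZ// mulrC ler_pdivrMr// mul1r; lra.
Qed.

End normalized.

(** * Second moments of the denominator and of the remainder *)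

Let mx i : measurable_fun setT (x i). Proof. by []. Qed.

Let ordN (i : 'I_n) : (0 < i.+1 <= n + n)%N.
Proof. by rewrite /= (leq_trans (ltn_ord i))// leq_addr. Qed.

(** The sub-Gaussian bound [2 * k^k * (K * t^2)^k] at [k = 2], with the norm bound [K = 2 * t^2 / c]
    of [row_dir_le]. *)
Let A4 : R := 8 * (2 * t ^+ 2 / c * t ^+ 2) ^+ 2.

Let r4 i : (0 < i <= n + n)%N ->
  L1 P (fun w => r i w ^+ 4) /\ Ex P (fun w => r i w ^+ 4) <= A4.
Proof.
move=> iN; have := row_moment 2 iN row_dir_le.
rewrite (_ : (fun w => _) = (fun w => r i w ^+ 4)); last first.
  by apply/funext => w; rewrite row_rE.
by rewrite /A4 (_ : 2 * 2%:R ^+ 2 = 8 :> R)//; ring.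
Qed.

Let b4 i (b : 'cV[R]_q.+1) : (0 < i <= n + n)%N ->
  L1 P (fun w => dotv b (x i w) ^+ 4) /\
  Ex P (fun w => dotv b (x i w) ^+ 4) <= 8 * t ^+ 4 * dotv b b ^+ 2.
Proof.
move=> iN; have [i4 E4] := row_moment 2 iN (lexx (dotv b b)).
split; first exact: i4.
apply: le_trans E4 _; rewrite le_eqVlt; apply/orP; left; apply/eqP.
by rewrite (_ : 2%:R ^+ 2 = 4 :> R); ring.
Qed.

(* AM-GM at the scale [k = dotv b b]:
   [r^2 <b,x>^2 <= (k r^4 + k^-1 <b,x>^4) / 2] *)
Lemma row_rb2 i (b : 'cV[R]_q.+1) : (0 < i <= n + n)%N ->
  L1 P (fun w => (r i w * dotv b (x i w)) ^+ 2) /\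
  Ex P (fun w => (r i w * dotv b (x i w)) ^+ 2) <= (A4 + 8 * t ^+ 4) * dotv b b.
Proof.
move=> iN; have [ir4 Er4] := r4 iN; have [ib Eb] := b4 b iN.
have [->|b0] := eqVneq b 0.
  have E (v : 'cV[R]_q.+1) : dotv 0 v = 0.
    by rewrite /dotv big1// => j _; rewrite mxE mul0r.
  rewrite (_ : (fun w => _) = cst 0); last first.
    by apply/funext => w; rewrite E mulr0 expr0n.
  by rewrite E mulr0 Ex_cst; split => //; exact: L1_cst.
have k0 : 0 < dotv b b by rewrite lt_def dotvv_eq0 b0 dotvv_ge0.
set k := dotv b b in k0 Eb *.
have iD := L1D (L1Z k ir4) (L1Z k^-1 ib).
have le w : (r i w * dotv b (x i w)) ^+ 2 <=
    k * r i w ^+ 4 + k^-1 * dotv b (x i w) ^+ 4.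
  have := sqr_ge0 (k * r i w ^+ 2 - dotv b (x i w) ^+ 2).
  have -> : k * r i w ^+ 4 + k^-1 * dotv b (x i w) ^+ 4 =
      (k ^+ 2 * r i w ^+ 4 + dotv b (x i w) ^+ 4) / k by field; rewrite gt_eqF.
  rewrite ler_pdivlMr//.
  have := mulr_ge0 (ltW k0) (sqr_ge0 (r i w * dotv b (x i w))).
  lra.
have mrb : measurable_fun setT (fun w => (r i w * dotv b (x i w)) ^+ 2).
  apply: measurable_funX; apply: measurable_funM; first exact: row_mr.
  exact: (measurableT_comp (measurable_dotv b) (mx i)).
have i2 : L1 P (fun w => (r i w * dotv b (x i w)) ^+ 2).
  by apply: (L1_dom mrb iD) => w; rewrite ger0_norm ?sqr_ge0.
split => //; apply: le_trans (le_Ex i2 iD le) _.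
rewrite ExD ?ExZ//; try exact: L1Z.
have -> : (A4 + 8 * t ^+ 4) * k = k * A4 + k^-1 * (8 * t ^+ 4 * k ^+ 2).
  by field; rewrite gt_eqF.
by rewrite lerD// ler_wpM2l// ?invr_ge0 ltW.
Qed.

(* The cross terms vanish by pairwise independence of the observations. *)
Let sum_var (phi : nat -> T -> R) v :
    (forall i, (0 < i <= n)%N -> measurable_fun setT (phi i)) ->
    (forall i (J : set nat), (0 < i <= n)%N -> J i ->
      measurable_fun setT (phi i : @block _ _ _ P (n + n) _ x u J -> R)) ->
    (forall i, (0 < i <= n)%N -> L1 P (fun w => phi i w ^+ 2) /\
      Ex P (fun w => phi i w ^+ 2) <= v /\ Ex P (phi i) = 0) ->
  L1 P (fun w => (\sum_(i < n) phi i.+1 w) ^+ 2) /\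
  Ex P (fun w => (\sum_(i < n) phi i.+1 w) ^+ 2) <= n%:R * v.
Proof.
move=> mphi bphi phi2.
have oN (i : 'I_n) : (0 < i.+1 <= n)%N by rewrite /= ltn_ord.
apply: Ex_sum_sqr.
- by move=> i; exact: mphi.
- by move=> i; have [] := phi2 _ (oN i).
- by move=> i; have [_ []] := phi2 _ (oN i).
move=> i j ij; have iL k' : (0 < k' <= n)%N -> L1 P (phi k').
  by move=> kN; apply: L1_sqr; [exact: mphi|have [] := phi2 _ kN].
have ind : indep_fun P (phi i.+1) (phi j.+1).
  apply: (block_indep sis (J := [set i.+1]) (K := [set j.+1])).
  + by move=> l -> [] /val_inj /eqP; rewrite (negbTE ij).
  + exact: bphi.
  + exact: bphi.
have [_ ->] := indep_fun_Ex (iL _ (oN i)) (iL _ (oN j)) ind.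
by have [_ [_ ->]] := phi2 _ (oN i); rewrite mul0r.
Qed.

Let leN i : (0 < i <= n)%N -> (0 < i <= n + n)%N.
Proof. by case/andP => -> /leq_trans -> //; rewrite leq_addr. Qed.

Let rb_block (b : 'cV[R]_q.+1) (k : R) (J : set nat) i : (0 < i <= n + n)%N -> J i ->
  measurable_fun setT
    ((fun w => r i w * dotv b (x i w) - k) : @block _ _ _ P (n + n) _ x u J -> R).
Proof.
move=> iN Ji; apply: measurable_funB => //; apply: measurable_funM.
  exact: row_measurable_r.
exact: (measurableT_comp (measurable_dotv b) (@x_block _ _ _ P (n + n) _ x u J i iN Ji)).
Qed.

Let mrb (b : 'cV[R]_q.+1) (k : R) i :
  measurable_fun setT (fun w => r i w * dotv b (x i w) - k).
Proof.
apply: measurable_funB => //; apply: measurable_funM; first exact: row_mr.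
exact: (measurableT_comp (measurable_dotv b) (mx i)).
Qed.

Let Erb i (b : 'cV[R]_q.+1) : (0 < i <= n + n)%N ->
  L1 P (fun w => r i w * dotv b (x i w)) /\
  Ex P (fun w => r i w * dotv b (x i w)) = dotv a (Sigma *m b).
Proof.
move=> iN; have := row_cov a b iN.
rewrite (_ : (fun w => _) = (fun w => r i w * dotv b (x i w)))//.
by apply/funext => w; rewrite row_rE.
Qed.

Definition row_C2 : R := A4 + 8 * t ^+ 4.

(** By [row_rhoE] each [r_i x_i1] has mean [rho], so this is the variance of a centred average of
    independent terms, divided by [rho^2 >= c^2]. *)
Lemma row_ratio :
  L1 P (fun w => ((n%:R * rho)^-1 *
    (\sum_(i < n) r i.+1 w * fst_coord (x i.+1 w)) - 1) ^+ 2) /\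
  Ex P (fun w => ((n%:R * rho)^-1 *
    (\sum_(i < n) r i.+1 w * fst_coord (x i.+1 w)) - 1) ^+ 2) <=
    (2 * row_C2 + 8 * t ^+ 4) / c ^+ 2 / n%:R.
Proof.
have n0 : 0 < n%:R :> R by rewrite ltr0n.
have rho0 : 0 < rho by apply: lt_le_trans row_rho_ge.
pose phi i w := r i w * dotv unit0 (x i w) - rho.
(* The value comes from [phi^2 <= 2 * (r x_1)^2 + 2 * rho^2], with [rho <= 2 * t^2] in the last
   term. *)
have [||| iS ES] := @sum_var phi (2 * row_C2 + 8 * t ^+ 4).
- by move=> i _; exact: mrb.
- by move=> i J iN Ji; apply: rb_block => //; exact: leN.
- move=> i /leN iN; have [irb2 Erb2] := row_rb2 unit0 iN.
  have [irb ErbE] := Erb unit0 iN.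
  rewrite unit0_dotv mulr1 -/row_C2 in Erb2.
  have iD : L1 P (fun w => 2 * (r i w * dotv unit0 (x i w)) ^+ 2 + 2 * rho ^+ 2).
    by apply: L1D; [exact: L1Z|exact: L1_cst].
  have le w : phi i w ^+ 2 <= 2 * (r i w * dotv unit0 (x i w)) ^+ 2 + 2 * rho ^+ 2.
    by rewrite /phi; have := sqr_ge0 (r i w * dotv unit0 (x i w) + rho); lra.
  have i2 : L1 P (fun w => phi i w ^+ 2).
    apply: (L1_dom _ iD) => [|w]; last by rewrite ger0_norm ?sqr_ge0.
    by apply: measurable_funX; exact: mrb.
  split=> //; split.
    apply: le_trans (le_Ex i2 iD le) _.
    rewrite ExD ?ExZ ?Ex_cst//; try exact: L1_cst; try exact: L1Z.
    have : rho ^+ 2 <= (2 * t ^+ 2) ^+ 2.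
      by apply: lerXn2r; rewrite ?nnegrE; have := row_rho_le; lra.
    have -> : (2 * t ^+ 2) ^+ 2 = 4 * t ^+ 4 by ring.
    lra.
  by rewrite /phi ExB ?Ex_cst ?ErbE -?row_rhoE ?subrr//; exact: L1_cst.
have E : (fun w => ((n%:R * rho)^-1 *
    (\sum_(i < n) r i.+1 w * fst_coord (x i.+1 w)) - 1) ^+ 2) =
    (fun w => (n%:R * rho) ^- 2 * (\sum_(i < n) phi i.+1 w) ^+ 2).
  apply/funext => w; rewrite -exprVn -exprMn; congr (_ ^+ _).
  rewrite /phi sumrB sumr_const card_ord -(mulr_natl rho) mulrBr mulVf; last first.
    by rewrite gt_eqF// mulr_gt0.
  congr (_ * _ - _); apply: eq_bigr => i _; by rewrite dotv_delta.
rewrite E; split; first exact: L1Z.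
rewrite ExZ// mulrC; set V := 2 * row_C2 + 8 * t ^+ 4 in ES *.
have V0 : 0 <= V.
  have : 0 <= n%:R * V by apply: le_trans ES; apply: Ex_ge0 => w; exact: sqr_ge0.
  by rewrite pmulr_rge0.
rewrite ler_pdivrMr ?exprn_gt0 ?mulr_gt0//; apply: le_trans ES _.
have -> : V / c ^+ 2 / n%:R * (n%:R * rho) ^+ 2 = n%:R * (V * (rho ^+ 2 / c ^+ 2)).
  by field; rewrite !gt_eqF.
rewrite ler_pM2l// ler_peMr// ler_pdivlMr ?exprn_gt0// mul1r.
by rewrite lerXn2r// ?nnegrE ?row_rho_ge// ltW.
Qed.

(** The sum is [<Y, D>] with [Y = sum r_i x_i] built from the first half. For fixed [b] with first
    coordinate 0 the summands of [<Y, b>] are centred by [row_dir_orth], so their variances add up;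
    [Ex_indep_quadratic] then replaces [b] by [D]. *)
Lemma row_remainder (D : T -> 'cV[R]_q.+1) k : measurable_fun setT D ->
    measurable_fun setT
      (D : @block _ _ _ P (n + n) _ x u [set i | (n < i)%N] -> 'cV[R]_q.+1) ->
    (forall w, D w 0 0 = 0 /\ dotv (D w) (D w) <= k ^+ 2) ->
  L1 P (fun w => (\sum_(i < n) r i.+1 w * dotv (x i.+1 w) (D w)) ^+ 2) /\
  Ex P (fun w => (\sum_(i < n) r i.+1 w * dotv (x i.+1 w) (D w)) ^+ 2) <=
    n%:R * row_C2 * k ^+ 2.
Proof.
move=> mD bD Dk.
pose Y w : 'cV[R]_q.+1 := \sum_(i < n) r i.+1 w *: x i.+1 w.
have YE w b : dotv (Y w) b = \sum_(i < n) r i.+1 w * dotv (x i.+1 w) b.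
  rewrite /Y; elim/big_rec2: _ => [|i u' v' _ <-].
    by rewrite /dotv big1// => j _; rewrite mxE mul0r.
  by rewrite dotvDl dotvZl.
have Yj w j : Y w j 0 = \sum_(i < n) (r i.+1 w * dotv (delta_mx j 0) (x i.+1 w) - 0).
  rewrite -[LHS]dotv_delta dotvC YE; apply: eq_bigr => i _.
  by rewrite subr0 dotvC.
have mY : measurable_fun setT Y.
  apply: measurable_mxP => j k0; rewrite ord1.
  rewrite (_ : (fun w => _) = fun w => \sum_(i < n)
      (r i.+1 w * dotv (delta_mx j 0) (x i.+1 w) - 0)).
    by apply: measurable_sum => i; exact: mrb.
  by apply/funext => w; rewrite Yj.
have bY : measurable_fun setT
    (Y : @block _ _ _ P (n + n) _ x u [set i | (i <= n)%N] -> 'cV[R]_q.+1).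
  apply: measurable_mxP => j k0; rewrite ord1.
  rewrite (_ : (fun w => _) = fun w => \sum_(i < n)
      (r i.+1 w * dotv (delta_mx j 0) (x i.+1 w) - 0)).
    by apply: measurable_sum => i; apply: rb_block; [exact: ordN|exact: ltn_ord].
  by apply/funext => w; rewrite Yj.
have YD : indep_fun P Y D.
  apply: (block_indep sis _ bY bD) => i /= iN Ni.
  by move: (leq_ltn_trans iN Ni); rewrite ltnn.
have iY j : L1 P (fun w => Y w j 0 ^+ 2).
  rewrite (_ : (fun w => _) = fun w => (\sum_(i < n)
      r i.+1 w * dotv (delta_mx j 0) (x i.+1 w)) ^+ 2); last first.
    by apply/funext => w; rewrite Yj; congr (_ ^+ _); apply: eq_bigr => i _; rewrite subr0.
  rewrite (_ : (fun w => _) = fun w => \sum_(i < n) \sum_(l < n)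
      (r i.+1 w * dotv (delta_mx j 0) (x i.+1 w)) *
      (r l.+1 w * dotv (delta_mx j 0) (x l.+1 w))); last first.
    apply/funext => w; rewrite expr2 mulr_suml; apply: eq_bigr => i _.
    by rewrite mulr_sumr.
  have mrb0 i : measurable_fun setT (fun w => r i w * dotv (delta_mx j 0) (x i w)).
    apply: measurable_funM; first exact: row_mr.
    exact: (measurableT_comp (measurable_dotv _) (mx i)).
  apply: L1_sum => i; apply: L1_sum => l; apply: L1M_sqr => //.
    by have [] := row_rb2 (delta_mx j 0) (ordN i).
  by have [] := row_rb2 (delta_mx j 0) (ordN l).
have C0 : 0 <= n%:R * row_C2.
  have t4 : 0 <= t ^+ 4.
    have -> : t ^+ 4 = (t ^+ 2) ^+ 2 by ring.
    exact: sqr_ge0.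
  have B0 := sqr_ge0 (2 * t ^+ 2 / c * t ^+ 2).
  by apply: mulr_ge0 => //; rewrite /row_C2 /A4; lra.
have EYb (b : 'cV[R]_q.+1) : [set b : 'cV[R]_q.+1 | b 0 0 = 0] b ->
    Ex P (fun w => dotv (Y w) b ^+ 2) <= n%:R * row_C2 * dotv b b.
  move=> /= b00; pose phi i w := r i w * dotv b (x i w) - 0.
  have [||| _ ES] := @sum_var phi (row_C2 * dotv b b).
  - by move=> i _; exact: mrb.
  - by move=> i J iN Ji; apply: rb_block => //; exact: leN.
  - move=> i /leN iN; have [irb2 Erb2] := row_rb2 b iN.
    have [irb ErbE] := Erb b iN.
    rewrite (_ : phi i = fun w => r i w * dotv b (x i w)); last first.
      by apply/funext => w; rewrite /phi subr0.
    by rewrite ErbE row_dir_orth.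
  rewrite -mulrA; apply: le_trans ES; rewrite le_eqVlt; apply/orP; left; apply/eqP.
  congr (Ex P); apply/funext => w; rewrite YE; congr (_ ^+ _).
  by apply: eq_bigr => i _; rewrite /phi subr0 dotvC.
have E : (fun w => (\sum_(i < n) r i.+1 w * dotv (x i.+1 w) (D w)) ^+ 2) =
    (fun w => dotv (Y w) (D w) ^+ 2) by apply/funext => w; rewrite YE.
rewrite E; exact: Ex_indep_quadratic mY mD YD iY Dk C0 EYb.
Qed.

(** * Error decomposition and bounds on the distribution function *)

Section conclusion.
Variable est : 'M[R]_(n, q.+1) * 'cV[R]_n -> 'cV[R]_q.+1.
Hypothesis mest : measurable_fun setT est.
Let bhat w := est (pilot_design n x w, pilot_response n y w).
Let sd2 : R := Ex P (fun w => r n w ^+ 2 * z n w ^+ 2).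
Let nu := asymptotic_sd P (r n) (z n).
Variables (cnu kappa : R).
Hypothesis cnu_gt0 : 0 < cnu.
Hypothesis cnu_le : cnu <= nu.
Hypothesis kappa_ge0 : 0 <= kappa.
Variable Xi : T -> R.
Hypothesis mXi : measurable_fun setT Xi.
Hypothesis XiE : forall w, Num.sqrt n%:R *
  (debiased n gamma x y bhat w - fst_coord beta) = nu * Xi w.

Let sd := Num.sqrt sd2.
Let n0 : 0 < n%:R :> R. Proof. by rewrite ltr0n. Qed.
Let rho0 : 0 < rho. Proof. exact: lt_le_trans row_rho_ge. Qed.

Let nuE : nu = sd / rho.
Proof.
rewrite /nu /asymptotic_sd !fine_expectation -/sd2.
have -> : Ex P (fun w => r n w ^+ 2) = rho.
  have [_ aa] := row_cov a a nN; rewrite -[RHS]aa; congr (Ex P).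
  by apply/funext => w; rewrite row_rE expr2.
have sd2_ge0 : 0 <= sd2.
  by apply: Ex_ge0 => w; rewrite mulr_ge0 ?sqr_ge0.
by rewrite sqrtrM// sqrtrV ?sqr_ge0// sqrtr_sqr gtr0_norm.
Qed.

(** A lower bound on [sd] that is free of [n], from [sd = nu * rho], [nu >= cnu] and [rho >= c]. *)
Let s0 := cnu * c.
Let s0_gt0 : 0 < s0. Proof. exact: mulr_gt0. Qed.

Let s0_le : s0 <= sd.
Proof.
move: cnu_le; rewrite nuE ler_pdivlMr// => h; apply: le_trans h.
by rewrite ler_wpM2l ?(ltW cnu_gt0)// row_rho_ge.
Qed.

Let sd_gt0 : 0 < sd. Proof. exact: lt_le_trans s0_le. Qed.

Let sdE : sd ^+ 2 = Ex P (fun w => r n w ^+ 2 * z n w ^+ 2).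
Proof.
by rewrite sqr_sqrtr//; apply: Ex_ge0 => w; rewrite mulr_ge0 ?sqr_ge0.
Qed.

Let W w : R := (Num.sqrt n%:R)^-1 * \sum_(i < n) (r i.+1 w * z i.+1 w / sd).
Let Q w : R := (n%:R * rho)^-1 * \sum_(i < n) r i.+1 w * fst_coord (x i.+1 w).
(** Truncation at radius [kappa] provides the boundedness that the conditioning argument requires,
    and changes nothing on [G]. *)
Let D w : 'cV[R]_q.+1 :=
  if norm2 (bhat w - beta) <= kappa then emb (other_coords (bhat w - beta)) else 0.
Let S w : R := \sum_(i < n) r i.+1 w * dotv (x i.+1 w) (D w).
Let E w : R := (Num.sqrt n%:R * sd)^-1 * S w.

Let mW : measurable_fun setT W.
Proof.
apply: measurable_funM => //; apply: measurable_sum => i.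
by apply: measurable_funM => //; apply: measurable_funM; [exact: row_mr|exact: row_mz].
Qed.

Let mQ : measurable_fun setT Q.
Proof.
apply: measurable_funM => //; apply: measurable_sum => i.
apply: measurable_funM; first exact: row_mr.
exact: (measurableT_comp (measurable_coord _ _) (mx _)).
Qed.

(** Isolating the truncation as a fixed function of the estimate gives the measurability of [D] both
    on [T] and on the block of the second half. *)
Let trunc (b : 'cV[R]_q.+1) : 'cV[R]_q.+1 :=
  if norm2 (b - beta) <= kappa then emb (other_coords (b - beta)) else 0.

Let norm2_measurable : measurable_fun setT (fun b : 'cV[R]_q.+1 => norm2 (b - beta)).
Proof.
have msqrt : measurable_fun setT (@Num.sqrt R).
  by apply: continuous_measurable_fun; exact: sqrt_continuous.
have mb : measurable_fun setT (fun b : 'cV[R]_q.+1 => b - beta).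
  apply: measurable_mxP => j k.
  rewrite (_ : (fun w => _) = fun b : 'cV[R]_q.+1 => b j k - beta j k); last first.
    by apply/funext => b; rewrite !mxE.
  by apply: measurable_funB => //; exact: measurable_coord.
exact: (measurableT_comp msqrt (measurable_dotv_fun mb mb)).
Qed.

Let mtrunc : measurable_fun setT trunc.
Proof.
apply: measurable_fun_ifT; last exact: measurable_cst.
  by apply: measurable_fun_ler => //; exact: norm2_measurable.
apply: measurable_mxP => j k; rewrite ord1.
have [l ->|->] := unliftP ord0 j.
  rewrite (_ : (fun w => _) = fun b : 'cV[R]_q.+1 =>
      b (lift ord0 l) 0 - beta (lift ord0 l) 0); last first.
    by apply/funext => b; rewrite embS !mxE.
  by apply: measurable_funB => //; exact: measurable_coord.
rewrite (_ : (fun w => _) = cst 0); first exact: measurable_cst.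
by apply/funext => b; rewrite emb0.
Qed.

Let blk := @block _ _ _ P (n + n) _ x u [set i | (n < i)%N].

Let bhat_block : measurable_fun setT (bhat : blk -> 'cV[R]_q.+1).
Proof.
apply: (measurableT_comp mest); apply: measurable_fun_pair.
  apply: measurable_mxP => i j.
  rewrite (_ : (fun w => _) = fun w => x (n + i.+1)%N w j 0); last first.
    by apply/funext => w; rewrite mxE.
  apply: (measurableT_comp (measurable_coord _ _)).
  (* Row [i] of the pilot design, counted from 0, is observation [n + i + 1]: strictly beyond [n]
     and at most [n + n]. *)
  apply: x_block; first by rewrite addnS /= ltn_add2l ltn_ord.
  by rewrite /= addnS ltnS leq_addr.
apply: measurable_mxP => i j.
rewrite (_ : (fun w => _) = y (n + i.+1)%N); last first.
  by apply/funext => w; rewrite mxE.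
apply: (y_block sis); first by rewrite addnS /= ltn_add2l ltn_ord.
by rewrite /= addnS ltnS leq_addr.
Qed.

Let mbhat : measurable_fun setT bhat.
Proof.
apply: (measurableT_comp mest); apply: measurable_fun_pair.
  apply: measurable_mxP => i j.
  rewrite (_ : (fun w => _) = fun w => x (n + i.+1)%N w j 0); last first.
    by apply/funext => w; rewrite mxE.
  exact: (measurableT_comp (measurable_coord _ _) (mx _)).
apply: measurable_mxP => i j.
rewrite (_ : (fun w => _) = y (n + i.+1)%N)//.
by apply/funext => w; rewrite mxE.
Qed.

Let mD : measurable_fun setT D.
Proof. exact: (measurableT_comp mtrunc mbhat). Qed.

Let bD : measurable_fun setT (D : blk -> 'cV[R]_q.+1).
Proof. exact: (measurableT_comp mtrunc bhat_block). Qed.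

Let Dk w : D w 0 0 = 0 /\ dotv (D w) (D w) <= kappa ^+ 2.
Proof.
rewrite /D; case: ifPn => [h|_]; last first.
  rewrite mxE; split => //; rewrite /dotv big1 ?sqr_ge0// => j _.
  by rewrite mxE mul0r.
rewrite emb0; split => //; set v := bhat w - beta in h *.
apply: (@le_trans _ _ (norm2 v ^+ 2)).
  rewrite norm2_sqr dotv_emb /dotv [leRHS]big_ord_recl.
  rewrite (eq_bigr (fun k => v (lift ord0 k) 0 * v (lift ord0 k) 0)).
    by rewrite lerDr -expr2 sqr_ge0.
  by move=> k _; rewrite /other_coords !mxE liftK /= !mxE.
by rewrite lerXn2r// ?nnegrE// sqrtr_ge0.
Qed.

Let G := [set w | norm2 (bhat w - beta) <= kappa].

Let mG : measurable G.
Proof.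
have mn := measurableT_comp norm2_measurable mbhat.
rewrite -[X in measurable X]setTI.
exact: (measurable_fun_le (f := fun w => norm2 (bhat w - beta)) (g := cst kappa)).
Qed.

Let mE : measurable_fun setT E.
Proof.
apply: measurable_funM => //; apply: measurable_sum => i.
apply: measurable_funM; first exact: row_mr.
exact: measurable_dotv_fun (mx _) mD.
Qed.

(** With a nonzero denominator the debiased error is [(A - S) / den]: the term [d1 * den] in the
    numerator cancels the initial error [d1]. Division by [nu = sd / rho] and rescaling give the
    ratio. *)
Let XiG w : G w -> Q w != 0 -> Xi w = (W w - E w) / Q w.
Proof.
move=> Gw Qw; have sn0 : 0 < Num.sqrt (n%:R : R) by rewrite sqrtr_gt0.
pose den := \sum_(i < n) r i.+1 w * fst_coord (x i.+1 w).
have den0 : den != 0 by apply: contra Qw => /eqP d0; rewrite /Q -/den d0 mulr0.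
pose A := \sum_(i < n) r i.+1 w * z i.+1 w.
have WE : W w = (Num.sqrt n%:R)^-1 * (A / sd) by rewrite /W -mulr_suml.
have QE : Q w = (n%:R * rho)^-1 * den by [].
have DE : D w = emb (other_coords (bhat w - beta)) by rewrite /D; move: Gw => /= ->.
have debE : debiased n gamma x y bhat w - fst_coord beta = (A - S w) / den.
  pose d1 := fst_coord (bhat w - beta).
  rewrite /debiased !big_add1 !big_mkord -/den.
  have -> : \sum_(i < n) nodewise_r gamma (x i.+1) w * (y i.+1 w - dotv (x i.+1 w) (bhat w)) =
      A - d1 * den - S w.
    rewrite /A /den /S mulr_sumr -!sumrB; apply: eq_bigr => i _.
    rewrite -/(r i.+1 w) /z /index_z DE.
    have -> : dotv (x i.+1 w) (bhat w) = dotv (x i.+1 w) beta +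
        (d1 * fst_coord (x i.+1 w) + dotv (x i.+1 w) (emb (other_coords (bhat w - beta)))).
      rewrite -{1}[bhat w](subrK beta) addrC dotvDr; congr (_ + _).
      rewrite [dotv _ (emb _)]dotvC dotv_emb /dotv big_ord_recl mulrC; congr (_ + _).
      by apply: eq_bigr => k _; rewrite /other_coords !mxE mulrC.
    by ring.
  have -> : fst_coord (bhat w) = fst_coord beta + d1.
    by rewrite /d1 /fst_coord !mxE; ring.
  by field.
have := XiE w; rewrite debE nuE => H.
have -> : Xi w = Num.sqrt n%:R * ((A - S w) / den) / (sd / rho).
  by rewrite H; field; rewrite !gt_eqF.
(* Writing [n] as the square of its root leaves [field] a single atom. *)
have nE : (n%:R * rho)^-1 = (Num.sqrt n%:R ^+ 2 * rho)^-1 by rewrite sqr_sqrtr ?ler0n.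
rewrite WE QE /E nE.
by field; rewrite den0 !gt_eqF.
Qed.

Lemma row_debiased_measurable : measurable_fun setT (debiased n gamma x y bhat).
Proof.
have mfst (g : T -> 'cV[R]_q.+1) : measurable_fun setT g ->
    measurable_fun setT (fun w => fst_coord (g w)).
  by move=> mg; exact: (measurableT_comp (measurable_coord _ _) mg).
apply: measurable_funD; first exact: mfst.
apply: measurable_funM.
  apply: measurable_sum => i; apply: measurable_funM; first exact: row_mr.
  by apply: measurable_funB => //; exact: measurable_dotv_fun (mx _) mbhat.
apply: measurable_fun_inv; apply: measurable_sum => i.
by apply: measurable_funM; [exact: row_mr|exact: mfst].
Qed.

(** Passing from [Xi] to [W] costs a shift by [dl] and the probability [close]. The normal
    approximation then costs the width of a ramp on the outer side, which is why [Phi] is taken at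
    [b1] above and at [a2] below. *)
Lemma row_conclusion k C L eta l dl a1 b1 A1 B1 a2 b2 A2 B2 t0 :
    (forall s L r y v sd : R, 0 < s -> s <= sd -> 0 < L ->
      (if `|r * (y - v) / sd| <= L then 0 else (r * (y - v) / sd) ^+ 2) <=
      (L `^ (alpha / 2) * s `^ (2 + alpha / 2))^-1 *
      (C * (1 + `|y| `^ (2 + alpha) + v ^+ (2 * k) + r ^+ (2 * k)))) ->
    0 < C -> 0 < L -> 0 < eta -> eta <= 2^-1 -> 0 < l -> 2 * eta * (l + 1) <= dl ->
    clt_constants a1 b1 A1 B1 -> clt_constants a2 b2 A2 B2 ->
    a1 = t0 + dl -> b2 = t0 - dl ->
  let tl := (L `^ (alpha / 2) * (cnu * c) `^ (2 + alpha / 2))^-1 * (C * row_K k) in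
  let err A B := B * (Num.sqrt n%:R)^-1 + (B * (Num.sqrt n%:R)^-1 * L + 2 * A * tl) in
  let close := 1 / l ^+ 2 + (2 * row_C2 + 8 * t ^+ 4) / c ^+ 2 / n%:R / eta ^+ 2 +
    row_C2 * kappa ^+ 2 / (cnu * c) ^+ 2 / eta ^+ 2 +
    (1 - Pr P [set w | norm2 (bhat w - beta) <= kappa]) in
  Pr P [set w | Xi w <= t0] <= Phi b1 + err A1 B1 + close /\
  Phi a2 - err A2 B2 - close <= Pr P [set w | Xi w <= t0].
Proof.
move=> tb C0 L0 eta0 eta1 l0 dlE clt1 clt2 a1E b2E tl err close.
have tb' (L' r0 y0 v : R) : 0 < L' ->
    (if `|r0 * (y0 - v) / sd| <= L' then 0 else (r0 * (y0 - v) / sd) ^+ 2) <=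
    (L' `^ (alpha / 2) * s0 `^ (2 + alpha / 2))^-1 *
    (C * (1 + `|y0| `^ (2 + alpha) + v ^+ (2 * k) + r0 ^+ (2 * k))).
  by move=> L'0; exact: tb.
have X2 (i : 'I_n) := row_L2 s0_gt0 s0_le tb' C0 sdE (ordN i).
have cltA A B a' b' : clt_constants a' b' A B ->
    Pr P [set w | W w <= a'] <= Phi b' + err A B /\
    Phi a' - err A B <= Pr P [set w | W w <= b'].
  move=> H; apply: (H _ _ P n (fun i w => r i.+1 w * z i.+1 w / sd) L tl n_gt0 (ltW L0)).
  - by move=> i; apply: measurable_funM => //; apply: measurable_funM;
      [exact: row_mr|exact: row_mz].
  - by move=> i; have [] := X2 i.
  - by move=> i; exact: (row_mean sd (ordN i)).
  - by move=> i; have [] := X2 i.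
  - by move=> i; exact: (row_ind_sum sd i).
  - by move=> i; exact: (row_tail tb' C0 (ordN i) L0).
have [EW iW] := row_clt_le s0_gt0 s0_le tb' C0 sdE.
have [iQ EQ] := row_ratio.
have [iS ES] := row_remainder mD bD Dk.
have iE : L1 P (fun w => E w ^+ 2) /\
    Ex P (fun w => E w ^+ 2) <= row_C2 * kappa ^+ 2 / (cnu * c) ^+ 2.
  have EE : (fun w => E w ^+ 2) = fun w => (n%:R * sd ^+ 2)^-1 * S w ^+ 2.
    apply/funext => w; rewrite /E exprMn exprVn exprMn sqr_sqrtr//; exact: ltW.
  have sd2_gt0 : 0 < sd ^+ 2 by rewrite exprn_gt0.
  rewrite EE; split; first exact: L1Z.
  rewrite ExZ// mulrC ler_pdivrMr; last by rewrite mulr_gt0.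
  have V0 : 0 <= row_C2 * kappa ^+ 2.
    have : 0 <= n%:R * (row_C2 * kappa ^+ 2).
      by rewrite mulrA; apply: (le_trans _ ES); apply: Ex_ge0 => w; exact: sqr_ge0.
    by rewrite pmulr_rge0.
  apply: le_trans ES _.
  have -> : row_C2 * kappa ^+ 2 / (cnu * c) ^+ 2 * (n%:R * sd ^+ 2) =
      n%:R * (row_C2 * kappa ^+ 2 * (sd ^+ 2 / (cnu * c) ^+ 2)).
    by field; rewrite !gt_eqF.
  rewrite -mulrA ler_pM2l// ler_peMr// ler_pdivlMr ?exprn_gt0// mul1r.
  by rewrite lerXn2r// ?nnegrE// ltW.
have [mB PB] := ratio_close mW mQ mE mXi mG iW EW iQ EQ iE.1 iE.2 XiG eta0 eta1 l0 dlE.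
have [up lo] := cdf_sandwich P t0 mW mXi mB.
have [c1 _] := cltA _ _ _ _ clt1; have [_ c2] := cltA _ _ _ _ clt2.
rewrite a1E in c1; rewrite b2E in c2.
have PB' : Pr P [set w | dl < `|Xi w - W w|] <= close by exact: PB.
by split; lra.
Qed.

End conclusion.

End row.

(** * Passage to the limit *)

Lemma Phi_lipschitz (R : realType) (x y : R) :
  `|Phi x - Phi y| <= normal_peak 1 * `|x - y|.
Proof.
apply: (is_derive_lipschitz (df := normal_pdf 0 1)) => z; first exact: is_derive_Phi.
by rewrite ger0_norm ?normal_pdf_ge0//; exact: phi_le.
Qed.

Lemma scaled_RV_ex (R : realType) (d : measure_display) (T : measurableType d)
    (P : probability T R) (b : T -> R) (s k : R) : measurable_fun setT b -> k != 0 ->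
  exists Xi : {RV P >-> R}, forall w, s * b w = k * Xi w.
Proof.
move=> mb k0; pose X w := s / k * b w.
have mX : measurable_fun setT X by exact: measurable_funM.
pose X' : {RV P >-> R} := HB.pack X (isMeasurableFun.Build _ _ _ _ X mX).
by exists X' => w; rewrite /X' /= /X mulrA mulrC -[LHS]mulrC; field.
Qed.

(** As [p] is a positive integer, [ln p] is either 0 or at least [ln 2]. This links the squared
    logarithm of the sparsity assumption to the single one in the pilot rate. *)
Lemma sparsity_ln_le (R : realType) (s : R) (p n : nat) : 0 <= s -> (0 < p)%N ->
  s * ln p%:R / n%:R <= (s * ln (p%:R : R) ^+ 2 / n%:R) / ln 2.
Proof.
move=> s0 p0; have l2 : 0 < ln (2 : R) by rewrite ln_gt0// ltr1n.
rewrite ler_pdivlMr//; have -> : s * ln p%:R / n%:R * ln 2 =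
  (s / n%:R) * (ln p%:R * ln (2 : R)) by ring.
have -> : s * ln (p%:R : R) ^+ 2 / n%:R = (s / n%:R) * (ln p%:R * ln p%:R) by ring.
rewrite ler_wpM2l ?divr_ge0//; case: p p0 => // -[_|p _].
  by rewrite ln1 !mul0r.
by rewrite ler_wpM2l ?ln_ge0 ?ler1n// ler_ln ?posrE ?ltr0n// ler_nat.
Qed.

Lemma near_natV_le (R : realType) (V e : R) : 0 < e -> \forall n \near \oo, V / n%:R <= e.
Proof.
move=> e0; near=> n.
have n0 : 0 < n%:R :> R by rewrite ltr0n; near: n; exists 1%N.
rewrite ler_pdivrMr// mulrC -ler_pdivrMr//; near: n; exact: nbhs_infty_ger.
Unshelve. all: by end_near. Qed.

Lemma near_sqrtV_le (R : realType) (V e : R) : 0 < e ->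
  \forall n \near \oo, V * (Num.sqrt n%:R)^-1 <= e.
Proof.
move=> e0; near=> n.
have n0 : 0 < n%:R :> R by rewrite ltr0n; near: n; exists 1%N.
have s0 : 0 < Num.sqrt (n%:R : R) by rewrite sqrtr_gt0.
rewrite ler_pdivrMr// mulrC -ler_pdivrMr//; apply: le_trans (ler_norm _) _.
rewrite -sqrtr_sqr; apply: ler_wsqrtr; near: n; exact: nbhs_infty_ger.
Unshelve. all: by end_near. Qed.

Lemma cdf_Pr (R : realType) (d : measure_display) (T : measurableType d)
    (P : probability T R) (X : {RV P >-> R}) (a : R) :
  cdf X a = (Pr P [set w | X w <= a])%:E.
Proof.
rewrite /cdf /distribution /pushforward.
have E : X @^-1` `]-oo, a] = [set w | X w <= a].
  by apply/seteqP; split => w; rewrite /= in_itv.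
rewrite E Pr_fin// -E; exact: measurable_funPTI.
Qed.

(* The dimension is p = (q n).+1; [est n] is the Lasso solver, so that the
   pilot estimator [bhat n] is a measurable function of the second half of the
   sample. *)
Theorem theorem17 (R : realType)
    (d : nat -> measure_display) (T : forall n, measurableType (d n))
    (P : forall n, probability (T n) R)
    (q : nat -> nat)
    (Sigma : forall n, 'M[R]_((q n).+1))
    (Fv : nat -> probability (measurableTypeR R) R)
    (tau : forall n, 'cV[R]_((q n).+1))
    (f : nat -> R * R -> R)
    (x : forall n, nat -> {RV P n >-> 'cV[R]_((q n).+1)})
    (u : forall n, nat -> {RV P n >-> R})
    (y : forall n, nat -> {RV P n >-> R})
    (lambda sigma_x sigma_z : nat -> R)
    (est : forall n, 'M[R]_(n, (q n).+1) * 'cV[R]_n -> 'cV[R]_((q n).+1)) :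
  let p n : R := (q n).+1%:R in
  let mu n : R := index_mu (P n) (tau n) (x n n) (y n n) in
  let beta n := index_beta (P n) (tau n) (x n n) (y n n) in
  let z n i := index_z (beta n) (x n i) (y n i) in
  let s n : R := (norm0 (beta n))%:R in
  let gamma n := nodewise_gamma (P n) (x n n) in
  let r n i := nodewise_r (gamma n) (x n i) in
  let nu n := asymptotic_sd (P n) (r n n) (z n n) in
  let bhat n w := est n (pilot_design n (x n) w, pilot_response n (y n) w) in
  let btilde n := debiased n (gamma n) (x n) (y n) (bhat n) in
  (* the model *)
  (forall n, (0 < n)%N ->
    single_index_sample (n + n) (Sigma n) (Fv n) (tau n) (f n)
      (x n) (u n) (y n)) ->
  (forall n, (0 < n)%N -> mu n != 0) ->
  (* the pilot estimator *)
  (forall n, (0 < n)%N -> (psi2_norm (P n) (z n n) <= (sigma_z n)%:E)%E) ->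
  (exists2 c : R, 0 < c & forall n, (0 < n)%N ->
    c * (sigma_x n * sigma_z n * Num.sqrt (ln (p n) / n%:R)) <= lambda n) ->
  (forall n, (0 < n)%N -> measurable_fun setT (est n)) ->
  (forall n, (0 < n)%N -> forall w,
    lasso_argmin (lambda n) (pilot_design n (x n) w) (pilot_response n (y n) w)
      (bhat n w)) ->
  (* assumption 1 *)
  (forall n i, (0 < n)%N -> (0 < i <= n + n)%N ->
    psi2_norm_vec_le (P n) (x n i) (sigma_x n)) ->
  (exists K : R, forall n, (0 < n)%N -> sigma_x n <= K) ->
  (* assumption 2, in a form that makes sense also when log p = 0 *)
  (fun n => s n * ln (p n) ^+ 2 / n%:R) @ \oo --> (0 : R) ->
  (* assumption 3 *)
  (exists c C : R, 0 < c /\ forall n, (0 < n)%N ->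
    [/\ c <= lambda_min (Sigma n), lambda_min (Sigma n) <= lambda_max (Sigma n)
      & lambda_max (Sigma n) <= C]) ->
  (* assumption 4 *)
  (exists alpha M : R, 0 < alpha /\ forall n, (0 < n)%N ->
    ('E_(P n)[fun w => (`|y n n w| `^ (2 + alpha))%R] <= M%:E)%E) ->
  (* assumption 5 *)
  (exists2 K : R, 0 < K &
    (fun n => P n [set w | norm2 (bhat n w - beta n) <=
                           K * Num.sqrt (s n * ln (p n) / n%:R)])
      @ \oo --> 1%:E) ->
  (* nondegeneracy: nu stays away from 0; the claim fails e.g. for the noiseless
     linear link, where nu = 0 but the estimation error is not 0 *)
  (exists2 c : R, 0 < c & forall n, (0 < n)%N -> c <= nu n) ->
  exists Xi : forall n, {RV P n >-> R},
    (forall n, (0 < n)%N -> forall w,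
      Num.sqrt n%:R * (btilde n w - fst_coord (beta n)) = nu n * Xi n w) /\
    cvg_in_distribution Xi (normal_prob 0 1).
Proof.
move=> p mu beta z s gamma r nu bhat btilde Hsis _ _ _ Hest _ Hsub [Ks HKs] Hsp
  [c [C_ [c0 Hc]]] [alpha [M [a0 HM]]] [K K0 Hgood] [cnu cnu0 Hnu].
(* The moment bounds require a scale strictly above the sub-Gaussian constant, hence the extra 1. *)
pose t := `|Ks| + 1.
have st n : (0 < n)%N -> sigma_x n < t.
  by move=> /HKs h; rewrite /t; have := ler_norm Ks; lra.
have cS n : (0 < n)%N -> c <= lambda_min (Sigma n) by move=> /Hc [].
have mbt n : (0 < n)%N -> measurable_fun setT (btilde n).
  by move=> n0; exact: row_debiased_measurable (Hest n n0).
(* The case [n = 0] is unconstrained; the zero variable serves as default. *)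
have XiP n : exists Xi : {RV P n >-> R}, (0 < n)%N -> forall w,
    Num.sqrt n%:R * (btilde n w - fst_coord (beta n)) = nu n * Xi w.
  have [n0|] := boolP (0 < n)%N; last by exists (cst 0).
  have mb : measurable_fun setT (fun w => btilde n w - fst_coord (beta n)).
    by apply: measurable_funB => //; exact: mbt.
  have nu0 : nu n != 0 by rewrite gt_eqF// (lt_le_trans cnu0)// Hnu.
  by have [Xi XiE] := scaled_RV_ex (P n) (Num.sqrt n%:R) mb nu0; exists Xi.
pose Xi n := sval (cid (XiP n)).
have XiE n : (0 < n)%N -> forall w,
  Num.sqrt n%:R * (btilde n w - fst_coord (beta n)) = nu n * Xi n w.
  exact: svalP (cid (XiP n)).
exists Xi; split => // x0 _.
rewrite [X in _ --> X](_ : _ = (Phi x0)%:E); last first.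
  by rewrite PhiE fineK//; exact: fin_num_measure.
apply: cvg_EFin; first by apply: nearW => n; rewrite cdf_Pr.
rewrite (_ : fine \o _ = fun n => Pr (P n) [set w | Xi n w <= x0]); last first.
  by apply/funext => n /=; rewrite cdf_Pr.
(* Seven errors of size [e'] will add up: one from the variation of [Phi], two from the normal
   approximation and four from [close]. *)
apply/cvgrPdist_le => e e0; pose e' := e / 8.
have e'0 : 0 < e' by rewrite divr_gt0.
pose pk : R := normal_peak 1.
have pk0 : 0 < pk by rewrite normal_peak_gt0 ?oner_neq0.
(* [pk] is a Lipschitz constant of [Phi], so a shift by [2 * dl] costs at most [e']: one [dl] for
   the distance from [Xi] to the main term, one for the width of the ramp. *)
pose dl := e' / (2 * pk).
have dl0 : 0 < dl by rewrite divr_gt0// mulr_gt0.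
have Phi_near (h : R) : `|h| <= 2 * dl -> `|Phi (x0 + h) - Phi x0| <= e'.
  move=> hd; apply: le_trans (Phi_lipschitz _ _) _; rewrite -/pk addrAC subrr add0r.
  rewrite mulrC -ler_pdivlMr//; apply: le_trans hd _.
  by rewrite /dl le_eqVlt; apply/orP; left; apply/eqP; field; rewrite gt_eqF.
have ab1 : x0 + dl < x0 + 2 * dl by lra.
have ab2 : x0 - 2 * dl < x0 - dl by lra.
have [A1 [B1 [A10 clt1]]] := clt_constants_ex ab1.
have [A2 [B2 [A20 clt2]]] := clt_constants_ex ab2.
have [k [C [C0 tb]]] := tail_bound a0.
pose CK := C * @row_K R t c M k.
pose sp := (cnu * c) `^ (2 + alpha / 2).
have sp0 : 0 < sp by rewrite powR_gt0// mulr_gt0.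
(* [L] will solve [L^(alpha/2) = Bg], and [Bg] is large enough to bring the tail term [2 * A * tl]
   of both ramps below [e']. The truncation level thus does not depend on [n]. *)
pose Bg := 1 + 2 * (A1 + A2) * `|CK| / sp / e'.
have Bg1 : 1 <= Bg.
  by rewrite /Bg lerDl !divr_ge0 ?mulr_ge0 ?addr_ge0//; exact: ltW.
have Bg0 : 0 < Bg by lra.
pose L := Bg `^ (2 / alpha).
have L0 : 0 < L by rewrite powR_gt0.
have LB : L `^ (alpha / 2) = Bg.
  rewrite /L -powRrM (_ : 2 / alpha * (alpha / 2) = 1) ?powRr1 ?ltW//.
  by field; rewrite gt_eqF.
pose tl := (L `^ (alpha / 2) * sp)^-1 * CK.
have tl_le A : 0 <= A -> A <= A1 + A2 -> 2 * A * tl <= e'.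
  move=> A0 AA; rewrite /tl LB mulrCA mulrC ler_pdivrMr ?mulr_gt0//.
  apply: (@le_trans _ _ (2 * (A1 + A2) * `|CK|)).
    apply: (@le_trans _ _ (2 * A * `|CK|)); first by rewrite ler_wpM2l ?mulr_ge0// ler_norm.
    by rewrite ler_wpM2r// ler_wpM2l.
  have -> : e' * (Bg * sp) = e' * sp + 2 * (A1 + A2) * `|CK|.
    by rewrite /Bg; field; rewrite !gt_eqF.
  by rewrite lerDr mulr_ge0// ltW.
pose l := 1 + e'^-1.
have e'V : 0 < e'^-1 by rewrite invr_gt0.
have l0 : 0 < l by rewrite /l; lra.
have l_le : 1 / l ^+ 2 <= e'.
  rewrite ler_pdivrMr ?exprn_gt0//.
  have -> : e' * l ^+ 2 = e' + 2 + e'^-1 by rewrite /l; field; rewrite gt_eqF.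
  lra.
pose eta := Num.min 2^-1 (dl / (2 * (l + 1))).
have l1 : 0 < 2 * (l + 1) by lra.
have eta0 : 0 < eta by rewrite lt_min invr_gt0 ltr0n divr_gt0.
have eta1 : eta <= 2^-1 by rewrite ge_min lexx.
have dlE : 2 * eta * (l + 1) <= dl.
  have : eta <= dl / (2 * (l + 1)) by rewrite ge_min lexx orbT.
  by rewrite ler_pdivlMr//; lra.
pose V1 := (2 * @row_C2 R t c + 8 * t ^+ 4) / c ^+ 2 / eta ^+ 2.
pose D := `|@row_C2 R t c| * K ^+ 2 / (cnu * c) ^+ 2 / eta ^+ 2.
have D0 : 0 <= D.
  by do 2?apply: divr_ge0; rewrite ?sqr_ge0//; apply: mulr_ge0; rewrite ?sqr_ge0.
have l2 : 0 < ln (2 : R) by rewrite ln_gt0// ltr1n.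
(* The 1 guards against [D = 0], and [ln 2] is the loss in [sparsity_ln_le]. *)
have e2 : 0 < e' / (D + 1) * ln 2 by rewrite mulr_gt0// divr_gt0//; lra.
have /fine_cvgP[_ /cvgrPdist_le/(_ _ e'0) good] := Hgood.
have /cvgrPdist_le/(_ _ e2) spars := Hsp.
(* All levels are fixed by now; what remains is to make [n^(-1/2)], [n^(-1)], the sparsity ratio and
   the probability of the bad event small. *)
near=> n.
have n0 : (0 < n)%N by near: n; exists 1%N.
pose X := s n * ln (p n) / n%:R.
have s0 : 0 <= s n by rewrite /s.
have X0 : 0 <= X by rewrite /X divr_ge0// mulr_ge0// ln_ge0// ler1n.
have DX : D * X <= e'.
  have : `|0 - s n * ln (p n) ^+ 2 / n%:R| <= e' / (D + 1) * ln 2 by near: n.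
  rewrite sub0r normrN => /(le_trans (ler_norm _)) h.
  have : X <= e' / (D + 1).
    by apply: le_trans (sparsity_ln_le _ s0 (ltn0Sn _)) _; rewrite ler_pdivrMr.
  rewrite ler_pdivlMr; last lra.
  lra.
pose kappa := K * Num.sqrt (s n * ln (p n) / n%:R).
have kap0 : 0 <= kappa by rewrite mulr_ge0 ?sqrtr_ge0// ltW.
have mXi : measurable_fun setT (Xi n) by [].
have [] := row_conclusion n0 (Hsis n n0) (fun i => Hsub n i n0) (st n n0) c0
  (cS n n0) a0 (HM n n0) (Hest n n0) cnu0 (Hnu n n0) kap0 mXi (XiE n n0)
  tb C0 L0 eta0 eta1 l0 dlE clt1 clt2 erefl erefl.
rewrite -/sp -/CK -/tl.
have T1 : 2 * A1 * tl <= e' by apply: tl_le => //; rewrite lerDl.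
have T2 : 2 * A2 * tl <= e' by apply: tl_le => //; rewrite lerDr.
have N1 : B1 * (1 + L) * (Num.sqrt n%:R)^-1 <= e' by near: n; exact: near_sqrtV_le.
have N2 : B2 * (1 + L) * (Num.sqrt n%:R)^-1 <= e' by near: n; exact: near_sqrtV_le.
have N3 : (2 * @row_C2 R t c + 8 * t ^+ 4) / c ^+ 2 / n%:R / eta ^+ 2 <= e'.
  by rewrite [leLHS]mulrAC; near: n; exact: near_natV_le.
have N4 : @row_C2 R t c * kappa ^+ 2 / (cnu * c) ^+ 2 / eta ^+ 2 <= e'.
  apply: le_trans DX; rewrite /kappa exprMn sqr_sqrtr// -/X /D.
  have -> : `|@row_C2 R t c| * K ^+ 2 / (cnu * c) ^+ 2 / eta ^+ 2 * X =
      `|@row_C2 R t c| * (K ^+ 2 * X) / (cnu * c) ^+ 2 / eta ^+ 2.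
    by ring.
  do 3?apply: ler_wpM2r; rewrite ?invr_ge0 ?sqr_ge0 ?ler_norm//.
  by apply: mulr_ge0; rewrite ?sqr_ge0.
have N5 : 1 - Pr (P n) [set w | norm2 (bhat n w - beta n) <= kappa] <= e'.
  by apply: le_trans (ler_norm _) _; rewrite /kappa; near: n; exact: good.
have P1 := Phi_near (2 * dl); have P2 := Phi_near (- (2 * dl)).
have dl2 : 0 <= 2 * dl by lra.
rewrite normrN ger0_norm// in P2; rewrite ger0_norm// in P1.
have {}P1 := P1 (lexx _); have {}P2 := P2 (lexx _).
move: P1 P2; rewrite !ler_norml => /andP[P1 P1'] /andP[P2 P2'] up lo.
by apply/andP; split; rewrite /e' in T1 T2 N1 N2 N3 N4 N5 P1 P1' P2 P2' l_le *; lra.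
Unshelve. all: by end_near. Qed.
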